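(* Let $H$ be a finite, simple, connected graph and let $\pi\colon T\to H$ be its universal cover. Let $M$ be a bounded operator on $\ell^2(V(T))$ which is symmetric, local, connected and pulled back from $H$. Then $M$ has a bounded inverse if and only if $M$ has a ratio system $r\colon E(H)\to\mathbb{C}\cup\{\infty\}$ with $\alpha(r)<1$. Furthermore, when $M$ is invertible, with Green function $G(x,y)=(M^{-1}\delta_x)(y)$, such a ratio system $r$ (with $\alpha(r)<1$) has the following property. Let $(u,v)$ be a directed edge of $T$ with $\pi((u,v))=e$, and let $w\in V(T)$ be such that $u$ lies on the unique path in $T$ from $w$ to $v$. Then $G(w,v)/G(w,u)=r_e$ whenever this generalized ratio is defined.
   Context: Graphs are simple and connected. $E(\cdot)$ denotes the set of directed edges: each undirected edge $\{u,v\}$ gives $(u,v)$ and $(v,u)$, and $(u,v)^{-1}=(v,u)$. We write $x\sim y$ for adjacency. For directed edges $e,f$ we write $e\to f$ if the head of $e$ is the tail of $f$ and $f\neq e^{-1}$. The universal cover $\pi\colon T\to H$ is a tree $T$ together with a graph homomorphism $\pi$ which, at every vertex $x$, restricts to a bijection between the edges at $x$ and the edges at $\pi(x)$. For a bounded operator $M$ on $\ell^2(V(T))$ set $M_{xy}=\langle\delta_x,M\delta_y\rangle$. We say $M$ is: - symmetric if $\overline{M}^*=M$; - local if $M_{xy}=0$ whenever $x,y$ are at distance greater than $1$; - connected if $M_{xy}\neq0$ whenever $x,y$ are at distance $1$; - pulled back from $H$ if $M_{xy}$ depends only on $(\pi(x),\pi(y))$ whenever $x=y$ or $x\sim y$.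 For $a,b\in V(H)$ with $a=b$ or $a\sim b$, let $m_{ab}$ denote this common value. For $e=(a,b)\in E(H)$ write $m_e=m_{ab}$. For $a,b\in\mathbb{C}$ not both zero, the generalized ratio $b/a$ is $\infty$ if $a=0$ and the usual ratio otherwise; it is undefined if $a=b=0$. We use the convention $c/\infty=0$. A ratio system for $M$ is a function $r\colon E(H)\to\mathbb{C}\cup\{\infty\}$ such that: (a) if $r_e\neq0$ for $e=(u,v)$, then $0=m_{vv}+m_{e^{-1}}/r_e+\sum_{e'\colon e\to e'}m_{e'}r_{e'}$; (b) if $r_e=0$, then there is some $f$ with $e\to f$ and $r_f=\infty$; (c) if $r_f=\infty$ and $e\to f$, then $r_e=0$ and $r_{f^{-1}}\neq0$. The decay rate $\alpha(r)$ is the Perron eigenvalue (spectral radius) of the nonnegative matrix $R$. Its rows and columns are indexed by those $e\in E(H)$ with $r_e\neq0$ (possibly $\infty$), and its entries are: - $R_{e,f}=\sum_{e'\colon e\to e'\to f}|m_f/m_{e'^{-1}}|^2$ if $r_f=\infty$; - $R_{e,f}=|r_f|^2$ if $r_f\neq\infty$ and $e\to f$; - $R_{e,f}=0$ otherwise.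
   Formalization: For r_f=∞ the entry R_{e,f} uses |m_{e'^{-1}}/m_f|^2, the inverse ratio, since ''Furthermore'' fails otherwise (H=C_4); and ''ratio system with α(r)<1 implies bounded inverse'' is claimed only for H not a tree, since it fails on trees (K_2, all-ones M, r=-1). *)

(* Defs.v *)
From HB Require Import structures.
From mathcomp Require Import all_boot all_order all_algebra finmap complex.
From mathcomp Require Import all_classical all_reals all_analysis.
From mathcomp.analysis.showcase Require summability.

Set Implicit Arguments.
Unset Strict Implicit.
Unset Printing Implicit Defensive.

Import Order.TTheory GRing.Theory Num.Theory numFieldNormedType.Exports.
Import ComplexField.Normc.

Local Open Scope classical_set_scope.
Local Open Scope complex_scope.
Local Open Scope ring_scope.

Record sgraph (V : Type) := SGraph {
  adj :> rel V;
  adj_sym : symmetric adj;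
  adj_irr : irreflexive adj
}.

Section Graphs.
Context {V : eqType} (G : sgraph V).

(* p lists the vertices after x of a path from x to y without repetition. *)
Definition simple_path (x y : V) (p : seq V) : Prop :=
  [/\ path G x p, last x p = y & uniq (x :: p)].

Definition connected_graph : Prop :=
  (exists x : V, True) /\ forall x y : V, exists p, simple_path x y p.

Definition acyclic : Prop :=
  forall c : seq V, (2 < size c)%N -> ~~ ucycleb G c.

Definition is_tree : Prop := connected_graph /\ acyclic.

End Graphs.

(* In a simple graph the edges at x correspond to the neighbours of x. *)
Definition universal_cover (VT VH : eqType) (T : sgraph VT) (H : sgraph VH)
    (pi : VT -> VH) : Prop :=
  [/\ is_tree T,
      {homo pi : x y / T x y >-> H x y} &
      forall x, set_bij [set y | T x y] [set b | H (pi x) b] pi].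

Section DirectedEdges.
Context {V : finType} (G : sgraph V).

Definition dedge : predArgType := {e : V * V | G e.1 e.2}.

HB.instance Definition _ := Finite.on dedge.

Definition dtail (e : dedge) : V := (val e).1.
Definition dhead (e : dedge) : V := (val e).2.

Lemma dinv_subproof (e : dedge) : G (dhead e) (dtail e).
Proof. by rewrite adj_sym; exact: (valP e). Qed.

Definition dinv (e : dedge) : dedge :=
  exist (fun e : V * V => is_true (G e.1 e.2)) (dhead e, dtail e)
    (dinv_subproof e).

Definition follows (e f : dedge) : bool :=
  (dhead e == dtail f) && (f != dinv e).

End DirectedEdges.

Section Ell2.
Context {R : realType} {V : choiceType}.
Local Notation C := R[i].

Definition sqsum (f : V -> C) : \bar R :=
  (\esum_(v in [set: V]) (normc (f v) ^+ 2)%:E)%E.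

Definition sqsummable : {pred V -> C} := fun f => (sqsum f < +oo)%E.

Lemma sqsummableP (f : V -> C) (K : R) :
  (forall X : {fset V}, \sum_(v <- X) normc (f v) ^+ 2 <= K) -> sqsummable f.
Proof.
move=> fK; apply: (@le_lt_trans _ _ K%:E); last exact: ltry.
apply: ge_ereal_sup => _ [X [finX _] <-].
by rewrite fsbig_finite//= sumEFin lee_fin.
Qed.

Lemma normc_ge0 (z : C) : 0 <= normc z.
Proof. by case: z => a b; exact: sqrtr_ge0. Qed.

Lemma sqsum_fset (f : V -> C) (X : {fset V}) : sqsummable f ->
  \sum_(v <- X) normc (f v) ^+ 2 <= fine (sqsum f).
Proof.
move=> fl; rewrite -lee_fin fineK; last first.
  by rewrite ge0_fin_numE// esum_ge0// => v _; rewrite lee_fin sqr_ge0.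
apply: esum_ge; exists [set` X]; first by split.
by rewrite fsbig_finite//= set_fsetK sumEFin.
Qed.

Lemma sqsummable_submod : submod_closed sqsummable.
Proof.
split=> [|a f g fl gl].
  apply: (@sqsummableP _ 0) => X; rewrite big1// => v _.
  by rewrite normc0 expr0n.
pose K := (normc a ^+ 2 * fine (sqsum f) + fine (sqsum g)) *+ 2.
apply: (@sqsummableP _ K) => X.
apply: (@le_trans _ _ ((normc a ^+ 2 * (\sum_(v <- X) normc (f v) ^+ 2)
    + \sum_(v <- X) normc (g v) ^+ 2) *+ 2)).
  rewrite mulr_sumr -big_split/= -sumrMnl; apply: ler_sum => v _.
  rewrite -exprMn -normcM.
  apply: (@le_trans _ _ ((normc (a * f v) + normc (g v)) ^+ 2)).
    by rewrite lerXn2r ?nnegrE ?addr_ge0 ?normc_ge0// le_normcD.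
  rewrite sqrrD addrAC mulr2n lerD2l -subr_ge0.
  rewrite (_ : _ - _ = (normc (a * f v) - normc (g v)) ^+ 2) ?sqr_ge0//.
  by rewrite sqrrB addrAC.
rewrite lerMn2r/= lerD// ?sqsum_fset//.
by rewrite ler_wpM2l ?sqr_ge0// sqsum_fset.
Qed.

HB.instance Definition _ :=
  GRing.isSubmodClosed.Build C (V -> C) sqsummable sqsummable_submod.

End Ell2.

Record ell2 (R : realType) (V : choiceType) := Ell2 {
  ell2_fun :> V -> R[i];
  ell2P : ell2_fun \in sqsummable
}.

Section Ell2Structure.
Context (R : realType) (V : choiceType).

HB.instance Definition _ := [isSub for @ell2_fun R V].
HB.instance Definition _ := [Choice of ell2 R V by <:].
HB.instance Definition _ := [SubChoice_isSubLmodule of ell2 R V by <:].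

End Ell2Structure.

Section Operators.
Context {R : realType} {V : choiceType}.
Local Notation C := R[i].
Local Notation E := (ell2 R V).

Lemma delta_subproof (x : V) :
  (fun v => (v == x)%:R : C) \in sqsummable.
Proof.
apply: (@sqsummableP _ _ _ 1) => X.
have dE v : normc ((v == x)%:R : C) ^+ 2 = (v == x)%:R.
  by case: (v == x); rewrite ?normc1 ?normc0 ?expr1n ?expr0n.
under eq_bigr do rewrite dE.
have [xX|xX] := boolP (x \in X).
  rewrite (big_fsetD1 x)//= eqxx big_seq big1 ?addr0// => v.
  by rewrite !inE => /andP[/negPf ->].
rewrite big_seq big1// => v vX; case: eqP => // vx.
by rewrite -vx vX in xX.
Qed.

Definition delta (x : V) : E := Ell2 (delta_subproof x).

Lemma ell2_conj_subproof (f : E) : (fun v => (f v)^*) \in sqsummable.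
Proof.
have:= ell2P f; congr (_ < _)%E; apply: eq_esum => v _.
by case: (f v) => a b /=; rewrite sqrrN.
Qed.

Definition ell2_conj (f : E) : E := Ell2 (ell2_conj_subproof f).

Definition l2norm (f : E) : R := Num.sqrt (fine (sqsum f)).

Definition inner (f g : E) : C :=
  summability.sum (fun v => (f v)^* * g v : C^o).

Definition bounded_op (M : E -> E) : Prop :=
  exists K : R, forall f, l2norm (M f) <= K * l2norm f.

Definition bounded_inverse (M N : {linear E -> E}) : Prop :=
  [/\ bounded_op N, cancel M N & cancel N M].

Definition entry (M : E -> E) (x y : V) : C := inner (delta x) (M (delta y)).

Definition op_conj (M : E -> E) (f : E) : E := ell2_conj (M (ell2_conj f)).

Definition adjoint (M N : E -> E) : Prop :=
  forall f g, inner f (M g) = inner (N f) g.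

(* The adjoint of the entrywise conjugate of M is M. *)
Definition symmetric_op (M : E -> E) : Prop := adjoint (op_conj M) M.

Definition local_op (T : sgraph V) (M : E -> E) : Prop :=
  forall x y, x != y -> ~~ T x y -> entry M x y = 0.

Definition connected_op (T : sgraph V) (M : E -> E) : Prop :=
  forall x y, T x y -> entry M x y != 0.

Section PulledBack.
Context {VH : finType} (T : sgraph V) (pi : V -> VH) (M : E -> E).

Definition pulled_back : Prop :=
  forall x y x' y', (x == y) || T x y -> (x' == y') || T x' y' ->
    pi x = pi x' -> pi y = pi y' -> entry M x y = entry M x' y'.

(* The common value of the entries over (a, b); irrelevant (namely 0) unless
   a = b or a ~ b. *)
Definition coef (a b : VH) : C :=
  xget 0 [set c | exists x y, [/\ (x == y) || T x y, pi x = a, pi y = b &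
                                  c = entry M x y]].

End PulledBack.
End Operators.

(* C u {oo} is represented by option C, with None in the role of oo. *)
Section RatioSystems.
Context {R : realType}.
Local Notation C := R[i].

(* The generalized ratio b / a, meaningful only if a and b are not both 0. *)
Definition gratio (b a : C) : option C := if a == 0 then None else Some (b / a).

Definition divoo (c : C) (r : option C) : C := if r is Some z then c / z else 0.

Context {VH : finType} {H : sgraph VH} (m : VH -> VH -> C).
Implicit Types e f : dedge H.

Definition coef_e e : C := m (dtail e) (dhead e).

(* In the first clause all the r e' are finite by the third clause, so that
   the default value of odflt plays no role. *)
Definition ratio_system (r : dedge H -> option C) : Prop :=
  [/\ forall e, r e != Some 0 ->
        0 = m (dhead e) (dhead e) + divoo (coef_e (dinv e)) (r e)
            + \sum_(e' | follows e e') coef_e e' * odflt 0 (r e'),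
      forall e, r e = Some 0 -> exists2 f, follows e f & r f = None &
      forall e f, r f = None -> follows e f ->
        r e = Some 0 /\ r (dinv f) != Some 0].

(* If psi solves M psi = 0 near a vertex v with psi v = 0, and if u and x are
   the only neighbours of v where psi may not vanish, then
   m_vu psi u + m_vx psi x = 0.  Passing from e to f with r f = oo through
   e' = (u, v), f = (v, x) thus multiplies |psi|^2 by
   |m_(e'^-1) / m_f|^2, and not by its inverse. *)
Definition decay_entry (r : dedge H -> option C) e f : R :=
  if r f is Some z then (if follows e f then normc z ^+ 2 else 0)
  else \sum_(e' | follows e e' && follows e' f)
         normc (coef_e (dinv e') / coef_e f) ^+ 2.

Definition decay_matrix (r : dedge H -> option C) :=
  let J := [pred e | r e != Some 0] in
  \matrix_(i < #|J|, j < #|J|) decay_entry r (enum_val i) (enum_val j).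

End RatioSystems.

(* sup set0 = 0, so the empty matrix has spectral radius 0. *)
Definition spectral_radius {R : realType} n (A : 'M[R]_n) : R :=
  sup [set normc z | z in [set z : R[i] |
                            eigenvalue (map_mx (real_complex R) A) z]].

Definition decay_rate {R : realType} {VH : finType} {H : sgraph VH}
    (m : VH -> VH -> R[i]) (r : dedge H -> option R[i]) : R :=
  spectral_radius (decay_matrix m r).

(* Main.v *)
Require Import Defs.
From HB Require Import structures.
From mathcomp Require Import all_boot all_order all_algebra finmap complex.
From mathcomp Require Import all_classical all_reals all_analysis.
From mathcomp Require Import ring lra.

Set Implicit Arguments.
Unset Strict Implicit.
Unset Printing Implicit Defensive.

Import Order.TTheory GRing.Theory Num.Theory numFieldNormedType.Exports.
Import ComplexField.Normc.

Local Open Scope ring_scope.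

(** Write [B(u, v)] for the part of the tree [T] behind the edge [(u, v)].

    If [M] is invertible, two square-summable solutions of [M psi = 0] on
    [B(u, v)] have proportional values at [u] and [v]: truncate both to [B(u, v)]
    and use the symmetry of [M].  So [r_e = psi v / psi u] is well defined; it
    depends only on [e] because deck transformations move solutions between the
    lifts of [e].  Two solutions that contradict clause (c) could be glued to an
    element of the kernel of [M].  For the decay rate, let [A_e] be the infimum of
    the mass on [B(u, v)] of the solutions with [psi v = 1].  Splitting [B(u, v)]
    into the branches behind it gives [1 + R A <= A], so the spectral radius of
    [R] is less than 1.

    Conversely [alpha(r) < 1] gives [A >= 1] with [A = 1 + R A].  Root [T] at [o]
    and measure on each edge [(u, v)] pointing away from [o] the defect
    [F = m_uv (r f u - f v)] (or [m_uv f u] if [r = oo]) of a square-summable [f].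
    The ratio equations express [F] on an edge through [M f] and [F] on the next
    edges, and [A] turns this transfer into a contraction of a weighted square
    norm; hence [|F| <= C |M f|] off the root.  When [M f] is supported at the
    root, [F = 0], which is the formula for the Green function.  In the other
    direction [f] is recovered from [F] along the transposed transfer, which
    contracts for the same reason, starting from the value at the root; there one
    divides by [root_pivot], which can vanish only if [H] is a tree.  So [M] is
    bounded below, and a symmetric operator that is bounded below is invertible. *)

(** * Squared moduli and nonnegative matrices *)

(** The natural candidate for the Green function is a product of ratios along a path, but a factor
    [0] is followed by [oo] on some branch, and such a product has no meaning. The defect avoids
    products: it is linear in [f], makes sense for every value of the ratio, and satisfies a
    recursion with finite coefficients. The transposed recursion governs the values of [f], so that
    one family of weights controls both directions. The weights are [(1 - R)^-1 1] and not a Perron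
    eigenvector: [R] may be reducible, and an eigenvector may vanish on some edges, whereas the
    resolvent is at least 1 on each of them. Inner products are limits over finite sets. Symmetry is
    only used where truncation or locality leaves finitely many nonzero products, and the estimates
    are carried out on finite partial sums, with constants that depend on [H], the coefficients and
    the ratios only. *)

Section SquaredModulus.
Context {R : realType}.
Local Notation C := R[i].
Implicit Types z w : C.

Definition nsq z : R := normc z ^+ 2.

Lemma nsqE z : nsq z = complex.Re z ^+ 2 + complex.Im z ^+ 2.
Proof. by case: z => a b; rewrite /nsq /= sqr_sqrtr ?addr_ge0 ?sqr_ge0. Qed.

Lemma nsq_ge0 z : 0 <= nsq z. Proof. exact: sqr_ge0. Qed.

Lemma nsq0 : nsq 0 = 0 :> R.
Proof. by rewrite nsqE/= expr0n/= addr0. Qed.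

Lemma nsq1 : nsq 1 = 1 :> R.
Proof. by rewrite nsqE/= expr1n expr0n/= addr0. Qed.

Lemma nsqM z w : nsq (z * w) = nsq z * nsq w.
Proof. by rewrite /nsq normcM exprMn. Qed.

Lemma nsqN z : nsq (- z) = nsq z.
Proof. by rewrite /nsq normcN. Qed.

Lemma nsqV z : nsq z^-1 = (nsq z)^-1.
Proof. by rewrite /nsq normcV exprVn. Qed.

Lemma nsqJ z : nsq z^* = nsq z.
Proof. by case: z => a b; rewrite !nsqE/= sqrrN. Qed.

Lemma nsq_eq0 z : (nsq z == 0) = (z == 0).
Proof.
apply/idP/idP => [|/eqP ->]; last by rewrite nsq0.
by rewrite sqrf_eq0 => /eqP/eq0_normc ->.
Qed.

Lemma nsq_gt0 z : (0 < nsq z) = (z != 0).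
Proof. by rewrite lt_neqAle nsq_ge0 andbT eq_sym nsq_eq0. Qed.

Lemma nsq_real z : (nsq z)%:C%C = z^* * z.
Proof.
rewrite nsqE; case: z => a b /=; simpc => /=.
by congr (_ +i* _)%C; ring.
Qed.

(** The difference of the two sides is [eps^-1 |eps z - w|^2]. A small [eps] lets a contraction
    factor [kap < 1] survive as [(1 + eps) * kap < 1] when a source term is split off. *)
Lemma nsqD_eps (eps : R) z w : 0 < eps ->
  nsq (z + w) <= (1 + eps) * nsq z + (1 + eps^-1) * nsq w.
Proof.
move=> e0; have e1 : eps^-1 * eps = 1 by rewrite mulVf// gt_eqF.
have ei : 0 < eps^-1 by rewrite invr_gt0.
rewrite !nsqE; case: z w => a b [c d] /=.
have key (x y : R) : (x + y) ^+ 2 <= (1 + eps) * x ^+ 2 + (1 + eps^-1) * y ^+ 2.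
  rewrite -subr_ge0.
  suff -> : (1 + eps) * x ^+ 2 + (1 + eps^-1) * y ^+ 2 - (x + y) ^+ 2
     = eps^-1 * (eps * x - y) ^+ 2 by rewrite mulr_ge0 ?sqr_ge0// ltW.
  have -> : eps^-1 * (eps * x - y) ^+ 2 =
    (eps^-1 * eps) * eps * x ^+ 2 - (eps^-1 * eps) * (x * y) *+ 2
    + eps^-1 * y ^+ 2 by ring.
  rewrite e1; ring.
by have := key a c; have := key b d; lra.
Qed.

Lemma nsqD z w : nsq (z + w) <= 2 * nsq z + 2 * nsq w.
Proof. by have := @nsqD_eps 1 z w ltr01; rewrite invr1. Qed.

(** Weighted Cauchy-Schwarz. Adding one term reduces to [(p * B - A * q)^2 >= 0]. *)
Lemma nsq_wsum (I : Type) (s : seq I) (P : pred I) (th x : I -> C)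
    (w : I -> R) : (forall i, P i -> 0 < w i) ->
  nsq (\sum_(i <- s | P i) th i * x i) <=
  (\sum_(i <- s | P i) nsq (th i) * w i) * (\sum_(i <- s | P i) nsq (x i) / w i).
Proof.
move=> w0.
have g0 (y : I -> C) (v : I -> R) r : (forall i, P i -> 0 <= v i) ->
    0 <= \sum_(i <- r | P i) nsq (y i) * v i.
  by move=> v0; apply: sumr_ge0 => i Pi; rewrite mulr_ge0 ?nsq_ge0 ?v0.
elim: s => [|i s IHs]; first by rewrite !big_nil nsq0 mul0r.
rewrite !big_cons; case: ifPn => // Pi.
have wi := w0 _ Pi.
set a := \sum_(_ <- s | _) _ in IHs *.
set A := \sum_(_ <- s | _) _ in IHs *.
set B := \sum_(_ <- s | _) _ in IHs *.
have A0 : 0 <= A by apply: g0 => j Pj; exact/ltW/w0.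
have B0 : 0 <= B by apply: g0 => j Pj; rewrite invr_ge0; exact/ltW/w0.
set b := th i * x i; set p := nsq (th i) * w i; set q := nsq (x i) / w i.
have p0 : 0 <= p by rewrite mulr_ge0 ?nsq_ge0// ltW.
have q0 : 0 <= q by rewrite mulr_ge0 ?nsq_ge0// invr_ge0 ltW.
have pq : nsq b = p * q by rewrite nsqM /p /q; field; rewrite gt_eqF.
have : nsq (b + a) <= (normc b + normc a) ^+ 2.
  by rewrite /nsq lerXn2r ?nnegrE ?addr_ge0 ?normc_ge0// le_normcD.
move=> /le_trans; apply.
have -> : (normc b + normc a) ^+ 2 = nsq b + nsq a + 2 * (normc b * normc a).
  by rewrite /nsq; ring.
have : (normc b * normc a) * 2 <= p * B + A * q.
  rewrite -(@ler_pXn2r _ 2)// ?nnegrE; last first.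
  - by rewrite addr_ge0// mulr_ge0.
  - by rewrite !mulr_ge0 ?normc_ge0.
  have -> : (normc b * normc a * 2) ^+ 2 = 4 * (nsq b * nsq a).
    by rewrite /nsq; ring.
  rewrite pq; apply: (@le_trans _ _ (4 * (p * q * (A * B)))).
    by rewrite ler_wpM2l// ler_wpM2l// mulr_ge0.
  rewrite -subr_ge0.
  have -> : (p * B + A * q) ^+ 2 - 4 * (p * q * (A * B)) = (p * B - A * q) ^+ 2.
    by ring.
  exact: sqr_ge0.
rewrite pq; lra.
Qed.

Lemma nsq_sum (I : Type) (s : seq I) (P : pred I) (th x : I -> C) :
  nsq (\sum_(i <- s | P i) th i * x i) <=
  (\sum_(i <- s | P i) nsq (th i)) * (\sum_(i <- s | P i) nsq (x i)).
Proof.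
apply: le_trans (@nsq_wsum _ s P th x (fun=> 1) _) _ => //.
by under eq_bigr do rewrite mulr1; under [X in _ * X]eq_bigr do rewrite divr1.
Qed.

End SquaredModulus.

(** * Spectral radius and resolvent of a nonnegative matrix *)

Section Perron.
Context {R : realType} {n : nat} (B : 'M[R]_n).
Hypothesis B_ge0 : forall i j, 0 <= B i j.

Let Bc := map_mx (real_complex R) B.

Lemma normc_real (x : R) : normc x%:C%C = `|x|.
Proof. by rewrite /= expr0n/= addr0 sqrtr_sqr. Qed.

Lemma normc_gt0 (z : R[i]) : (0 < normc z) = (z != 0).
Proof.
rewrite lt_neqAle normc_ge0 andbT eq_sym; congr (~~ _).
by apply/eqP/eqP => [/eq0_normc//|->]; exact: normc0.
Qed.

Lemma normc_sum (I : Type) (s : seq I) (P : pred I) (F : I -> R[i]) :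
  normc (\sum_(i <- s | P i) F i) <= \sum_(i <- s | P i) normc (F i).
Proof.
elim/big_rec2 : _ => [|i y x Pi le_yx]; first by rewrite normc0.
by rewrite (le_trans (le_normcD _ _))// lerD2l.
Qed.

(* A left eigenvector tested against a subsolution. *)
Lemma eigenvalue_subsolution (A : 'I_n -> R) (kappa : R) (z : R[i]) :
  (forall i, 0 < A i) -> (forall i, \sum_j B i j * A j <= kappa * A i) ->
  eigenvalue Bc z -> normc z <= kappa.
Proof.
move=> A0 BA /eigenvalueP[v vB v0].
have [j vj] : exists j, v 0 j != 0.
  apply/existsP; rewrite -negb_forall; apply: contra v0 => /forallP v0.
  by apply/eqP/rowP => j; rewrite mxE; apply/eqP.
pose S := \sum_j normc (v 0 j) * A j.
have S0 : 0 < S.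
  rewrite /S (bigD1 j)//= ltr_pwDl//.
    by rewrite mulr_gt0// normc_gt0.
  by apply: sumr_ge0 => k _; rewrite mulr_ge0 ?normc_ge0// ltW.
rewrite -(ler_pM2r S0) {1}/S mulr_sumr.
apply: (@le_trans _ _ (\sum_k (\sum_i normc (v 0 i) * B i k) * A k)).
  apply: ler_sum => k _; rewrite mulrA ler_wpM2r ?(ltW (A0 k))//.
  rewrite -normcM -[z * v 0 k]/(z * v 0 k).
  have -> : z * v 0 k = (v *m Bc) 0 k by rewrite vB mxE.
  rewrite mxE (le_trans (normc_sum _ _ _))//; apply: ler_sum => i _.
  by rewrite normcM mxE normc_real ger0_norm.
under eq_bigr do rewrite mulr_suml.
rewrite exchange_big/= /S mulr_sumr; apply: ler_sum => i _.
under eq_bigr do rewrite -mulrA.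
by rewrite -mulr_sumr mulrCA ler_wpM2l ?normc_ge0.
Qed.

(** With [K] an upper bound of [A], [B A <= A - 1 <= (1 - 1/K) A]. This explicit gap bounds all
    eigenvalues at once and so passes to the supremum. *)
Lemma spectral_radius_lt1 (A : 'I_n -> R) :
  (forall i, 0 <= A i) -> (forall i, 1 + \sum_j B i j * A j <= A i) ->
  spectral_radius B < 1.
Proof.
move=> A0 BA.
have A1 i : 1 <= A i.
  apply: le_trans (BA i); rewrite lerDl; apply: sumr_ge0 => j _.
  by rewrite mulr_ge0.
pose K := 1 + \sum_i A i.
have AK i : A i <= K.
  by rewrite /K (bigD1 i)//= addrCA lerDl addr_ge0// sumr_ge0.
have K0 : 0 < K by rewrite ltr_pwDl// sumr_ge0.
have [[z /= [w wB wz]]|noev] := pselect ([set normc z | z in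
    [set z : R[i] | eigenvalue Bc z]] !=set0)%classic; last first.
  rewrite /spectral_radius (_ : [set _ | _ in _]%classic = set0) ?sup0//.
  by apply/seteqP; split => // x Bx; apply: noev; exists x.
apply: (@le_lt_trans _ _ (1 - K^-1)); last by rewrite ltrBlDr ltrDl invr_gt0.
apply: ge_sup; first by exists z, w.
move=> _ [w' w'B <-]; apply: (eigenvalue_subsolution _ _ w'B) => i.
  by rewrite (lt_le_trans ltr01).
rewrite mulrBl mul1r lerBrDl (le_trans _ (BA i))// lerD2r.
by rewrite mulrC ler_pdivrMr ?mul1r.
Qed.

Lemma eigenvalue_le_spectral_radius z :
  eigenvalue Bc z -> normc z <= spectral_radius B.
Proof.
move=> zB; apply: ub_le_sup; last by exists z.
(* The supremum is an upper bound only if the set is bounded; the constant subsolution shows that it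
   is. *)
exists (\sum_i \sum_j B i j) => _ [w wB <-].
apply: (@eigenvalue_subsolution (fun=> 1)) => // i.
under eq_bigr do rewrite mulr1.
rewrite mulr1 [leRHS](bigD1 i)//= lerDl.
by apply: sumr_ge0 => k _; apply: sumr_ge0.
Qed.

(* The nonnegativity of [(1 - t B)^-1 1] is open and closed in [t], because a
   nonnegative solution of [A = 1 + t B A] is at least 1. *)
Lemma spectral_radius_resolvent : spectral_radius B < 1 ->
  exists A : 'I_n -> R,
    forall i, 1 <= A i /\ A i = 1 + \sum_j B i j * A j.
Proof.
move=> B1.
(* Cramer's rule over polynomials: where [D] is nonzero, [Q i / D] solves [(1 - t B) A = 1], and
   continuity in [t] becomes that of polynomials. *)
pose Bp : 'M[{poly R}]_n := 1%:M - 'X *: map_mx polyC B.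
pose D := \det Bp.
pose Q i := (\adj Bp *m const_mx 1 : 'cV_n) i 0.
pose Bt (t : R) := 1%:M - t *: B.
have BpE t : map_mx (horner_eval t) Bp = Bt t.
  apply/matrixP => i j; rewrite !mxE /horner_eval.
  by rewrite hornerD hornerN hornerM hornerX hornerC hornerMn hornerC.
have DE t : D.[t] = \det (Bt t).
  by rewrite -BpE det_map_mx.
have QE t i : (Q i).[t] = (\adj (Bt t) *m const_mx 1 : 'cV_n) i 0.
  rewrite -BpE -map_mx_adj /Q !mxE horner_sum; apply: eq_bigr => j _ /=.
  by rewrite !mxE hornerM hornerC /horner_eval.
have eqQ t i : (Q i).[t] - t * \sum_j B i j * (Q j).[t] = D.[t].
  have /(congr1 (fun A => (A *m const_mx 1 : 'cV_n) i 0)) := mul_mx_adj (Bt t).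
  rewrite -mulmxA mul_scalar_mx -DE [RHS]mxE [X in _ * X]mxE mulr1 => <-.
  rewrite mulr_sumr [RHS]mxE; under [RHS]eq_bigr do rewrite -QE !mxE mulrBl.
  rewrite sumrB; congr (_ - _); last by apply: eq_bigr => j _; rewrite mulrA.
  rewrite (bigD1 i)//= eqxx mul1r big1 ?addr0// => j ji.
  by rewrite eq_sym (negPf ji) mul0r.
(* A kernel vector of [1 - t B] is an eigenvector of [B] for [1 / t >= 1]. *)
have D_neq0 t : 0 <= t <= 1 -> D.[t] != 0.
  move=> /andP[t0 t1]; rewrite DE; apply/negP => /det0P[v v0].
  rewrite mulmxBr mulmx1 -scalemxAr => /eqP; rewrite subr_eq0 => /eqP vB.
  have tn0 : t != 0 by apply: contra v0 => /eqP t00; rewrite vB t00 scale0r.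
  have : eigenvalue B t^-1.
    by apply/eigenvalueP; exists v => //; rewrite {2}vB scalerA mulVf// scale1r.
  rewrite -(eigenvalue_map (real_complex R)) => /eigenvalue_le_spectral_radius.
  rewrite normc_real ger0_norm ?invr_ge0// => /le_lt_trans/(_ B1).
  have {tn0} t_gt0 : 0 < t by rewrite lt_neqAle eq_sym tn0.
  by rewrite invf_lt1// ltNge t1.
pose f t i := (Q i).[t] / D.[t].
have f_eq t i : 0 <= t <= 1 -> f t i = 1 + t * \sum_j B i j * f t j.
  move=> t01; have Dn := D_neq0 _ t01.
  apply/eqP; rewrite -subr_eq; apply/eqP.
  under eq_bigr do rewrite /f mulrA.
  by rewrite -mulr_suml mulrA /f -mulrBl eqQ divff.
have f_ge1 t : 0 <= t <= 1 -> (forall i, 0 <= f t i) -> forall i, 1 <= f t i.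
  move=> t01 f0 i; rewrite f_eq// lerDl mulr_ge0//; first by case/andP: t01.
  by apply: sumr_ge0 => j _; rewrite mulr_ge0.
(* [Q i * D] has the sign of [f t i] on the unit interval and, unlike [f], is continuous on the
   whole line. *)
pose g (t : R) : R := \big[Num.min/1]_i (Q i * D).[t].
have QDf t i : 0 <= t <= 1 -> (Q i * D).[t] = f t i * D.[t] ^+ 2.
  by move=> t01; rewrite hornerM /f; field; exact: D_neq0.
have g_le t i : g t <= (Q i * D).[t].
  by rewrite /g; exact: bigmin_le.
have g_gt0 t : 0 <= t <= 1 -> (forall i, 0 <= f t i) -> 0 < g t.
  move=> t01 f0; rewrite /g; apply/bigmin_gtP; split => // i _.
  rewrite QDf// mulr_gt0 ?exprn_even_gt0 ?D_neq0//.
  by rewrite (lt_le_trans ltr01)// f_ge1.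
have g_cont : continuous g.
  rewrite /g => t; elim: (index_enum _) => [|i s IHs].
    rewrite (_ : (fun t => _) = cst 1); first exact: cvg_cst.
    by apply/funext => x; rewrite big_nil.
  rewrite (_ : (fun t => _) = (horner (Q i * D))
      \min (fun t => \big[Num.min/1]_(i <- s) (Q i * D).[t])).
    apply: (@continuous_min R R) => //; exact: continuous_horner.
  by apply/funext => x; rewrite big_cons.
have z01 : 0 <= (0 : R) <= 1 by rewrite lexx ler01.
have o01 : 0 <= (1 : R) <= 1 by rewrite lexx ler01.
suff f1 i : 0 <= f 1 i.
  by exists (f 1) => i; rewrite f_ge1//; split => //; rewrite {1}f_eq// mul1r.
rewrite leNgt; apply/negP => fi.
have g1 : g 1 <= 0.
  apply: le_trans (g_le 1 i) _.
  by rewrite QDf// mulr_le0_ge0 ?sqr_ge0// ltW.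
have g0 : 0 < g 0.
  by apply: g_gt0 => // j; rewrite f_eq// mul0r addr0.
(* At a zero of [g] all [f c i] are nonnegative, hence at least 1, which makes [g c] positive. *)
have [c c01 gc] : exists2 c, c \in `[0, 1] & g c = 0.
  apply: IVT => //; first exact: continuous_subspaceT.
  by rewrite ge_min g1 orbT le_max (ltW g0).
have {}c01 : 0 <= c <= 1 by rewrite in_itv in c01.
suff /(g_gt0 _ c01) : forall i, 0 <= f c i by rewrite gc ltxx.
move=> j; have := g_le c j; rewrite gc QDf// pmulr_lge0//.
by rewrite exprn_even_gt0 ?D_neq0.
Qed.

End Perron.

(** * Trees and coverings *)

Section Trees.
Context {V : eqType} (T : sgraph V) (T_tree : is_tree T).

Lemma adj_neq x y : T x y -> x != y.
Proof. by apply: contraTneq => ->; rewrite adj_irr. Qed.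

Lemma simple_path_unique x y p q :
  simple_path T x y p -> simple_path T x y q -> p = q.
Proof.
have [_ acT] := T_tree.
have nil_path z s : simple_path T z z s -> s = [::].
  case: s => // a s [_ /= ls /andP[]].
  by rewrite -{1}ls mem_last.
elim: p x q => [|a p IHp] x [|b q]//.
- by move=> [_ /= -> _] /nil_path.
- by move=> /[swap] -[_ /= -> _] /nil_path.
have [<-{b}|ab] := eqVneq a b.
  move=> [/= /andP[_ pp] lp /andP[_ up]] [/= /andP[_ pq] lq /andP[_ uq]].
  by congr cons; apply: (IHp a).
move=> [pp lp]; rewrite cons_uniq => /andP[xp up] [pq lq].
rewrite cons_uniq => /andP[xq uq]; exfalso.
(* Follow the first path to its first vertex [z] on the second one; the two segments from [x] to [z]
   form a cycle. *)
have : has (mem (b :: q)) (a :: p).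
  by apply/hasP; exists y; [rewrite -lp|rewrite -lq] => /=; exact: mem_last.
have hP : ohead (a :: p) = Some a by [].
move: (a :: p) pp lp xp up hP => P pp lp xp up hP.
move=> /split_find sP; move: sP pp xp up lp hP.
case=> z p1 p2 zq p1q pp xp up _ hP.
have {}hp1 : p1 = [::] -> a = z by move=> p10; move: hP; rewrite p10 => -[].
have hQ : ohead (b :: q) = Some b by [].
move: (b :: q) hQ zq p1q pq xq uq lq => Q hQ zq.
move: hQ; case/path.splitP: zq => q1 q2 hQ p1q pq xq uq _.
have {hQ}hq1 : q1 = [::] -> b = z by move=> q10; move: hQ; rewrite q10 => -[].
pose c := x :: rcons p1 z ++ rev q1.
(* If both segments had no interior vertex, then [a = z = b]. *)
have size_c : (2 < size c)%N.
  rewrite /= size_cat size_rcons size_rev !ltnS.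
  case: (p1) hp1 => [|//] /(_ erefl) az; case: (q1) hq1 => [|//] /(_ erefl) bz.
  by rewrite az bz eqxx in ab.
have /negP := acT c size_c; apply; apply/andP; split.
  rewrite /= rcons_cat cat_path last_rcons.
  move: pp; rewrite cat_path => /andP[-> _] /=.
  move: pq; rewrite cat_path => /andP[+ _].
  rewrite -rev_path last_rcons belast_rcons rev_cons.
  by rewrite (eq_path (e' := T))// => ? ?; rewrite adj_sym.
move: xp up xq uq; rewrite !mem_cat !cat_uniq !negb_or /= => /andP[xp1 _].
move=> /andP[up1 _] /andP[xq1 _] /andP[uq1 _].
move: xq1; rewrite mem_rcons inE negb_or => /andP[_ xq1].
move: uq1; rewrite rcons_uniq => /andP[zq1 uq1].
rewrite mem_cat mem_rev negb_or xp1 xq1 cat_uniq up1 rev_uniq uq1 /= ?andbT.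
apply/hasPn => d; rewrite mem_rev mem_rcons inE negb_or => dq1.
rewrite (memPn zq1)//=; apply: contra p1q => dp1; apply/hasP; exists d => //=.
by rewrite mem_cat mem_rcons inE dq1 orbT.
Qed.

Definition geodesic x y : seq V := sval (cid (T_tree.1.2 x y)).
Local Notation pth := geodesic.

Lemma geodesicP x y : simple_path T x y (pth x y).
Proof. exact: (svalP (cid (T_tree.1.2 x y))). Qed.

Lemma geodesicE x y p : simple_path T x y p -> pth x y = p.
Proof. exact/simple_path_unique/geodesicP. Qed.

Lemma geodesic_adj x y : T x y -> pth x y = [:: y].
Proof.
move=> xy; apply: geodesicE; split => //=; first by rewrite xy.
by rewrite inE adj_neq.
Qed.

Lemma geodesic_cat x y z : z \in x :: pth x y -> pth x y = pth x z ++ pth z y.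
Proof.
have [px lx ux] := geodesicP x y.
move=> zx; move: px lx ux; case/splitPl: zx => p1 p2 zp1.
rewrite cat_path last_cat zp1 -cat_cons cat_uniq => /andP[pp1 pp2] lp2.
move=> /and3P[up1 /hasPn dp up2].
rewrite (@geodesicE x z p1)// (@geodesicE z y p2)//; split => //=.
rewrite up2 andbT; apply/negP => /dp /=; rewrite -zp1.
by rewrite mem_last.
Qed.

Lemma geodesic_rcons x y z : T y z ->
  pth x z = rcons (pth x y) z \/ pth x y = rcons (pth x z) y.
Proof.
move=> yz; have [zxy|zxy] := boolP (z \in x :: pth x y).
  by right; rewrite (geodesic_cat zxy) (@geodesic_adj z y) ?cats1// adj_sym.
have [p l u] := geodesicP x y.
left; apply: geodesicE; split; rewrite ?last_rcons//.
  by rewrite rcons_path p l.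
by rewrite -rcons_cons rcons_uniq zxy.
Qed.

(** The set [B(u, v)] of the overview. The first vertex of a geodesic from [u] is adjacent to [u],
    so membership already forces [T u v]. *)
Definition branch u v : pred V := fun x => ohead (pth u x) == Some v.

Lemma branch_geodesic u v x : branch u v x -> pth u x = v :: pth v x.
Proof.
rewrite /branch => /eqP hp; have vp : v \in pth u x.
  by case: (pth u x) hp => //= a s [->]; rewrite mem_head.
have [/= p _ _] := geodesicP u x.
have uv : T u v by case: (pth u x) hp p => //= a s [->] /andP[].
by rewrite (@geodesic_cat u x v) ?inE ?vp ?orbT// geodesic_adj.
Qed.

Lemma branch_compl u v x : T u v -> branch v u x = ~~ branch u v x.
Proof.
move=> uv; apply/idP/idP => [vux|].
  apply/negP => /branch_geodesic uvx; have [_ _] := geodesicP u x.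
  by rewrite uvx (branch_geodesic vux) /= !inE eqxx orbT.
have [vux|vux] := boolP (v \in pth u x).
  move=> /negP[]; rewrite /branch (@geodesic_cat u x v) ?inE ?vux ?orbT//.
  by rewrite geodesic_adj.
move=> _; have [p l un] := geodesicP u x.
rewrite /branch (@geodesicE v x (u :: pth u x)) ?eqxx//; split => //=.
  by rewrite adj_sym uv.
by move: un => /= ->; rewrite inE negb_or vux eq_sym adj_neq.
Qed.

Lemma branch_head u v : T u v -> branch u v v.
Proof. by move=> uv; rewrite /branch geodesic_adj. Qed.

Lemma branch_tail u v : T u v -> branch u v u = false.
Proof.
by move=> uv; apply/negbTE; rewrite -branch_compl// branch_head// adj_sym.
Qed.

(** The edge between [u] and [v] is the only one that leaves the branch; hence truncating a function
    to it disturbs a local operator at [u] and [v] only. *)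
Lemma branch_boundary u v x y :
  T x y -> branch u v x -> ~~ branch u v y -> x = v /\ y = u.
Proof.
move=> xy; rewrite /branch => /eqP ux /eqP uy.
have [py ly _] := geodesicP u y.
case: (geodesic_rcons u xy) => [e|e]; move: e ux uy ly.
  by move=> ->; case: (pth u x).
by move=> ->; case: (pth u y) => //= [[->] _ ->].
Qed.

Lemma branch_sub u v x y :
  T u v -> x != u -> branch v x y -> branch u v y.
Proof.
move=> uv xu /eqP vxy; rewrite -[branch u v y]negbK -branch_compl//.
by rewrite /branch vxy; apply: contra xu => /eqP[->].
Qed.

Lemma branch_neq v x y : T v x -> branch v x y -> y != v.
Proof. by move=> vx; apply: contraTneq => ->; rewrite branch_tail. Qed.

Lemma branch_disjoint v x x' y : branch v x y -> branch v x' y -> x = x'.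
Proof. by move=> /eqP e /eqP; rewrite e => -[]. Qed.

Lemma branch_exists x y : x != y -> exists2 v, T x v & branch x v y.
Proof.
move=> xy; have [] := geodesicP x y; rewrite /branch.
case: (pth x y) => [_ /= /eqP|a s /= /andP[xa _] _ _]; first by rewrite (negPf xy).
by exists a.
Qed.

(** Reversing the path turns the position of [u] in the theorem into membership of [w] in a
    branch. *)
Lemma branch_of_simple_path u v w p :
  T u v -> simple_path T w v p -> u \in w :: p -> branch v u w.
Proof.
move=> uv wp; have [pp lp up] := wp.
rewrite -(geodesicE wp) => /geodesic_cat; rewrite (geodesicE wp) (geodesic_adj uv).
rewrite cats1 => pE; have lu : last w (pth w u) = u by have [] := geodesicP w u.
rewrite /branch (@geodesicE v w (rev (belast w p))).
  by rewrite pE belast_rcons lastI rev_rcons lu.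
split.
- by rewrite -lp rev_path (eq_path (e' := T))// => ? ?; rewrite adj_sym.
- by case: (p) lp => //= a s _; rewrite rev_cons last_rcons.
- by rewrite -lp -rev_rcons -lastI rev_uniq.
Qed.

End Trees.

(** * Coverings: lifts and deck transformations *)

Section Coverings.
Context {VT : choiceType} {VH : finType} (T : sgraph VT) (H : sgraph VH).
Context (pi : VT -> VH) (covT : universal_cover T H pi).

Lemma cover_tree : is_tree T. Proof. by case: covT. Qed.
Local Notation T_tree := cover_tree.

Lemma cover_adj x y : T x y -> H (pi x) (pi y).
Proof. by case: covT => _ + _; exact. Qed.

(** Neighbours of [x] are addressed by vertices of [H], so that sums over neighbours in the infinite
    tree are sums over a finite type. *)
Definition lift x b : VT := xget x [set y | T x y /\ pi y = b]%classic.

Lemma liftP x b : H (pi x) b -> T x (lift x b) /\ pi (lift x b) = b.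
Proof.
move=> xb; have [_ _ /(_ x)[_ _ surj]] := covT.
have [y xy yb] := surj b xb.
by apply: (@xgetPex _ x [set y | T x y /\ pi y = b]%classic); exists y.
Qed.

Lemma lift_adj x b : H (pi x) b -> T x (lift x b).
Proof. by case/liftP. Qed.

Lemma pi_lift x b : H (pi x) b -> pi (lift x b) = b.
Proof. by case/liftP. Qed.

Lemma lift_pi x y : T x y -> lift x (pi y) = y.
Proof.
move=> xy; have [xz zy] := liftP (cover_adj xy).
by have [_ _ /(_ x)[_ inj _]] := covT; apply: inj; rewrite ?inE.
Qed.

Lemma cover_surj : connected_graph H -> forall b, exists x, pi x = b.
Proof.
move=> [_ conH] b; have [[x0 _] _] := T_tree.1.
have [p [pp <- _]] := conH (pi x0) b.
elim: p x0 pp => [|a p IHp] x /=; first by exists x.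
move=> /andP[xa pp]; rewrite -(pi_lift xa).
by apply: (IHp (lift x a)); rewrite pi_lift.
Qed.

Lemma cover_edge : connected_graph H -> forall a b, H a b ->
  exists u v, [/\ T u v, pi u = a & pi v = b].
Proof.
move=> conH a b ab; have [u ua] := cover_surj conH a.
by exists u, (lift u b); rewrite lift_adj ?pi_lift ?ua.
Qed.

(** For [x0] and [x0'] in one fibre this is the deck transformation that moves [x0] to [x0']. *)
Definition deck x0 x0' y := foldl lift x0' (map pi (geodesic T_tree x0 y)).

Lemma pi_deck x0 x0' y : pi x0 = pi x0' -> pi (deck x0 x0' y) = pi y.
Proof.
move=> e; rewrite /deck; have [p l _] := geodesicP T_tree x0 y.
rewrite -[in RHS]l.
move: (geodesic T_tree x0 y) p l => s p _.
elim: s x0 x0' e p => [//|a s IHs] x x' xx' /=.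
move=> /andP[xa ps]; rewrite (IHs a)// pi_lift// -xx'.
exact: cover_adj.
Qed.

Lemma deck_id x0 x0' : deck x0 x0' x0 = x0'.
Proof. by rewrite /deck (@geodesicE _ _ _ _ _ [::]). Qed.

Lemma deck_adj x0 x0' y z : pi x0 = pi x0' ->
  T y z -> T (deck x0 x0' y) (deck x0 x0' z).
Proof.
move=> e; wlog gz : y z / geodesic T_tree x0 z = rcons (geodesic T_tree x0 y) z.
  move=> th yz; case: (geodesic_rcons T_tree x0 yz) => [/th|]; first exact.
  by rewrite adj_sym => /th; apply; rewrite adj_sym.
move=> yz; rewrite {2}/deck gz map_rcons -cats1 foldl_cat /=.
by rewrite lift_adj// -/(deck x0 x0' y) pi_deck//; exact: cover_adj.
Qed.

(** The composite preserves adjacency, lies over the identity of [H] and fixes [x0]; by uniqueness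
    of lifts it fixes every vertex of a geodesic from [x0]. *)
Lemma deckK x0 x0' : pi x0 = pi x0' -> cancel (deck x0 x0') (deck x0' x0).
Proof.
move=> e y; set f := fun y => deck x0' x0 (deck x0 x0' y).
have f_adj x z : T x z -> T (f x) (f z).
  by move=> xz; apply: deck_adj => //; exact: deck_adj.
have pi_f x : pi (f x) = pi x by rewrite /f !pi_deck.
have fx0 : f x0 = x0 by rewrite /f !deck_id.
rewrite -/(f y); clearbody f; have [p l _] := geodesicP T_tree x0 y.
suff : f (last x0 (geodesic T_tree x0 y)) = last x0 (geodesic T_tree x0 y).
  by rewrite l.
move: (geodesic T_tree x0 y) p l => s p _; elim: s x0 p fx0 {e} => [//|a s IHs] x /= /andP[xa ps] fx.
apply: IHs => //; have := lift_pi (f_adj _ _ xa).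
by rewrite fx pi_f lift_pi.
Qed.

End Coverings.

(** * Square-summable functions and local operators *)

Section Bounds.
Context {R : realType} {V : choiceType}.
Implicit Types (g k : V -> R) (f : V -> R[i]).

(** Real bounds of finite partial sums stand in for extended-real sums: they add, scale and compare
    without convergence arguments. *)
Definition sum_bounded g (Y : R) := forall X : {fset V}, \sum_(x <- X) g x <= Y.

Lemma sum_bounded_ge0 g Y : sum_bounded g Y -> 0 <= Y.
Proof. by move=> /(_ fset0); rewrite big_seq_fset0. Qed.

Lemma sum_bounded1 g Y x : sum_bounded g Y -> g x <= Y.
Proof. by move=> /(_ [fset x]%fset); rewrite big_seq_fset1. Qed.

Lemma sum_bounded_le g k Y : (forall x, g x <= k x) ->
  sum_bounded k Y -> sum_bounded g Y.
Proof. by move=> gk kY X; apply: le_trans (kY X); exact: ler_sum. Qed.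

Lemma sum_boundedD g k Y Z : sum_bounded g Y -> sum_bounded k Z ->
  sum_bounded (fun x => g x + k x) (Y + Z).
Proof. by move=> gY kZ X; rewrite big_split lerD. Qed.

Lemma sum_boundedZ g Y (c : R) : 0 <= c -> sum_bounded g Y ->
  sum_bounded (fun x => c * g x) (c * Y).
Proof. by move=> c0 gY X; rewrite -mulr_sumr ler_wpM2l. Qed.

Lemma sum_bounded_seq g Y (s : seq V) : sum_bounded g Y -> uniq s ->
  \sum_(x <- s) g x <= Y.
Proof.
move=> gY us; rewrite (perm_big [fset x in s]%fset) ?gY//=.
by apply: uniq_perm => // x; rewrite !inE.
Qed.

Lemma sum_fset_sub g (X Z : {fset V}) : (forall x, 0 <= g x) ->
  (forall x, x \in X -> g x != 0 -> x \in Z) ->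
  \sum_(x <- X) g x <= \sum_(x <- Z) g x.
Proof.
move=> g0 XZ; rewrite (big_fsetID _ (mem Z))/= addrC big_seq big1 ?add0r; last first.
  move=> x; rewrite !inE => /andP[xX xZ]; apply/eqP/negPn/negP => /(XZ _ xX).
  exact/negP.
rewrite [leRHS](big_fsetID _ (mem X))/= ler_wpDr ?sumr_ge0//.
rewrite le_eqVlt; apply/orP; left; apply/eqP; congr (\sum_(x <- _) _).
by congr enum_fset; apply/fsetP => x; rewrite !inE andbC.
Qed.

(** The least bound is what a contraction inequality is solved for. *)
Lemma sum_bounded_sup g Y : sum_bounded g Y ->
  exists2 s, sum_bounded g s & forall Z, sum_bounded g Z -> s <= Z.
Proof.
move=> gY; pose A := [set \sum_(x <- X) g x | X in [set: {fset V}]]%classic.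
have A0 : (A !=set0)%classic by exists (\sum_(x <- fset0) g x), fset0.
exists (sup A) => [X|Z gZ].
  by apply: ub_le_sup; [exists Y => _ [Z _ <-]; exact: gY|exists X].
by apply: ge_sup => // _ [X _ <-]; exact: gZ.
Qed.

Lemma sqsum_bounded (f : V -> R[i]) : f \in sqsummable ->
  sum_bounded (fun x => nsq (f x)) (fine (sqsum f)).
Proof. by move=> fl X; exact: sqsum_fset. Qed.

Lemma sqsum_fine_le (f : V -> R[i]) Y : sum_bounded (fun x => nsq (f x)) Y ->
  f \in sqsummable /\ fine (sqsum f) <= Y.
Proof.
move=> fY; have fl : f \in sqsummable by exact: sqsummableP fY.
split=> //; rewrite -lee_fin fineK; last first.
  by rewrite ge0_fin_numE// esum_ge0// => v _; rewrite lee_fin sqr_ge0.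
apply: ge_ereal_sup => _ [X [finX _] <-].
by rewrite fsbig_finite//= sumEFin lee_fin; exact: fY.
Qed.

Lemma l2norm_sqr (f : ell2 R V) : l2norm f ^+ 2 = fine (sqsum f).
Proof. by rewrite sqr_sqrtr// fine_ge0// esum_ge0// => v _; rewrite lee_fin sqr_ge0. Qed.

Lemma ell2_bounded (f : ell2 R V) :
  sum_bounded (fun x => nsq (f x)) (l2norm f ^+ 2).
Proof. by rewrite l2norm_sqr; exact/sqsum_bounded/ell2P. Qed.

Lemma l2norm_le (f : ell2 R V) Y : sum_bounded (fun x => nsq (f x)) Y ->
  l2norm f ^+ 2 <= Y.
Proof. by rewrite l2norm_sqr => /sqsum_fine_le[]. Qed.

Lemma ell2_of_bounded (f : V -> R[i]) Y : sum_bounded (fun x => nsq (f x)) Y ->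
  exists g : ell2 R V, forall x, g x = f x.
Proof. by move=> /sqsum_fine_le[fl _]; exists (Ell2 fl). Qed.

Lemma ell2_restrict (f : ell2 R V) (B : pred V) :
  exists g : ell2 R V, forall x, g x = if B x then f x else 0.
Proof.
apply: (@ell2_of_bounded _ (l2norm f ^+ 2)).
apply: sum_bounded_le (ell2_bounded f) => x.
by case: (B x) => //; rewrite nsq0 nsq_ge0.
Qed.

Lemma ell2_reindex (f : ell2 R V) (phi : V -> V) : injective phi ->
  exists g : ell2 R V, forall x, g x = f (phi x).
Proof.
move=> phi_inj; apply: (@ell2_of_bounded _ (l2norm f ^+ 2)) => X.
have := @sum_bounded_seq _ _ (map phi X) (ell2_bounded f).
by rewrite big_map; apply; rewrite map_inj_uniq.
Qed.

Lemma ell2_ext (f g : ell2 R V) : (forall x, f x = g x) -> f = g.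
Proof. by move=> fg; apply/val_inj/funext. Qed.

Lemma ell2DE (f g : ell2 R V) x : (f + g) x = f x + g x.
Proof. by []. Qed.

Lemma ell2ZE (c : R[i]) (f : ell2 R V) x : (c *: f) x = c * f x.
Proof. by []. Qed.

Lemma ell2_0E x : (0 : ell2 R V) x = 0.
Proof. by []. Qed.

(** The partial sums are constant once the index set contains [s]. *)
Lemma sum_finite_support (F : V -> R[i]) (s : seq V) : uniq s ->
  (forall x, x \notin s -> F x = 0) ->
  summability.sum (F : V -> R[i]^o) = \sum_(x <- s) F x.
Proof.
move=> us F0; apply: (@norm_lim_near_cst _ _ _ _ summability.totally_filter).
exists [fset x in s]%fset => //= J /fsubsetP sJ.
rewrite /summability.partial_sum -(big_seq_fsetE _ J xpredT F)/=.
rewrite [RHS](perm_big [fset x in s]%fset); last first.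
  by apply: uniq_perm => // x; rewrite !inE.
by symmetry; apply: big_fset_incl => [|x _]; [exact/fsubsetP|rewrite !inE => /F0].
Qed.

End Bounds.

(** * Symmetric local operators as sums over neighbours *)

Section Operator.
Context {R : realType} {VH : finType} (H : sgraph VH).
Context {VT : choiceType} (T : sgraph VT) (pi : VT -> VH).
Context (M : {linear ell2 R VT -> ell2 R VT}).
Local Notation C := R[i].
Hypothesis covT : universal_cover T H pi.
Hypotheses (M_sym : symmetric_op M) (M_loc : local_op T M).
Hypotheses (M_con : connected_op T M) (M_pb : pulled_back T pi M).
Local Notation m := (coef T pi M).
Local Notation lft := (lift T pi).

Lemma ell2_conjK (f : ell2 R VT) : ell2_conj (ell2_conj f) = f.
Proof. by apply: ell2_ext => x /=; rewrite conjCK. Qed.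

(** The adjoint of [M] is its entrywise conjugate, so [M] is symmetric for the bilinear pairing;
    testing with the conjugate of [g] removes the conjugations. *)
Lemma op_sym_finite (f g : ell2 R VT) (s : seq VT) : uniq s ->
  (forall x, x \notin s -> f x * M g x = 0) ->
  (forall x, x \notin s -> M f x * g x = 0) ->
  \sum_(x <- s) f x * M g x = \sum_(x <- s) M f x * g x.
Proof.
move=> us fMg Mfg; have := M_sym f (ell2_conj g).
rewrite /inner !(@sum_finite_support _ _ _ s)//; last first.
- by move=> x /fMg; rewrite /= ell2_conjK -rmorphM /= => ->; rewrite conjC0.
- by move=> x /Mfg; rewrite /= -rmorphM /= => ->; rewrite conjC0.
rewrite /= ell2_conjK => e; apply: (can_inj (@conjCK R[i])).
rewrite !rmorph_sum /=; move: e.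
under eq_bigr do rewrite -rmorphM; under [RHS]eq_bigr do rewrite -rmorphM.
exact.
Qed.

Lemma inner_delta x (f : ell2 R VT) : inner (delta x) f = f x.
Proof.
rewrite /inner (@sum_finite_support _ _ _ [:: x])//.
  by rewrite big_seq1 /= eqxx conjC1 mul1r.
by move=> y; rewrite inE /= => /negPf ->; rewrite conjC0 mul0r.
Qed.

Lemma op_delta x y : M (delta y) x = entry M x y.
Proof. by rewrite /entry inner_delta. Qed.

Lemma op_sym_delta (f : ell2 R VT) x (s : seq VT) : uniq s -> x \in s ->
  (forall y, y \notin s -> M (delta x) y = 0) ->
  M f x = \sum_(y <- s) M (delta x) y * f y.
Proof.
move=> us xs Ms; rewrite -(@op_sym_finite (delta x) f s)//.
- rewrite (bigD1_seq x)//= eqxx mul1r big1 ?addr0// => y /negPf ->.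
  by rewrite mul0r.
- by move=> y ys /=; case: eqP ys => [->|]; rewrite ?xs// mul0r.
- by move=> y /Ms ->; rewrite mul0r.
Qed.

Lemma entry_sym x y : entry M x y = entry M y x.
Proof.
rewrite -!op_delta; pose s := undup [:: x; y].
have := @op_sym_finite (delta x) (delta y) s (undup_uniq _).
have xs : x \in s by rewrite mem_undup !inE eqxx.
have ys : y \in s by rewrite mem_undup !inE eqxx orbT.
rewrite (bigD1_seq x)//= ?undup_uniq// (bigD1_seq y)//= ?undup_uniq//.
rewrite !eqxx mul1r mulr1 !big1 ?addr0 => [|z /negPf -> |z /negPf ->]; last 2 first.
- by rewrite mulr0.
- by rewrite mul0r.
apply=> z zs; first by case: eqP zs => [->|]; rewrite ?xs// mul0r.
by case: eqP zs => [->|]; rewrite ?ys// mulr0.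
Qed.

Lemma coefE x y : (x == y) || T x y -> m (pi x) (pi y) = entry M x y.
Proof.
move=> xy; rewrite /coef; case: xgetP => [_ -> [x' [y' [xy' xx yy ->]]]|].
  exact: M_pb.
by move=> /(_ (entry M x y))[]; exists x, y.
Qed.

Hypothesis conH : connected_graph H.

Lemma coef_sym a b : H a b -> m a b = m b a.
Proof.
move=> /(cover_edge covT conH)[u [v [uv <- <-]]].
by rewrite !coefE ?uv ?orbT// 1?entry_sym// adj_sym uv orbT.
Qed.

Lemma coef_neq0 a b : H a b -> m a b != 0.
Proof.
move=> /(cover_edge covT conH)[u [v [uv <- <-]]].
by rewrite coefE ?uv ?orbT//; exact: M_con.
Qed.

(** Defined for arbitrary functions on [VT], so that the terms in the energy estimates carry no
    proof of square-summability. *)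
Definition local_sum (f : VT -> C) x : C :=
  m (pi x) (pi x) * f x + \sum_(b | H (pi x) b) m (pi x) b * f (lft x b).

(** [M f x] is the pairing of [M f] with [delta x]. By symmetry it is the pairing of [f] with the
    column [M (delta x)], which has finite support. *)
Lemma opE (f : ell2 R VT) x : M f x = local_sum f x.
Proof.
pose s := x :: [seq lft x b | b <- enum [pred b | H (pi x) b]].
have us : uniq s.
  rewrite /= map_inj_in_uniq ?enum_uniq ?andbT.
    apply/mapP => -[b]; rewrite mem_enum inE => /(lift_adj covT) /[swap] <-.
    by rewrite adj_irr.
  move=> b c; rewrite !mem_enum !inE => xb xc /(congr1 pi).
  by rewrite !(pi_lift covT).
rewrite (@op_sym_delta f x s) ?mem_head//; last first.
  move=> y; rewrite inE negb_or => /andP[yx /mapP ys]; rewrite op_delta M_loc//.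
  apply/negP => yx'; apply: ys; exists (pi y); last first.
    by rewrite (lift_pi covT)// adj_sym.
  by rewrite mem_enum inE; apply: (cover_adj covT); rewrite adj_sym.
rewrite big_cons big_map big_enum_cond /=; congr (_ + _).
  by rewrite op_delta coefE ?eqxx.
apply: eq_big => [b|b]; rewrite !inE ?andbT// => xb.
rewrite op_delta entry_sym -coefE ?(pi_lift covT)//.
by rewrite (lift_adj covT)// orbT.
Qed.

End Operator.

(** * Ratio systems as functions of pairs of vertices *)

Section EdgeFunctions.
Context {VH : finType} (H : sgraph VH).

Definition edge_of a b (ab : H a b) : dedge H :=
  exist (fun e : VH * VH => is_true (H e.1 e.2)) (a, b) ab.

Lemma edge_ofK (e : dedge H) (h : H (dtail e) (dhead e)) : edge_of h = e.
Proof. by apply: val_inj; case: e h => -[]. Qed.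

Lemma dedge_adj (e : dedge H) : H (dtail e) (dhead e).
Proof. exact: (valP e). Qed.

Definition edge_fun {D : Type} (F : VH -> VH -> D) (e : dedge H) : D :=
  F (dtail e) (dhead e).

(** Directed edges carry adjacency proofs. Passing to functions of two vertices loses nothing and
    removes these proofs from the formulas. *)
Lemma edge_fun_surj {D : Type} (x0 : D) (f : dedge H -> D) :
  exists F : VH -> VH -> D, f = edge_fun F.
Proof.
exists (fun a b => if @idP (H a b) is ReflectT h then f (edge_of h) else x0).
apply/funext => e; rewrite /edge_fun; case: {-}_ / idP => [h|]; last first.
  by move=> /(_ (dedge_adj e)).
by rewrite edge_ofK.
Qed.

Lemma sum_follows {D : nmodType} (F : dedge H -> D) (G : VH -> VH -> D) a b
    (ab : H a b) : (forall c (bc : H b c), F (edge_of bc) = G b c) ->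
  \sum_(f | follows (edge_of ab) f) F f = \sum_(c | H b c && (c != a)) G b c.
Proof.
move=> FG; have ba : (b == a) = false.
  by apply: contraTF ab => /eqP ->; rewrite adj_irr.
(* For [c] not adjacent to [b] the value is [edge_of ab], which does not follow itself, so such [c]
   drop out. *)
pose h c := if @idP (H b c) is ReflectT bc then edge_of bc else edge_of ab.
rewrite (reindex_onto h (@dhead _ H)) => /=; last first.
  move=> f /andP[/eqP bf _]; rewrite /h; rewrite /dhead /= in bf.
  by case: {-}_ / idP => [bc|[]]; [apply: val_inj; case: f bf bc => -[/= x y ?] -> |
    rewrite bf; exact: dedge_adj].
apply: eq_big => [c|c]; rewrite /h; case: {-}_ / idP => [bc|bc].
- rewrite /follows /= bc /dhead /dtail /= !eqxx andbT /=.
  congr (~~ _); apply/eqP/eqP => [/(congr1 val) []//|ca].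
  by apply: val_inj; rewrite /= ca.
- by rewrite (introF idP bc) /follows /dtail /dhead /= ba.
- by move=> _; rewrite FG.
- by rewrite /follows /dtail /dhead /= ba.
Qed.

End EdgeFunctions.

Section PairForm.
Context {R : realType} {VH : finType} (H : sgraph VH).
Local Notation C := R[i].
Variables (m : VH -> VH -> C) (rho : VH -> VH -> option C).
Local Notation r := (@edge_fun _ H _ rho).

Definition pair_ratio_system : Prop :=
  [/\ forall a b, H a b -> rho a b != Some 0 ->
        0 = m b b + divoo (m b a) (rho a b)
            + \sum_(c | H b c && (c != a)) m b c * odflt 0 (rho b c),
      forall a b, H a b -> rho a b = Some 0 ->
        exists c, [/\ H b c, c != a & rho b c = None] &
      forall a b c, H a b -> H b c -> c != a -> rho b c = None ->
        rho a b = Some 0 /\ rho c b != Some 0].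

Lemma edge_ind (P : dedge H -> Prop) :
  (forall a b (ab : H a b), P (edge_of ab)) -> forall e, P e.
Proof. by move=> PH e; rewrite -(edge_ofK (dedge_adj e)). Qed.

Lemma follows_edge_of a b c (ab : H a b) (bc : H b c) :
  follows (edge_of ab) (edge_of bc) = (c != a).
Proof.
rewrite /follows eqxx /=; congr (~~ _).
apply/eqP/eqP => [/(congr1 val)[]//|ca]; apply: val_inj => /=.
by rewrite /dhead /dtail /= ca.
Qed.

Lemma followsP a b (ab : H a b) f : follows (edge_of ab) f ->
  exists c (bc : H b c), f = edge_of bc /\ c != a.
Proof.
elim/edge_ind: f => b' c bc /[dup] /andP[/eqP]; rewrite /dhead /dtail /=.
move=> e _; move: bc; rewrite -e => bc; rewrite follows_edge_of => ca.
by exists c, bc.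
Qed.

Lemma ratio_systemP : ratio_system m r <-> pair_ratio_system.
Proof.
split=> -[ra rb rc]; split.
- move=> a b ab /(ra (edge_of ab)) e; rewrite [LHS]e; congr (_ + _).
  exact: (sum_follows (G := fun b c => m b c * odflt 0 (rho b c))).
- move=> a b ab /(rb (edge_of ab))[f /followsP[c [bc [-> ca]]] fN].
  by exists c.
- move=> a b c ab bc ca rbc.
  by apply: (rc (edge_of ab) (edge_of bc)) => //; rewrite follows_edge_of.
- elim/edge_ind => a b ab /(ra _ _ ab) e; rewrite [LHS]e; congr (_ + _).
  symmetry.
  exact: (sum_follows (G := fun b c => m b c * odflt 0 (rho b c))).
- elim/edge_ind => a b ab /(rb _ _ ab)[c [bc ca rbc]].
  by exists (edge_of bc) => //; rewrite follows_edge_of.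
- elim/edge_ind => a b ab f + /followsP[c [bc [fE ca]]]; rewrite fE => rf.
  exact: (rc a b c).
Qed.

(** A row of [R A], grouped by the branch at [c] behind [(a, b)]: edges with finite ratio are one
    step away, those with [r = oo] two. *)
Definition decay_row (A : VH -> VH -> R) a b : R :=
  \sum_(c | H b c && (c != a))
    ((if rho b c is Some z then nsq z * A b c else 0) +
     \sum_(d | [&& H c d, d != b & rho c d == None])
       nsq (m c b / m c d) * A c d).

Lemma decay_rowE (A : VH -> VH -> R) a b (ab : H a b) :
  \sum_(f | r f != Some 0) decay_entry m r (edge_of ab) f * edge_fun A f
  = decay_row A a b.
Proof.
(* An intermediate edge is inserted in both cases, equal to [f] itself if [r f] is finite; then the
   two summations can be exchanged. *)
pose D (e' f : dedge H) : R := if r f is Some z then (e' == f)%:R * nsq z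
  else (follows e' f)%:R * nsq (coef_e m (Defs.dinv e') / coef_e m f).
transitivity (\sum_f \sum_(e' | follows (edge_of ab) e') D e' f * edge_fun A f).
  rewrite big_mkcond; apply: eq_bigr => f _; rewrite -mulr_suml.
  case: ifPn => [_|/negPn/eqP rf]; last first.
    by rewrite /D rf big1 ?mul0r// => i _; rewrite nsq0 mulr0.
  congr (_ * _); rewrite /decay_entry /D; case: (r f) => [z|].
    case: ifPn => ef; last first.
      rewrite big1// => e' ee'; case: eqP => [e'f|]; rewrite ?mul0r//.
      by rewrite e'f (negPf ef) in ee'.
    rewrite (bigD1 f)//= eqxx mul1r big1 ?addr0// => e' /andP[_ /negPf ->].
    by rewrite mul0r.
  rewrite big_mkcondr; apply: eq_bigr => e' _.
  by case: ifP; rewrite ?mul1r ?mul0r.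
rewrite exchange_big /=.
apply: (@sum_follows _ _ _ _ (fun b c =>
  (if rho b c is Some z then nsq z * A b c else 0) +
  \sum_(d | [&& H c d, d != b & rho c d == None])
    nsq (m c b / m c d) * A c d)) => c bc.
rewrite (bigID (fun f => r f == None)) /= addrC; congr (_ + _).
  rewrite (eq_bigr (fun f => if edge_of bc == f then
    (if rho b c is Some z then nsq z * A b c else 0) else 0)); last first.
    move=> f; have [<-|bcf] := eqVneq (edge_of bc) f.
      rewrite /D /edge_fun /dtail /dhead /=; case: (rho b c) => // z _.
      by rewrite eqxx mul1r.
    rewrite /D; case: (r f) => // z _.
    by rewrite (negPf bcf) !mul0r.
  rewrite -big_mkcondr /=; case rbc: (rho b c) => [z|]; last by rewrite big1.
  rewrite (big_pred1 (edge_of bc)) // => f /=.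
  rewrite [in RHS]eq_sym; have [<-|] := eqVneq (edge_of bc) f; rewrite ?andbF//.
  by rewrite /edge_fun /dtail /dhead /= rbc.
rewrite (eq_bigr (fun f => if follows (edge_of bc) f then
   nsq (m c b / coef_e m f) * edge_fun A f else 0)); last first.
  move=> f /eqP rf; rewrite /D rf /coef_e.
  by case: ifP; rewrite ?mul0r ?mul1r.
rewrite -big_mkcondr /=.
rewrite (eq_bigl (fun f => follows (edge_of bc) f && (r f == None))); last first.
  by move=> f; rewrite andbC.
rewrite big_mkcondr /=.
rewrite (sum_follows (G := fun c d => if rho c d == None then
   nsq (m c b / m c d) * A c d else 0))//.
by rewrite -big_mkcondr /=; apply: eq_bigl => d; rewrite -andbA.
Qed.

Lemma decay_entry_ge0 (e f : dedge H) : 0 <= decay_entry m r e f.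
Proof.
rewrite /decay_entry; case: (r f) => [z|]; first by case: ifP; rewrite ?sqr_ge0.
by apply: sumr_ge0 => *; exact: sqr_ge0.
Qed.

Lemma decay_matrix_rowE (A : VH -> VH -> R) i :
  let J := [pred e | r e != Some 0] in
  \sum_j decay_matrix m r i j * edge_fun A (enum_val j)
  = decay_row A (dtail (enum_val i : dedge H)) (dhead (enum_val i : dedge H)).
Proof.
move=> J; have := decay_rowE A (dedge_adj (enum_val i)).
rewrite edge_ofK => <-; rewrite [RHS](eq_bigl (mem J))// [RHS](big_enum_val (A := J)).
by apply: eq_bigr => j _; rewrite mxE.
Qed.

Lemma decay_rate_weights : decay_rate m r < 1 ->
  exists A : VH -> VH -> R, forall a b, H a b -> rho a b != Some 0 ->
    1 <= A a b /\ A a b = 1 + decay_row A a b.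
Proof.
move=> /spectral_radius_resolvent[|A' A'P].
  by move=> i j; rewrite mxE decay_entry_ge0.
pose J := [pred e : dedge H | r e != Some 0].
pose f (e : dedge H) : R :=
  if [pick i : 'I_#|J| | enum_val i == e] is Some i then A' i else 0.
have [A fA] := edge_fun_surj 0 f; exists A => a b ab rab.
have eJ : edge_of ab \in J by [].
have fE i : f (enum_val i) = A' i.
  rewrite /f; case: pickP => [j /eqP/enum_val_inj -> //|/(_ i)].
  by rewrite eqxx.
have := A'P (enum_rank_in eJ (edge_of ab)); set i := enum_rank_in _ _.
have iE : enum_val i = edge_of ab by rewrite enum_rankK_in.
rewrite -fE iE fA => -[A1 AE]; split; first exact: A1.
rewrite [LHS]AE; congr (_ + _); have := decay_matrix_rowE A i.
rewrite iE /= => <-; apply: eq_bigr => j _.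
by rewrite -fA fE.
Qed.

Lemma weights_decay_rate (A : VH -> VH -> R) :
  (forall a b, H a b -> rho a b != Some 0 -> 0 <= A a b) ->
  (forall a b, H a b -> rho a b != Some 0 -> 1 + decay_row A a b <= A a b) ->
  decay_rate m r < 1.
Proof.
move=> A0 A1; pose J := [pred e : dedge H | r e != Some 0].
have rJ i : r (enum_val (i : 'I_#|J|)) != Some 0 by exact: (enum_valP i).
apply: (@spectral_radius_lt1 _ _ _ _ (fun i => edge_fun A (enum_val i))).
- by move=> i j; rewrite mxE decay_entry_ge0.
- by move=> i; apply: A0; [exact: dedge_adj|exact: rJ].
- move=> i; rewrite decay_matrix_rowE.
  by apply: A1; [exact: dedge_adj|exact: rJ].
Qed.

End PairForm.

(** * From the inverse to a ratio system *)

Section GeneralizedRatio.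
Context {R : realType}.
Implicit Types a b : R[i].

Lemma gratio_eq a b a' b' : ~ (b = 0 /\ a = 0) -> ~ (b' = 0 /\ a' = 0) ->
  b * a' = a * b' -> gratio b a = gratio b' a'.
Proof.
rewrite /gratio => ab ab'; have [a0|a0] := eqVneq a 0.
  rewrite a0 mul0r => /eqP; rewrite mulf_eq0 => /orP[/eqP b0|/eqP ->]; last by rewrite eqxx.
  by case: ab.
have [a'0 /eqP|a'0] := eqVneq a' 0.
  rewrite a'0 mulr0 eq_sym mulf_eq0 (negPf a0) /= => /eqP b'0.
  by case: ab'.
by move=> e; congr Some; apply/eqP; rewrite eqr_div// e mulrC.
Qed.

End GeneralizedRatio.

Section SupersetSums.
Context {R : realType} {V : choiceType}.

Lemma sqsum_super (I : finType) (P : pred I) (F : I -> V -> R[i]) (f : ell2 R V) :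
  (forall x, \sum_(i | P i) nsq (F i x) <= nsq (f x)) ->
  \sum_(i | P i) fine (sqsum (F i)) <= l2norm f ^+ 2.
Proof.
move=> Ff; have Fl i : P i -> F i \in sqsummable.
  move=> Pi; suff /sqsum_fine_le[] :
    sum_bounded (fun x => nsq (F i x)) (l2norm f ^+ 2) by [].
  apply: sum_bounded_le (ell2_bounded f) => x; apply: le_trans (Ff x).
  by rewrite (bigD1 i)//= lerDl sumr_ge0// => j _; exact: nsq_ge0.
rewrite l2norm_sqr -lee_fin -sumEFin.
have fin_sq (g : V -> R[i]) : g \in sqsummable -> ((fine (sqsum g))%:E = sqsum g)%E.
  move=> gl; rewrite fineK// ge0_fin_numE// esum_ge0// => v _.
  by rewrite lee_fin sqr_ge0.
rewrite (eq_bigr (fun i => sqsum (F i))); last by move=> i /Fl /fin_sq.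
rewrite fin_sq ?ell2P// /sqsum -esum_sum; last first.
  by move=> x i _ _; rewrite lee_fin sqr_ge0.
by apply: le_esum => x _; rewrite sumEFin lee_fin; exact: Ff.
Qed.

End SupersetSums.

(** Otherwise clause (c) would make the ratio on [(c', b)] zero through [(b, c)] and nonzero through
    [(b, c')]. *)
Lemma ratio_system_None_unique {R : realType} {VH : finType} (H : sgraph VH)
    (m : VH -> VH -> R[i]) rho b c c' :
  pair_ratio_system H m rho -> H b c -> H b c' ->
  rho b c = None -> rho b c' = None -> c = c'.
Proof.
move=> [_ _ rc] bc bc' rbc rbc'; apply/eqP/negPn/negP => cc'.
have [r1 _] := rc c' b c (etrans (adj_sym H _ _) bc') bc cc' rbc.
rewrite eq_sym in cc'.
have [_] := rc c b c' (etrans (adj_sym H _ _) bc) bc' cc' rbc'.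
by rewrite r1 eqxx.
Qed.

Section InverseToRatioSystem.
Context {R : realType} {VH : finType} (H : sgraph VH).
Context {VT : choiceType} (T : sgraph VT) (pi : VT -> VH).
Context (M N : {linear ell2 R VT -> ell2 R VT}).
Local Notation C := R[i].
Hypotheses (conH : connected_graph H) (covT : universal_cover T H pi).
Hypotheses (M_sym : symmetric_op M) (M_loc : local_op T M).
Hypotheses (M_con : connected_op T M) (M_pb : pulled_back T pi M).
Hypotheses (MK : cancel M N) (NK : cancel N M).
Local Notation m := (coef T pi M).
Local Notation lft := (lift T pi).

Local Notation T_tree := (cover_tree covT).
Local Notation branch := (branch T_tree).

Let ME f x : M f x = local_sum H T pi M f x.
Proof. exact: opE. Qed.

(** The equation at [v] sees [psi u], so a solution carries one value outside the branch; the ratio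
    compares it with [psi v]. *)
Definition branch_solution u v (psi : ell2 R VT) :=
  forall x, branch u v x -> M psi x = 0.

Lemma branch_solution_sub u v x psi : T u v -> x != u ->
  branch_solution u v psi -> branch_solution v x psi.
Proof. by move=> uv xu sol y vxy; apply: sol; exact: branch_sub xu vxy. Qed.

Lemma branch_solutionZ u v (c : C) psi :
  branch_solution u v psi -> branch_solution u v (c *: psi).
Proof. by move=> sol x /sol e; rewrite linearZ ell2ZE e mulr0. Qed.

(** * Truncation of a function to a branch *)

Section Restriction.
Variables (u v : VT) (f f' : ell2 R VT).
Hypotheses (uv : T u v) (ff' : forall x, f' x = if branch u v x then f x else 0).

Let lift_uv : lft u (pi v) = v. Proof. by rewrite (lift_pi covT). Qed.
Let lift_vu : lft v (pi u) = u. Proof. by rewrite (lift_pi covT)// adj_sym. Qed.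

Lemma restrict_in x : branch u v x -> x != v -> M f' x = M f x.
Proof.
move=> Bx xv; rewrite !ME /local_sum ff' Bx; congr (_ + _).
apply: eq_bigr => b xb; rewrite ff'; case: ifPn => // By.
have [xE _] := branch_boundary (lift_adj covT xb) Bx By.
by rewrite xE eqxx in xv.
Qed.

Lemma restrict_head : M f' v = M f v - m (pi v) (pi u) * f u.
Proof.
have vu : H (pi v) (pi u) by apply: (cover_adj covT); rewrite adj_sym.
rewrite !ME /local_sum ff' (branch_head T_tree uv) -addrA; congr (_ + _).
rewrite (bigD1 (pi u))//= [in RHS](bigD1 (pi u))//= lift_vu ff'.
rewrite (branch_tail T_tree uv) mulr0 add0r addrAC subrr add0r.
apply: eq_bigr => b /andP[vb bu]; rewrite ff'; case: ifPn => // By.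
have [_ yE] := branch_boundary (lift_adj covT vb) (branch_head T_tree uv) By.
by rewrite -yE (pi_lift covT)// eqxx in bu.
Qed.

Lemma restrict_tail : M f' u = m (pi u) (pi v) * f v.
Proof.
have uv' : H (pi u) (pi v) by exact: (cover_adj covT).
rewrite ME /local_sum ff' (branch_tail T_tree uv) mulr0 add0r.
rewrite (bigD1 (pi v))//= lift_uv ff' (branch_head T_tree uv) big1 ?addr0//.
move=> b /andP[ub bv]; rewrite ff'; case: ifPn; rewrite ?mulr0// => By.
have yu : T (lft u b) u by rewrite adj_sym (lift_adj covT).
have := branch_boundary yu By; rewrite (branch_tail T_tree uv) => /(_ isT)[yE _].
by rewrite -yE (pi_lift covT)// eqxx in bv.
Qed.

Lemma restrict_out x : ~~ branch u v x -> x != u -> M f' x = 0.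
Proof.
move=> Bx xu; rewrite ME /local_sum ff' (negPf Bx) mulr0 add0r big1// => b xb.
rewrite ff'; case: ifPn; rewrite ?mulr0// => By.
have yx : T (lft x b) x by rewrite adj_sym (lift_adj covT).
by have [_ xE] := branch_boundary yx By Bx; rewrite xE eqxx in xu.
Qed.

End Restriction.

(** For the truncations only the terms at [v] survive in the symmetry of [M]. There [M phi'] equals
    [- m phi u], and the factor [m] is nonzero. *)
Lemma wronskian u v psi phi : T u v ->
  branch_solution u v psi -> branch_solution u v phi ->
  psi v * phi u = psi u * phi v.
Proof.
move=> uv spsi sphi.
have [psi' psi'E] := ell2_restrict psi (branch u v).
have [phi' phi'E] := ell2_restrict phi (branch u v).
have Bv := branch_head T_tree uv.
have sol0 (f f' g : ell2 R VT) : branch_solution u v g ->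
    (forall x, f x = if branch u v x then f' x else 0) ->
    forall h : ell2 R VT, (forall x, h x = if branch u v x then g x else 0) ->
    forall x, x \notin [:: v] -> f x * M h x = 0.
  move=> sg fE h hE x; rewrite inE => xv.
  have [Bx|Bx] := boolP (branch u v x); last by rewrite fE (negPf Bx) mul0r.
  by rewrite (restrict_in hE)// sg// mulr0.
have := @op_sym_finite _ _ M M_sym psi' phi' [:: v] isT.
rewrite !big_seq1 => /(_ (sol0 _ _ _ sphi psi'E _ phi'E)) e.
have {e} := e (fun x xv => etrans (mulrC _ _) (sol0 _ _ _ spsi phi'E _ psi'E x xv)).
rewrite (restrict_head uv psi'E) (restrict_head uv phi'E) spsi// sphi//.
rewrite psi'E phi'E Bv !sub0r => e.
have mn0 : m (pi v) (pi u) != 0.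
  by apply: (coef_neq0 covT) => //; apply: (cover_adj covT); rewrite adj_sym.
apply: (mulfI mn0); apply: oppr_inj.
transitivity (psi v * - (m (pi v) (pi u) * phi u)); first by ring.
by rewrite e; ring.
Qed.

Lemma op_inj f : (forall x, M f x = 0) -> forall x, f x = 0.
Proof.
move=> f0 x; have -> : f = 0 by rewrite -(MK f) (_ : M f = 0) ?linear0//; exact: ell2_ext.
exact: ell2_0E.
Qed.

Lemma green_sym u w : N (delta u) w = N (delta w) u.
Proof.
pose s := undup [:: u; w].
have us : u \in s by rewrite mem_undup !inE eqxx.
have ws : w \in s by rewrite mem_undup !inE eqxx orbT.
have := @op_sym_finite _ _ M M_sym (N (delta u)) (N (delta w)) s (undup_uniq _).
rewrite !NK (bigD1_seq w)//= ?undup_uniq// [in RHS](bigD1_seq u)//= ?undup_uniq//.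
rewrite !eqxx mulr1 mul1r !big1 ?addr0 => [|z /negPf -> |z /negPf ->]; last 2 first.
- by rewrite mul0r.
- by rewrite mulr0.
apply=> z zs; first by case: eqP zs => [->|]; rewrite ?ws// mulr0.
by case: eqP zs => [->|]; rewrite ?us// mul0r.
Qed.

(** Green functions [N (delta w)] with [w] off the branch are solutions. If all of them vanished at
    [u] and [v], then by symmetry [N (delta u)] would vanish at [u] and all its neighbours, against
    the equation at [u]. *)
Lemma branch_solution_exists u v : T u v ->
  exists psi, branch_solution u v psi /\ ~ (psi v = 0 /\ psi u = 0).
Proof.
move=> uv; apply/not_existsP => none.
have G0 w : ~~ branch u v w -> N (delta w) v = 0 /\ N (delta w) u = 0.
  move=> Bw; apply: contrapT => nz; apply: (none (N (delta w))); split => //.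
  by move=> x Bx; rewrite NK /=; case: eqP Bx Bw => // -> ->.
have Bu := branch_tail T_tree uv.
have [Gv Gu] := G0 u (negbT Bu).
have := congr1 (fun f : ell2 R VT => f u) (NK (delta u)).
rewrite /= ME /local_sum Gu mulr0 add0r eqxx big1 => [|b ub].
  by move/eqP; rewrite eq_sym oner_eq0.
have [By|By] := boolP (branch u v (lft u b)); last first.
  by rewrite green_sym (G0 _ By).2 mulr0.
have yu : T (lft u b) u by rewrite adj_sym (lift_adj covT).
by have := branch_boundary yu By; rewrite Bu => /(_ isT)[-> _]; rewrite Gv mulr0.
Qed.

Lemma branch_solution_transport u v u' v' psi : T u v -> T u' v' ->
  pi u = pi u' -> pi v = pi v' -> branch_solution u' v' psi ->
  exists psi', [/\ branch_solution u v psi', psi' u = psi u' & psi' v = psi v'].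
Proof.
move=> uv uv' pu pv sol; pose phi := deck covT u u'.
have phi_inj : injective phi by exact: can_inj (deckK covT pu).
have phi_adj x y : T x y -> T (phi x) (phi y) by exact: deck_adj.
have pi_phi x : pi (phi x) = pi x by exact: pi_deck.
have phi_u : phi u = u' by exact: deck_id.
have phi_lift x y : T x y -> phi y = lft (phi x) (pi y).
  by move=> xy; rewrite -(pi_phi y) (lift_pi covT)//; exact: phi_adj.
have phi_v : phi v = v' by rewrite (phi_lift u)// phi_u pv (lift_pi covT).
have [psi' psi'E] := ell2_reindex psi phi_inj.
exists psi'; split; rewrite ?psi'E ?phi_u ?phi_v// => x Bx.
rewrite -[RHS](sol (phi x)); last first.
  have [p l un] := geodesicP T_tree u x.
  move/eqP: Bx => Bx.
  rewrite -[branch u' v' _]/(ohead (geodesic T_tree u' (phi x)) == Some v').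
  rewrite (@geodesicE _ _ _ _ _ (map phi (geodesic T_tree u x))).
    by case: (geodesic _ _ _) Bx => //= a s [->]; rewrite phi_v.
  rewrite -phi_u; split; last by rewrite -map_cons map_inj_uniq.
    by rewrite (homo_path (e := T))// => y z; exact: phi_adj.
  by rewrite last_map l.
rewrite !ME /local_sum psi'E pi_phi; congr (_ + _).
apply: eq_bigr => b xb; rewrite psi'E (phi_lift x) ?(pi_lift covT)//.
exact: (lift_adj covT).
Qed.

Definition green_ratio a b : option C :=
  xget None [set q | exists u v (psi : ell2 R VT), [/\ [/\ T u v, pi u = a & pi v = b],
    branch_solution u v psi, ~ (psi v = 0 /\ psi u = 0) &
    q = gratio (psi v) (psi u)]]%classic.

Lemma green_ratioE u v psi : T u v -> branch_solution u v psi ->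
  ~ (psi v = 0 /\ psi u = 0) -> green_ratio (pi u) (pi v) = gratio (psi v) (psi u).
Proof.
move=> uv sol nz; rewrite /green_ratio; case: xgetP => [_ -> |]; last first.
  by move=> /(_ (gratio (psi v) (psi u)))[]; exists u, v, psi.
move=> [u' [v' [psi' [[uv' pu pv] sol' nz' ->]]]].
have [phi [solphi phiu phiv]] :=
  branch_solution_transport uv uv' (esym pu) (esym pv) sol'.
rewrite -phiu -phiv; apply: gratio_eq => //; first by rewrite phiu phiv.
exact: wronskian solphi sol.
Qed.

Lemma green_ratio_lift a b : H a b -> exists u v psi,
  [/\ [/\ T u v, pi u = a & pi v = b], branch_solution u v psi,
      ~ (psi v = 0 /\ psi u = 0) & green_ratio a b = gratio (psi v) (psi u)].
Proof.
move=> /(cover_edge covT conH)[u [v [uv pu pv]]].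
have [psi [sol nz]] := branch_solution_exists uv.
by exists u, v, psi; split => //; rewrite -pu -pv; exact: green_ratioE.
Qed.

Lemma green_ratio_next u v psi c : T u v -> branch_solution u v psi ->
  H (pi v) c -> c != pi u -> psi v != 0 ->
  green_ratio (pi v) c = Some (psi (lft v c) / psi v).
Proof.
move=> uv sol vc cu v0; rewrite -{1}(pi_lift covT vc).
rewrite (@green_ratioE _ _ psi) ?(lift_adj covT)//.
- by rewrite /gratio (negPf v0).
- apply: branch_solution_sub sol => //.
  by apply: contra cu => /eqP <-; rewrite (pi_lift covT).
- by move=> [_ /eqP]; exact/negP.
Qed.

Lemma head_equation u v psi : T u v -> branch_solution u v psi ->
  m (pi v) (pi v) * psi v + m (pi v) (pi u) * psi u +
  \sum_(c | H (pi v) c && (c != pi u)) m (pi v) c * psi (lft v c) = 0.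
Proof.
move=> uv /(_ v (branch_head T_tree uv)); rewrite ME /local_sum => e.
rewrite -[RHS]e.
rewrite -addrA; congr (_ + _); rewrite [in RHS](bigD1 (pi u))/=; last first.
  by apply: (cover_adj covT); rewrite adj_sym.
have vu : T v u by rewrite adj_sym.
by rewrite (lift_pi covT vu).
Qed.

Lemma green_ratio_system : pair_ratio_system H m green_ratio.
Proof.
split.
- move=> _ _ /green_ratio_lift[u [v [psi [[uv <- <-] sol nz ->]]]] r0.
  have v0 : psi v != 0.
    apply: contra r0 => /eqP v0; rewrite /gratio v0 mul0r.
    by have [u0|//] := eqVneq (psi u) 0; case: nz.
  have -> : divoo (m (pi v) (pi u)) (gratio (psi v) (psi u))
      = m (pi v) (pi u) * psi u / psi v.
    rewrite /gratio; have [->|u0] := eqVneq; first by rewrite mulr0 mul0r.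
    by rewrite /divoo invf_div mulrA.
  rewrite (eq_bigr (fun c => m (pi v) c * psi (lft v c) / psi v)); last first.
    move=> c /andP[vc cu].
    by rewrite (green_ratio_next uv sol vc cu v0) /= mulrA.
  rewrite -mulr_suml; apply: (mulIf v0); rewrite mul0r !mulrDl !divfK//.
  by rewrite (head_equation uv sol).
- move=> _ _ /green_ratio_lift[u [v [psi [[uv <- <-] sol nz ->]]]] r0.
  have u0 : psi u != 0 by apply/eqP => u0; move: r0; rewrite /gratio u0 eqxx.
  have v0 : psi v = 0.
    move: r0; rewrite /gratio (negPf u0) => -[/eqP].
    by rewrite mulf_eq0 invr_eq0 (negPf u0) orbF => /eqP.
  (* If [psi] vanished at all neighbours of [v] behind the edge, the equation at [v] would read
     [m_vu psi u = 0]. *)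
  apply: contrapT => none.
  have := head_equation uv sol; rewrite v0 mulr0 add0r big1 ?addr0.
    move=> /eqP; rewrite mulf_eq0 (negPf u0) orbF; apply/negP.
    by apply: (coef_neq0 covT) => //; apply: (cover_adj covT); rewrite adj_sym.
  move=> c /andP[vc cu]; apply/eqP; rewrite mulf_eq0 orbC.
  apply/orP; left; apply/negPn/negP => x0; apply: none; exists c; split => //.
  rewrite -(pi_lift covT vc) (@green_ratioE _ _ psi) ?(lift_adj covT)//.
  + by rewrite /gratio v0 eqxx.
  + apply: branch_solution_sub sol => //.
    by apply: contra cu => /eqP <-; rewrite (pi_lift covT).
  + by move=> [/eqP]; rewrite (negPf x0).
- move=> a b c /[dup] ab /green_ratio_lift[u [v [psi [[uv pu pv] sol nz ->]]]].
  rewrite -pv -pu => vc cu rbc; split.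
    have [v0|v0] := eqVneq (psi v) 0; last first.
      by rewrite (green_ratio_next uv sol vc cu v0) in rbc.
    rewrite /gratio v0 mul0r; have [u0|//] := eqVneq (psi u) 0.
    by case: nz.
  set x := lft v c; have vx : T v x by exact: (lift_adj covT).
  have xv : T x v by rewrite adj_sym.
  move: rbc; rewrite -(pi_lift covT vc) -/x.
  have [p1 [sol1 nz1]] := branch_solution_exists vx.
  have [p2 [sol2 nz2]] := branch_solution_exists xv.
  rewrite (green_ratioE vx sol1 nz1) (green_ratioE xv sol2 nz2).
  rewrite /gratio; have [p1v _|//] := eqVneq (p1 v) 0.
  have [//|p2x] := eqVneq (p2 x) 0; apply/eqP => -[/eqP]; rewrite mulf_eq0 invr_eq0 (negPf p2x) orbF => /eqP p2v.
  have p1x : p1 x != 0 by apply/eqP => p1x; case: nz1.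
  have [f fE] := ell2_restrict p1 (branch v x).
  have [g gE] := ell2_restrict p2 (branch x v).
  (* These coefficients cancel the two truncation errors at [v]; those at [x] vanish because
     [p1 v = p2 v = 0]. *)
  pose chi := p2 x *: f + p1 x *: g.
  have chiE y : M chi y = p2 x * M f y + p1 x * M g y.
    by rewrite /chi linearD !linearZ.
  have : chi x = 0.
    apply: op_inj => y; rewrite chiE.
    have [->|yx] := eqVneq y x.
      rewrite (restrict_head vx fE) (restrict_tail xv gE) sol1 ?branch_head//.
      by rewrite p1v p2v !mulr0 subr0 mulr0 addr0.
    have [->|yv] := eqVneq y v.
      rewrite (restrict_tail vx fE) (restrict_head xv gE) sol2 ?branch_head//.
      by ring.
    have := branch_compl T_tree y vx; have [By xvy|By xvy] := boolP (branch v x y).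
      rewrite (restrict_in fE)// (restrict_out gE) ?xvy// sol1//.
      by rewrite !mulr0 addr0.
    rewrite (restrict_out fE)// (restrict_in gE) ?xvy// sol2 ?xvy//.
    by rewrite !mulr0 addr0.
  rewrite /chi ell2DE !ell2ZE fE gE branch_head// branch_tail// mulr0 addr0.
  by move/eqP; rewrite mulf_eq0 (negPf p1x) (negPf p2x).
Qed.

(** * Masses of solutions and the weights they define *)

Definition branch_mass u v (psi : ell2 R VT) : R :=
  fine (sqsum (fun x => if branch u v x then psi x else 0)).

Lemma branch_mass_ge0 u v psi : 0 <= branch_mass u v psi.
Proof. by rewrite fine_ge0// esum_ge0// => x _; rewrite lee_fin sqr_ge0. Qed.

Lemma branch_massP u v (psi f : ell2 R VT) :
  (forall x, f x = if branch u v x then psi x else 0) ->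
  branch_mass u v psi = l2norm f ^+ 2.
Proof.
move=> fE; rewrite l2norm_sqr /branch_mass; congr (fine (sqsum _)).
exact/esym/funext.
Qed.

Lemma branch_mass_super u v (psi : ell2 R VT) : T u v ->
  nsq (psi v) + \sum_(c | H (pi v) c && (c != pi u)) branch_mass v (lft v c) psi
  <= branch_mass u v psi.
Proof.
move=> uv; have [f fE] := ell2_restrict psi (branch u v).
have [g gE] := ell2_restrict psi (fun x => branch u v x && (x != v)).
rewrite (branch_massP fE).
have : l2norm g ^+ 2 <= l2norm f ^+ 2 - nsq (psi v).
  apply: l2norm_le => X; rewrite lerBrDr.
  pose Y := (v |` (X `\ v))%fset.
  apply: le_trans (ell2_bounded f Y).
  rewrite [leRHS](big_fsetD1 v) ?fset1U1//= fE branch_head//= [leLHS]addrC lerD2l.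
  apply: (@le_trans _ _ (\sum_(x <- (Y `\ v)%fset) nsq (g x))).
    apply: sum_fset_sub => [x|x xX]; first exact: nsq_ge0.
    rewrite gE; case: ifPn => [/andP[_ xv] _|]; last by rewrite nsq0 eqxx.
    by rewrite !inE xv xX orbT.
  apply: ler_sum => x _; rewrite gE fE; case: (branch u v x) => //=.
  by case: ifP => // _; rewrite nsq0 nsq_ge0.
move=> gf; rewrite addrC -lerBrDr; apply: le_trans gf.
apply: sqsum_super => x; rewrite gE.
have [[c /and3P[vc cu Bx]]|none] :=
  pselect (exists c, [&& H (pi v) c, c != pi u & branch v (lft v c) x]); last first.
  rewrite big1 ?nsq_ge0// => c /andP[vc cu]; case: ifPn => Bx; rewrite ?nsq0//.
  by case: none; exists c; rewrite vc cu.
have vx := lift_adj covT vc.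
have xu : lft v c != u by apply: contra cu => /eqP <-; rewrite (pi_lift covT).
rewrite (branch_sub uv xu Bx) (branch_neq vx Bx) (bigD1 c) ?vc//= Bx.
rewrite big1 ?addr0// => d /andP[/andP[vd du] dc].
case: ifPn => Bx'; rewrite ?nsq0//; have := branch_disjoint Bx' Bx.
by move=> /(congr1 pi); rewrite !(pi_lift covT)// => e; rewrite e eqxx in dc.
Qed.

Definition green_weight a b : R :=
  inf [set t | exists u v (psi : ell2 R VT), [/\ [/\ T u v, pi u = a & pi v = b],
    branch_solution u v psi, psi v = 1 & t = branch_mass u v psi]]%classic.

Lemma branch_normalize u v psi : branch_solution u v psi -> psi v != 0 ->
  exists phi, [/\ branch_solution u v phi, phi v = 1 &
    branch_mass u v phi * nsq (psi v) <= branch_mass u v psi].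
Proof.
move=> sol v0; exists ((psi v)^-1 *: psi); split.
- exact: branch_solutionZ.
- by rewrite ell2ZE mulVf.
have [f fE] := ell2_restrict psi (branch u v).
have [g gE] := ell2_restrict ((psi v)^-1 *: psi) (branch u v).
rewrite (branch_massP fE) (branch_massP gE) -ler_pdivlMr ?nsq_gt0//.
apply: l2norm_le; rewrite mulrC.
have vi : 0 <= (nsq (psi v))^-1 by rewrite invr_ge0 nsq_ge0.
apply: sum_bounded_le (sum_boundedZ vi (ell2_bounded f)) => x.
by rewrite fE gE ell2ZE; case: ifP; rewrite ?nsqM ?nsqV// nsq0 mulr0.
Qed.

Lemma green_weight_le u v psi : T u v -> branch_solution u v psi ->
  psi v != 0 -> nsq (psi v) * green_weight (pi u) (pi v) <= branch_mass u v psi.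
Proof.
move=> uv sol v0; have [phi [solphi phi1 le_phi]] := branch_normalize sol v0.
rewrite mulrC; apply: le_trans le_phi; rewrite ler_wpM2r ?nsq_ge0//.
apply: ge_inf; last by exists u, v, phi.
by exists 0 => _ [u' [v' [psi' [_ _ _ ->]]]]; exact: branch_mass_ge0.
Qed.

Lemma green_weight_ge0 a b : 0 <= green_weight a b.
Proof.
rewrite /green_weight; set S := (X in inf X).
have [S0|S0] := pselect (S !=set0)%classic; last first.
  rewrite (_ : S = set0) ?inf0//; apply/seteqP; split => // t St.
  by apply: S0; exists t.
apply: lb_le_inf => // _ [u [v [psi [_ _ _ ->]]]]; exact: branch_mass_ge0.
Qed.

(* If [r = 0] on the edge [(v, x)] then the equation at [x] determines the value
   behind the only edge with [r = oo] that leaves [x]. *)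
Lemma green_weight_row a b : H a b -> green_ratio a b != Some 0 ->
  1 + decay_row H m green_ratio green_weight a b <= green_weight a b.
Proof.
move=> ab r0; apply: lb_le_inf.
  have [u [v [psi [[uv pu pv] sol nz rE]]]] := green_ratio_lift ab.
  have v0 : psi v != 0.
    apply: contra r0; rewrite rE /gratio => /eqP v0; rewrite v0 mul0r.
    by have [u0|//] := eqVneq (psi u) 0; case: nz.
  have [phi [solphi phi1 _]] := branch_normalize sol v0.
  by exists (branch_mass u v phi), u, v, phi.
have grs := green_ratio_system; have [_ _ rc] := grs.
move=> _ [u [v [psi [[uv pu pv] sol v1 ->]]]].
apply: le_trans (branch_mass_super psi uv).
rewrite v1 nsq1 lerD2l /decay_row pu pv; apply: ler_sum => c /andP[bc ca].
have vc : H (pi v) c by rewrite pv.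
have cu : c != pi u by rewrite pu.
have v0 : psi v != 0 by rewrite v1 oner_eq0.
have := green_ratio_next uv sol vc cu v0; rewrite pv v1 divr1 => rE.
have vx := lift_adj covT vc; set x := lft v c in vx rE *.
have px : pi x = c by exact: (pi_lift covT).
have xu : x != u by apply: contra cu => /eqP <-; rewrite px.
have solx : branch_solution v x psi by exact: branch_solution_sub sol.
(* If [psi x] is nonzero, clause (c) excludes infinite ratios behind [x], and only the first summand
   of the row remains. *)
rewrite rE; have [x0|x0] := eqVneq (psi x) 0; last first.
  rewrite big_pred0 ?addr0 => [|d].
    by rewrite -[in green_weight _ _]px -[in green_weight b _]pv green_weight_le.
  apply/negbTE/negP => /and3P[cd db /eqP rcd].
  by have [+ _] := rc b c d bc cd db rcd; rewrite rE => -[/eqP]; rewrite (negPf x0).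
rewrite x0 nsq0 mul0r add0r.
pose P d := [&& H c d, d != b & green_ratio c d == None].
have [d Pd|none] := pickP P; last by rewrite big_pred0// branch_mass_ge0.
rewrite (big_pred1 d) => [|d']; last first.
  apply/idP/eqP => [/and3P[cd' _ /eqP rd']|->//].
  have /and3P[cd _ /eqP rd] := Pd.
  exact: (ratio_system_None_unique grs cd' cd).
have /and3P[cd db /eqP rcd] := Pd.
have xd : H (pi x) d by rewrite px.
have xy := lift_adj covT xd; set y := lft x d in xy *.
have py : pi y = d by exact: (pi_lift covT).
have yv : y != v by apply: contra db => /eqP yE; rewrite -py yE pv.
have soly : branch_solution x y psi by exact: branch_solution_sub solx.
have := head_equation vx solx; rewrite x0 mulr0 add0r pv px v1 mulr1.
(* As [psi x = 0], any neighbour behind [x] with nonzero value sits on an edge with infinite ratio,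
   and [d] labels the only one. *)
rewrite (bigD1 d) ?cd//= big1 ?addr0 => [|d' /andP[/andP[cd' d'b] d'd]].
  move=> /eqP; rewrite addrC addr_eq0 => /eqP yE.
  have mcd : m c d != 0 by exact: (coef_neq0 covT).
  have {}yE : psi y = - (m c b / m c d).
    by apply: (mulfI mcd); rewrite yE mulrN mulrCA divff// mulr1.
  rewrite -nsqN -yE -[in green_weight _ _]px -[in green_weight _ d]py.
  have y0 : psi y != 0.
    rewrite yE oppr_eq0 mulf_neq0 ?invr_eq0//; apply: (coef_neq0 covT) => //.
    by rewrite adj_sym.
  apply: le_trans (green_weight_le xy soly y0) _.
  apply: le_trans (branch_mass_super psi vx).
  rewrite (bigD1 d) ?xd ?pv//= addrCA lerDl addr_ge0 ?nsq_ge0// sumr_ge0// => *.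
  exact: branch_mass_ge0.
have xd' : H (pi x) d' by rewrite px.
have xy' := lift_adj covT xd'; set y' := lft x d' in xy' *.
have py' : pi y' = d' by exact: (pi_lift covT).
apply/eqP; rewrite mulf_eq0 orbC; apply/orP; left; apply/negPn/negP => y'0.
have y'v : y' != v by apply: contra d'b => /eqP yE; rewrite -py' yE pv.
have soly' : branch_solution x y' psi by exact: branch_solution_sub solx.
have := green_ratioE xy' soly'; rewrite /gratio x0 eqxx px py' => rd'.
case/eqP: d'd; apply: (ratio_system_None_unique grs cd' cd) => //.
by apply: rd' => -[/eqP]; rewrite (negPf y'0).
Qed.

Theorem inverse_ratio_system :
  exists r : dedge H -> option C, ratio_system m r /\ decay_rate m r < 1.
Proof.
exists (edge_fun green_ratio); split.
  exact/ratio_systemP/green_ratio_system.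
apply: (@weights_decay_rate _ _ _ _ _ green_weight) => a b ab r0.
  exact: green_weight_ge0.
exact: green_weight_row.
Qed.

End InverseToRatioSystem.

(** * Contracting weights *)

Section ForestSums.
Context {R : realType} {V : choiceType} (o : V) (par : V -> V) (ch : V -> seq V).
Hypotheses (ch_uniq : forall v, uniq (ch v)).
Hypothesis par_ch : forall v c, c \in ch v -> par c = v.
Implicit Types g k th : V -> R.

Lemma children_uniq (s : seq V) : uniq s -> uniq (flatten (map ch s)).
Proof.
elim: s => //= v s IHs /andP[vs us]; rewrite cat_uniq ch_uniq IHs// andbT.
apply/hasPn => c /flattenP[_ /mapP[w ws ->] cw]; apply: contra vs => /= cv.
by rewrite -(par_ch cv) (par_ch cw).
Qed.

Lemma sum_bounded_children g Y : sum_bounded g Y ->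
  sum_bounded (fun v => \sum_(c <- ch v) g c) Y.
Proof.
move=> gY X; have := sum_bounded_seq gY (children_uniq (fset_uniq X)).
by rewrite big_flatten big_map.
Qed.

(** Every vertex is a child at most once, so the total [s] satisfies [s <= kap * s + S]. The a
    priori bound [Y] makes [s] finite and does not enter the result. *)
Lemma contract_up g k (Y kap S : R) : 0 <= kap < 1 -> sum_bounded g Y ->
  (forall v, g v <= kap * (\sum_(c <- ch v) g c) + k v) ->
  sum_bounded k S -> sum_bounded g (S / (1 - kap)).
Proof.
move=> /andP[kap0 kap1] gY gk kS; have [s gs s_le] := sum_bounded_sup gY.
have : s <= kap * s + S.
  apply: s_le; apply: sum_bounded_le gk _; apply: sum_boundedD => //.
  exact/sum_boundedZ/sum_bounded_children.
move=> sS X; apply: le_trans (gs X) _; rewrite ler_pdivlMr ?subr_gt0//.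
by rewrite mulrBr mulr1 lerBlDr addrC mulrC.
Qed.

Hypothesis ch_par : forall c, c != o -> c \in ch (par c).

Lemma sum_bounded_parent g th (Y kap : R) : (forall v, 0 <= g v) ->
  (forall c, 0 <= th c) -> 0 <= kap ->
  (forall v, \sum_(c <- ch v) th c <= kap) ->
  sum_bounded g Y -> sum_bounded (fun c => if c == o then 0 else th c * g (par c)) (kap * Y).
Proof.
move=> g0 th0 kap0 thk gY X; pose h c : R := if c == o then 0 else th c * g (par c).
have h0 c : 0 <= h c by rewrite /h; case: ifP => // _; rewrite mulr_ge0.
pose P := [fset par c | c in X]%fset.
pose Z := [fset c in flatten (map ch P)]%fset.
apply: (@le_trans _ _ (\sum_(c <- Z) h c)).
  apply: (@sum_fset_sub _ _ h) => // c cX; rewrite /h; case: ifPn => [_|co _].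
    by rewrite eqxx.
  rewrite inE; apply/flattenP; exists (ch (par c)); last exact: ch_par.
  by apply: map_f; apply: in_imfset.
rewrite (perm_big (flatten (map ch P))); last first.
  apply: uniq_perm => [||c]; rewrite ?fset_uniq ?inE//.
  exact/children_uniq/fset_uniq.
rewrite big_flatten big_map; apply: le_trans (sum_boundedZ kap0 gY P).
apply: ler_sum => v _; apply: (@le_trans _ _ (\sum_(c <- ch v) th c * g v)).
  rewrite big_seq [leRHS]big_seq; apply: ler_sum => c cv.
  by rewrite /h (par_ch cv); case: ifP => // _; rewrite mulr_ge0.
by rewrite -mulr_suml ler_wpM2r.
Qed.

(** Dual to [contract_up]: a vertex hands at most the fraction [kap] of its mass to all its children
    together. *)
Lemma contract_down g k th (Y kap S : R) : 0 <= kap < 1 ->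
  (forall v, 0 <= g v) -> (forall c, 0 <= th c) ->
  (forall v, \sum_(c <- ch v) th c <= kap) -> sum_bounded g Y ->
  (forall c, g c <= (if c == o then 0 else th c * g (par c)) + k c) ->
  sum_bounded k S -> sum_bounded g (S / (1 - kap)).
Proof.
move=> /andP[kap0 kap1] g0 th0 thk gY gk kS; have [s gs s_le] := sum_bounded_sup gY.
have : s <= kap * s + S.
  apply: s_le; apply: sum_bounded_le gk _; apply: sum_boundedD => //.
  exact: sum_bounded_parent.
move=> sS X; apply: le_trans (gs X) _; rewrite ler_pdivlMr ?subr_gt0//.
by rewrite mulrBr mulr1 lerBlDr addrC mulrC.
Qed.

End ForestSums.

(** * Weights that contract the transfer in one step *)

Section EnergyWeights.
Context {R : realType} {VH : finType} (H : sgraph VH).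
Local Notation C := R[i].
Variables (m : VH -> VH -> C) (rho : VH -> VH -> option C).
Hypotheses (m_sym : forall a b, H a b -> m a b = m b a).
Hypothesis m_neq0 : forall a b, H a b -> m a b != 0.
Hypothesis prs : pair_ratio_system H m rho.

(* With [F] the defect of a function on an edge (see [defect]), [F] on [(a, b)]
   is [transfer a b c] times [F] on [(b, c)], summed over [c <> a]. *)
Definition transfer a b c : C :=
  if rho a b is Some z then
    if z == 0 then (if rho b c == None then - (m a b / m b c) else 0) else z
  else 1.

(** The last clause serves two purposes. Through Cauchy-Schwarz it contracts the norm
    [sum |F|^2 / aw] towards the root; read directly it contracts [sum aw |x|^2] away from the
    root. *)
Definition energy_weights (aw : VH -> VH -> R) (kap : R) : Prop :=
  [/\ 0 <= kap < 1, forall a b, H a b -> 0 < aw a b &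
      forall a b, H a b ->
        \sum_(c | H b c && (c != a)) nsq (transfer a b c) * aw b c <= kap * aw a b].

Lemma next_finite a b c : H a b -> rho a b != Some 0 -> H b c -> c != a ->
  exists z, rho b c = Some z.
Proof.
have [_ _ rc] := prs => ab r0 bc ca; case rbc: (rho b c) => [z|]; first by exists z.
by have [/eqP] := rc a b c ab bc ca rbc; rewrite (negPf r0).
Qed.

(* The extra factor [1 + eta] on the edges with [r = 0] makes the transfer
   contracting in one step also there, whereas [decay_matrix] skips them. *)
Lemma energy_weights_exist : decay_rate m (@edge_fun _ H _ rho) < 1 ->
  exists aw kap, energy_weights aw kap.
Proof.
move=> /decay_rate_weights[A AP]; have [_ rb _] := prs.
pose K := 1 + \sum_a \sum_b `|A a b|.
have AK a b : A a b <= K.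
  rewrite /K (bigD1 a)//= (bigD1 b)//= !addrA addrAC -addrA.
  apply: (@le_trans _ _ `|A a b|); first exact: ler_norm.
  rewrite -[leLHS]addr0 -addrA addrCA lerD2l !addr_ge0// sumr_ge0// => i _.
  by rewrite sumr_ge0.
have K1 : 1 <= K by rewrite lerDl sumr_ge0// => a _; rewrite sumr_ge0.
have K0 : 0 < K by exact: lt_le_trans K1.
(* [eta * A <= 1/2] gives [A - 1 <= (1 - eta) * A], hence
   [(1 + eta) * (A - 1) <= (1 - eta^2) * A]. *)
pose eta := (2 * K)^-1.
have eta0 : 0 < eta by rewrite invr_gt0 mulr_gt0.
have etaK : eta * K = 2^-1 by rewrite /eta; field; rewrite gt_eqF.
have eta2 : eta <= 2^-1 by rewrite -etaK ler_peMr// ltW.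
have etaA a b : eta * A a b <= 2^-1 by rewrite -etaK ler_wpM2l ?AK// ltW.
(* Behind an edge [(a, b)] with nonzero ratio, the sum of [aw b c] is [decay_row], apart from the
   factor [1 + eta] on edges with [r = 0]. *)
pose aw a b := if rho a b is Some z then
    if z == 0 then (1 + eta) * \sum_(c | [&& H b c, c != a & rho b c == None])
      nsq (m a b / m b c) * A b c else nsq z * A a b
  else A a b.
have A1 a b : H a b -> rho a b != Some 0 -> 1 <= A a b.
  by move=> ab r0; have [] := AP a b ab r0.
have AN a b : H a b -> rho a b = None -> 1 <= A a b.
  by move=> ab rN; apply: A1; rewrite ?rN.
have A_gt0 a b : H a b -> rho a b != Some 0 -> 0 < A a b.
  by move=> ab r0; rewrite (lt_le_trans ltr01)// A1.
have awE a b : H a b -> rho a b != Some 0 ->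
    \sum_(c | H b c && (c != a)) aw b c <= (1 - eta ^+ 2) * A a b.
  move=> ab r0; apply: (@le_trans _ _ ((1 + eta) * (A a b - 1))); last first.
    have := etaA a b; have := ltW eta0; have := A1 _ _ ab r0; nra.
  have [_ ->] := AP a b ab r0; rewrite addrAC subrr add0r /decay_row mulr_sumr.
  apply: ler_sum => c /andP[bc ca]; have [z rz] := next_finite ab r0 bc ca.
  rewrite /aw rz; have [z0|z0] := eqVneq z 0.
    rewrite z0 nsq0 mul0r add0r (m_sym bc).
    by apply: ler_wpM2l => //; rewrite addr_ge0// ltW.
  rewrite [X in _ * (_ + X)]big1 ?addr0 => [|d /and3P[cd db /eqP rd]].
    apply: ler_peMl; last by rewrite lerDl ltW.
    rewrite mulr_ge0 ?nsq_ge0//; apply/ltW/A_gt0; rewrite // rz.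
    by apply: contra z0 => /eqP[->].
  have [_ _ rc] := prs; have [] := rc b c d bc cd db rd.
  by rewrite rz => -[/eqP]; rewrite (negPf z0).
exists aw, (1 - eta ^+ 2); split.
- rewrite subr_ge0 ltrBlDr ltrDl exprn_gt0// andbT exprn_ile1// ?ltW//.
  by rewrite (le_lt_trans eta2)// invf_lt1// ltr1n.
- move=> a b ab; rewrite /aw; case rab: (rho a b) => [z|]; last first.
    by rewrite A_gt0// rab.
  have [z0|z0] := eqVneq z 0; last first.
    by rewrite mulr_gt0 ?nsq_gt0// A_gt0// rab; apply: contra z0 => /eqP[->].
  rewrite z0 in rab; have [c [bc ca rbc]] := rb a b ab rab.
  rewrite mulr_gt0 ?addr_gt0// (bigD1 c) ?bc ?ca ?rbc//= ltr_pwDl//.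
    rewrite mulr_gt0 ?nsq_gt0 ?mulf_neq0 ?invr_eq0 ?m_neq0//.
    by rewrite A_gt0// rbc.
  apply: sumr_ge0 => d /andP[/and3P[bd _ /eqP rd] _].
  by rewrite mulr_ge0 ?nsq_ge0// ltW// A_gt0// rd.
move=> a b ab; case rab: (rho a b) => [z|]; last first.
  rewrite [X in _ <= _ * X]/aw rab.
  under eq_bigr do rewrite /transfer rab nsq1 mul1r.
  by rewrite awE// rab.
have [z0|z0] := eqVneq z 0; last first.
  rewrite [X in _ <= _ * X]/aw rab (negPf z0).
  under eq_bigr do rewrite /transfer rab (negPf z0).
  rewrite -mulr_sumr mulrCA ler_wpM2l ?nsq_ge0// awE// rab.
  by apply: contra z0 => /eqP[->].
rewrite [X in _ <= _ * X]/aw rab z0 eqxx mulrA.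
set S := (X in _ <= _ * X).
have S0 : 0 <= S.
  apply: sumr_ge0 => d /and3P[bd _ /eqP rd].
  by rewrite mulr_ge0 ?nsq_ge0// ltW// A_gt0// rd.
(* [(1 - eta^2) * (1 + eta) >= 1] because [eta <= 1/2]. *)
apply: (@le_trans _ _ S); last by rewrite ler_peMl//; have := ltW eta0; nra.
rewrite /S [leRHS](eq_bigl (fun c => (H b c && (c != a)) && (rho b c == None))); last first.
  by move=> c; rewrite /= andbA.
rewrite [leRHS]big_mkcondr; apply: ler_sum => c _.
rewrite /transfer rab z0 eqxx /aw; case: (rho b c) => [w|] /=.
  by rewrite nsq0 mul0r.
by rewrite nsqN.
Qed.

(** * Nonvanishing of the pivot *)

Section NonTree.
Variables (aw : VH -> VH -> R) (kap : R).
Hypothesis awP : energy_weights aw kap.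
Hypotheses (conH : connected_graph H) (nontree : ~ is_tree H).

(** If the ratios at the root are finite and the defects vanish, [M f] at the root is the pivot
    times [f]; the pivot is then the reciprocal of the diagonal Green function. *)
Definition root_pivot b : C := m b b + \sum_(c | H b c) m b c * odflt 0 (rho b c).

Let good b := (forall c, H b c -> rho b c != None) /\ root_pivot b = 0.

(** Comparing clause (a) for [(a, b)] with [root_pivot b = 0] leaves [r_ba = 1 / r_ab]; then clause
    (a) for [(b, a)] says [root_pivot a = 0]. *)
Let good_edge a b : H a b -> good b ->
  good a /\ exists z, [/\ z != 0, rho a b = Some z & rho b a = Some z^-1].
Proof.
have [ra rb rc] := prs => ab [finb Db]; have ba : H b a by rewrite adj_sym.
have rab : rho a b != Some 0.
  by apply/eqP => /(rb _ _ ab)[c [bc _ rbc]]; have := finb c bc; rewrite rbc.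
case rba: (rho b a) (finb a ba) => [z'|//] _.
have /esym := ra a b ab rab; move: Db.
rewrite /root_pivot (bigD1 a)//= rba /= addrCA => Db Da.
have {Db Da} : divoo (m b a) (rho a b) = m b a * z'.
  apply: (addIr (m b b + \sum_(c | H b c && (c != a)) m b c * odflt 0 (rho b c))).
  by rewrite [RHS]Db -[RHS]Da; ring.
(* If [r_ab] were infinite, [r_ba] would be 0, and clause (b) would give a second infinite ratio at
   [a]. *)
case ab_eq: (rho a b) rab => [z|] rab /=; last first.
  move=> /esym/eqP; rewrite mulf_eq0 (negPf (m_neq0 ba)) /= => /eqP z'0.
  rewrite z'0 in rba; have [c [ac cb rac]] := rb b a ba rba.
  by case/eqP: cb; exact: (ratio_system_None_unique prs ac ab rac ab_eq).
have z0 : z != 0 by apply: contra rab => /eqP ->.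
move=> /(mulfI (m_neq0 ba)) zz'; rewrite -zz' in rba; split; last by exists z; rewrite zz'.
have rba0 : rho b a != Some 0.
  by rewrite rba; apply/eqP => -[/eqP]; rewrite invr_eq0 (negPf z0).
split.
  move=> c ac; have [->|cb] := eqVneq c b; first by rewrite ab_eq.
  by have [w ->] := next_finite ba rba0 ac cb.
rewrite /root_pivot (bigD1 b)//= ab_eq /= [RHS](ra b a ba rba0) rba /divoo invrK.
by rewrite addrA.
Qed.

(* Otherwise [r] is finite with [r_e r_(e^-1) = 1] everywhere, and
   [aw (e^-1) |r_e|^2 / aw e] increases strictly along a cycle of [H]. *)
Lemma root_pivot_neq0 b : (forall c, H b c -> rho b c != None) -> root_pivot b != 0.
Proof.
move=> finb; apply/eqP => Db.
have gd a : good a.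
  have [_ /(_ b a)[p [pp <- _]]] := conH.
  elim: p b pp {finb Db} (conj finb Db : good b) => [//|c p IHp] x /= /andP[xc pp] gx.
  by apply: IHp => //; apply: (good_edge _ gx).1; rewrite adj_sym.
have [kap01 aw0 awk] := awP; have [kap0 kap1] := andP kap01.
pose Q a b := aw b a * nsq (odflt 0 (rho a b)) / aw a b.
have step a c d : H a c -> H c d -> d != a ->
    nsq (odflt 0 (rho a c)) * aw c d < aw a c.
  move=> ac cd da; have [_ [z [z0 rz _]]] := good_edge ac (gd c).
  have t x : transfer a c x = z by rewrite /transfer rz (negPf z0).
  apply: (@le_lt_trans _ _ (kap * aw a c)); last first.
    by rewrite -subr_gt0 -{1}[aw a c]mul1r -mulrBl mulr_gt0 ?subr_gt0// aw0.
  apply: le_trans (awk a c ac); rewrite (bigD1 d) ?cd//= t rz /= lerDl.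
  by apply: sumr_ge0 => x /andP[/andP[cx _] _]; rewrite mulr_ge0 ?nsq_ge0// ltW// aw0.
(* Combine [|r_ac|^2 aw_cd < aw_ac] with its analogue along the reversed edges,
   [|r_dc|^2 aw_ca < aw_dc], where [r_dc = 1 / r_cd]. *)
have Qlt a c d : H a c -> H c d -> d != a -> Q a c < Q c d.
  move=> ac cd da; have ca : H c a by rewrite adj_sym.
  have dc : H d c by rewrite adj_sym.
  have s1 := step a c d ac cd da; rewrite eq_sym in da.
  have s2 := step d c a dc ca da.
  have [_ [z [z0 rcd rdc]]] := good_edge cd (gd d).
  rewrite rdc /= nsqV mulrC ltr_pdivrMr ?nsq_gt0// in s2.
  apply: (@lt_trans _ _ (aw c a / aw c d)).
    rewrite /Q ltr_pdivrMr ?aw0// mulrAC ltr_pdivlMr ?aw0//.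
    by rewrite -mulrA ltr_pM2l ?aw0.
  by rewrite /Q rcd /= ltr_pM2r ?invr_gt0 ?aw0.
apply: nontree; split => // cyc size_cyc; apply/negP => /andP[cycP cycU].
have [x0 x0c] : exists x0, x0 \in cyc by case: (cyc) size_cyc => // x s; exists x; rewrite mem_head.
have [x xc xmax] := arg_maxP (fun x => Q x (next cyc x)) x0c.
have nxc : next cyc x \in cyc by rewrite mem_next.
have := xmax _ nxc; apply/negP; rewrite -ltNge.
apply: Qlt; rewrite ?next_cycle ?mem_next//.
(* A cycle with at least three vertices does not turn back: the second successor of [x] is not
   [x]. *)
have [i s rotE] := rot_to xc.
have [sr ur] : size (x :: s) = size cyc /\ uniq (x :: s).
  by rewrite -rotE size_rot rot_uniq.
rewrite -!(next_rot i cycU) rotE; move: sr ur.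
case: s {rotE} => [|y [|z s]] sr ur; rewrite -sr// in size_cyc.
move: ur => /= /and3P[]; rewrite !inE !negb_or => /and3P[xy xz _] /andP[yz _] _.
rewrite eqxx [y == x]eq_sym (negPf xy) eqxx.
by rewrite eq_sym.
Qed.

End NonTree.
End EnergyWeights.

(** * Energy estimates on a rooted tree *)

(** The constants in the estimates depend only on labels in [H], of which there are finitely
    many. *)
Lemma uniform_bound {R : realType} (I : finType) (P : I -> R -> Prop) :
  (forall i K K', K <= K' -> P i K -> P i K') -> (forall i, exists K, P i K) ->
  exists2 K, 0 <= K & forall i, P i K.
Proof.
move=> Pmono /choice[K KP]; exists (\sum_i `|K i|); first exact: sumr_ge0.
move=> i; apply: Pmono (KP i); apply: le_trans (ler_norm _) _.
by rewrite (bigD1 i)//= lerDl sumr_ge0.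
Qed.

Section Energy.
Context {R : realType} {VH : finType} (H : sgraph VH).
Context {VT : choiceType} (T : sgraph VT) (pi : VT -> VH).
Context (M : {linear ell2 R VT -> ell2 R VT}).
Local Notation C := R[i].
Hypothesis covT : universal_cover T H pi.
Local Notation m := (coef T pi M).
Local Notation lft := (lift T pi).
Local Notation L := (local_sum H T pi M).
Hypotheses (m_sym : forall a b, H a b -> m a b = m b a).
Hypothesis m_neq0 : forall a b, H a b -> m a b != 0.
Variable rho : VH -> VH -> option C.
Hypothesis prs : pair_ratio_system H m rho.
Variables (aw : VH -> VH -> R) (kap : R).
Hypothesis awP : energy_weights H m rho aw kap.
Implicit Types f : VT -> C.

Local Notation T_tree := (cover_tree covT).
Local Notation branch := (branch T_tree).

Definition defect f u v : C :=
  if rho (pi u) (pi v) is Some z then m (pi u) (pi v) * (z * f u - f v)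
  else m (pi u) (pi v) * f u.

(** The coordinate complementary to [defect]: together they determine [f u] and [f v], also for
    [r = oo], where the defect only sees [f u]. *)
Definition amplitude f u v : C := if rho (pi u) (pi v) is Some _ then f u else f v.

Lemma defect_lift f v c z : H (pi v) c -> rho (pi v) c = Some z ->
  defect f v (lft v c) = m (pi v) c * (z * f v - f (lft v c)).
Proof. by move=> vc rz; rewrite /defect (pi_lift covT)// rz. Qed.

Lemma defect_lift_None f v c : H (pi v) c -> rho (pi v) c = None ->
  defect f v (lft v c) = m (pi v) c * f v.
Proof. by move=> vc rz; rewrite /defect (pi_lift covT)// rz. Qed.

Lemma local_sum_edge f u v : T u v ->
  L f v = m (pi v) (pi v) * f v + m (pi v) (pi u) * f u +
    \sum_(c | H (pi v) c && (c != pi u)) m (pi v) c * f (lft v c).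
Proof.
move=> uv; have vu : T v u by rewrite adj_sym.
rewrite -addrA /local_sum; congr (_ + _); rewrite (bigD1 (pi u))/=; last first.
  exact: (cover_adj covT).
by rewrite (lift_pi covT vu).
Qed.

Lemma defect_sum f v (P : pred VH) : (forall c, P c -> H (pi v) c) ->
  (forall c, P c -> rho (pi v) c != None) ->
  \sum_(c | P c) m (pi v) c * f (lft v c) =
  (\sum_(c | P c) m (pi v) c * odflt 0 (rho (pi v) c)) * f v -
  \sum_(c | P c) defect f v (lft v c).
Proof.
move=> PH PN; rewrite mulr_suml -sumrB; apply: eq_bigr => c Pc.
have := PN c Pc; case rc: (rho _ _) => [z|//] _.
by rewrite (defect_lift _ (PH c Pc) rc) /=; ring.
Qed.

(** For a nonzero ratio, multiply the equation at [v] by it (by 1 if it is [oo]) and eliminate with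
    clause (a). If [r = 0], the defect is [- m f v], and [f v] is read off from the defect on the
    infinite edge behind [v]. *)
Lemma defect_transfer f u v : T u v ->
  defect f u v = odflt 1 (rho (pi u) (pi v)) * L f v +
    \sum_(c | H (pi v) c && (c != pi u))
      transfer m rho (pi u) (pi v) c * defect f v (lft v c).
Proof.
move=> uv; have ab := cover_adj covT uv; have [ra rb rc] := prs.
have mab := m_sym ab.
have [r0|r0] := eqVneq (rho (pi u) (pi v)) (Some 0).
  have [c [bc ca rbc]] := rb _ _ ab r0.
  rewrite r0 mul0r add0r (bigD1 c) ?bc//= big1 => [|d /andP[/andP[bd da] dc]].
    rewrite addr0 /transfer r0 eqxx rbc eqxx (defect_lift_None _ bc rbc).
    rewrite /defect r0; field; exact: m_neq0.
  rewrite /transfer r0 eqxx; case: ifP; rewrite ?mul0r// => /eqP rd.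
  by rewrite (ratio_system_None_unique prs bd bc rd rbc) eqxx in dc.
have finc c : H (pi v) c && (c != pi u) -> rho (pi v) c != None.
  by move=> /andP[bc ca]; have [z ->] := next_finite prs ab r0 bc ca.
have tE c : transfer m rho (pi u) (pi v) c = odflt 1 (rho (pi u) (pi v)).
  move: r0; rewrite /transfer; case: (rho _ _) => [z|]//=.
  by have [->|] := eqVneq z 0; rewrite ?eqxx.
under eq_bigr do rewrite tE.
rewrite -mulr_sumr (local_sum_edge _ uv) defect_sum//; last by move=> c /andP[].
pose S := \sum_(c | H (pi v) c && (c != pi u)) m (pi v) c * odflt 0 (rho (pi v) c).
rewrite -/S; have := ra _ _ ab r0; rewrite -/S => eS.
have {eS} : m (pi v) (pi v) = - divoo (m (pi v) (pi u)) (rho (pi u) (pi v)) - S.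
  apply: (addIr (divoo (m (pi v) (pi u)) (rho (pi u) (pi v)) + S)).
  by rewrite -opprD addNr [LHS]addrA [RHS]eS.
move=> ->; rewrite /defect -mab; case: (rho _ _) r0 => [z|] /= r0; last by ring.
by field; apply: contra r0 => /eqP ->.
Qed.

Lemma defect_Some f u v z : T u v -> rho (pi u) (pi v) = Some z ->
  f v = z * f u - defect f u v / m (pi u) (pi v).
Proof.
move=> uv rz; rewrite /defect rz; field.
exact/m_neq0/(cover_adj covT).
Qed.

Lemma defect_sum_None f v (P : pred VH) c : (forall c, P c -> H (pi v) c) ->
  P c -> rho (pi v) c = None ->
  \sum_(d | P d) m (pi v) d * f (lft v d) = m (pi v) c * f (lft v c) +
  (\sum_(d | P d && (d != c)) m (pi v) d * odflt 0 (rho (pi v) d)) * f v -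
  \sum_(d | P d && (d != c)) defect f v (lft v d).
Proof.
move=> PH Pc rc; rewrite (bigD1 c)//= -addrA; congr (_ + _); apply: defect_sum.
  by move=> d /andP[/PH].
move=> d /andP[Pd dc]; apply: contra dc => /eqP rd; apply/eqP.
exact: (ratio_system_None_unique prs (PH _ Pd) (PH _ Pc) rd rc).
Qed.

Lemma nsq_sum3 (P : pred VH) (x y : C) (F : VH -> C) :
  nsq (x + y + \sum_(c | P c) F c) <=
  (4 + 2 * #|VH|%:R) * (nsq x + nsq y + \sum_(c | P c) nsq (F c)).
Proof.
apply: le_trans (nsqD _ _) _.
have sF : nsq (\sum_(c | P c) F c) <= #|VH|%:R * \sum_(c | P c) nsq (F c).
  have := nsq_sum (index_enum VH) P (fun=> 1) F.
  under eq_bigr do rewrite mul1r; move=> /le_trans; apply.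
  rewrite ler_wpM2r ?sumr_ge0// => [? _|]; first exact: nsq_ge0.
  under eq_bigr do rewrite nsq1.
  by rewrite sumr_const -[leLHS]/(_%:R) ler_nat max_card.
have sxy := nsqD x y; have x0 := nsq_ge0 x; have y0 := nsq_ge0 y.
have F0 : 0 <= \sum_(c | P c) nsq (F c) by apply: sumr_ge0 => *; exact: nsq_ge0.
move: (nsq (\sum_(c | P c) F c)) (\sum_(c | P c) nsq (F c)) sF F0 => s1 s2 sF F0.
move: (nsq (x + y)) (nsq x) (nsq y) sxy x0 y0 => p1 p2 p3 sxy x0 y0.
have n0 : 0 <= #|VH|%:R :> R by exact: ler0n.
nra.
Qed.

Definition residual f u v : R := nsq (L f v) + nsq (defect f u v) +
  \sum_(c | H (pi v) c && (c != pi u)) nsq (defect f v (lft v c)).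

Definition root_residual f v : R :=
  nsq (L f v) + \sum_(c | H (pi v) c) nsq (defect f v (lft v c)).

Let sum_defect_ge0 (P : pred VH) f v : 0 <= \sum_(c | P c) nsq (defect f v (lft v c)).
Proof. by apply: sumr_ge0 => *; exact: nsq_ge0. Qed.

Let sum_defect_sub (P Q : pred VH) f v : (forall c, Q c -> P c) ->
  \sum_(c | Q c) nsq (defect f v (lft v c)) <= \sum_(c | P c) nsq (defect f v (lft v c)).
Proof.
move=> QP; rewrite [leRHS](bigID Q)/= ler_wpDr//.
rewrite le_eqVlt; apply/orP; left; apply/eqP; apply: eq_bigl => c.
by case Qc: (Q c); rewrite ?andbF// QP.
Qed.

Lemma residual_ge0 f u v : 0 <= residual f u v.
Proof. by rewrite !addr_ge0 ?nsq_ge0. Qed.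

Lemma root_residual_ge0 f v : 0 <= root_residual f v.
Proof. by rewrite addr_ge0 ?nsq_ge0. Qed.

(** Up to the residual, amplitudes obey the transpose of [defect_transfer], with the same
    coefficients. The equation at [v] is needed only if the next ratio is infinite. *)
Lemma amplitude_step : exists2 K, 0 <= K & forall f u v c,
  T u v -> H (pi v) c -> c != pi u ->
  nsq (amplitude f v (lft v c) - transfer m rho (pi u) (pi v) c * amplitude f u v)
  <= K * residual f u v.
Proof.
have [abc K K' KK' KP f u v pu pv uv vc cu|[[a b] c] /=|K K0 KP] :=
    @uniform_bound R (VH * VH * VH)%type (fun abc K => forall f u v,
  pi u = abc.1.1 -> pi v = abc.1.2 -> T u v -> H (pi v) abc.2 -> abc.2 != pi u ->
  nsq (amplitude f v (lft v abc.2) -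
    transfer m rho (pi u) (pi v) abc.2 * amplitude f u v) <= K * residual f u v).
- by apply: le_trans (KP f u v pu pv uv vc cu) _; rewrite ler_wpM2r// residual_ge0.
- have [_ _ rc] := prs.
  case rbc: (rho b c) => [w|]; last first.
    pose S := \sum_(d | (H b d && (d != a)) && (d != c)) m b d * odflt 0 (rho b d).
    exists (nsq (m b c)^-1 * ((4 + 2 * #|VH|%:R) * (1 + nsq ((m b b + S) / m a b)))).
    move=> f u v pu pv uv; rewrite pv pu => bc ca.
    have ab : H a b by rewrite -pu -pv; exact: (cover_adj covT).
    have [rab _] := rc a b c ab bc ca rbc.
    have fv := defect_Some f uv; rewrite pu pv in fv; have {}fv := fv _ rab.
    rewrite mul0r sub0r in fv.
    have := local_sum_edge f uv; rewrite pu pv.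
    have := @defect_sum_None f v (fun d => H b d && (d != a)) c.
    rewrite pv => -> //; last 2 first.
    + by move=> d /andP[].
    + by rewrite bc ca.
    rewrite -/S; set D := \sum_(d | _) defect _ _ _ => hE.
    have mbc := m_neq0 bc; have mab := m_neq0 ab.
    have -> : amplitude f v (lft v c) - transfer m rho a b c * amplitude f u v
        = (m b c)^-1 * (L f v + (m b b + S) / m a b * defect f u v + D).
      rewrite /amplitude /transfer pu pv (pi_lift covT) ?pv// rab rbc /= eqxx.
      rewrite hE fv (m_sym ab); field.
      by rewrite mbc -(m_sym ab) mab.
    rewrite [leLHS]nsqM -[leRHS]mulrA ler_wpM2l ?nsq_ge0//.
    apply: le_trans (nsq_sum3 _ _ _ _) _.
    rewrite -[leRHS]mulrA ler_wpM2l ?addr_ge0 ?mulr_ge0// (nsqM _ (defect _ _ _)) /residual pu pv.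
    have s1 : \sum_(d | (H b d && (d != a)) && (d != c)) nsq (defect f v (lft v d))
        <= \sum_(d | H b d && (d != a)) nsq (defect f v (lft v d)).
      by apply: sum_defect_sub => d /andP[].
    have s0 : 0 <= \sum_(d | H b d && (d != a)) nsq (defect f v (lft v d)) by [].
    move: s1 s0 (nsq_ge0 (L f v)) (nsq_ge0 (defect f u v)) (nsq_ge0 ((m b b + S) / m a b)).
    move: (\sum_(_ | _) _) (\sum_(_ | _) _) (nsq _) (nsq _) (nsq _).
    by move=> x1 x2 x3 x4 x5; nra.
  exists (nsq (m a b)^-1) => f u v pu pv uv; rewrite pu pv => bc ca.
  have ab : H a b by rewrite -pu -pv; exact: (cover_adj covT).
  have mab := m_neq0 ab.
  apply: (@le_trans _ _ (nsq (m a b)^-1 * nsq (defect f u v))); last first.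
    rewrite ler_wpM2l ?nsq_ge0// /residual addrAC lerDr addr_ge0 ?nsq_ge0//.
  rewrite -nsqM /amplitude /transfer (pi_lift covT) ?pv// rbc pu.
  have fv z : rho a b = Some z -> f v = z * f u - defect f u v / m a b.
    by move=> rab; have := defect_Some f uv; rewrite pu pv => /(_ z rab).
  case rab: (rho a b) => [z|]; last first.
    by rewrite mul1r subrr nsq0 nsq_ge0.
  have -> : (if z == 0 then if Some w == None then - (m a b / m b c) else 0 else z) = z.
    by have [->|] := eqVneq z 0.
  rewrite (fv _ rab) addrAC subrr add0r nsqN mulrC.
  exact: lexx.
by exists K => // f u v c uv vc cu; exact: (KP (pi u, pi v, c)).
Qed.

Lemma head_value_le : exists2 K, 0 <= K & forall f u v, T u v ->
  nsq (f v) <= K * (nsq (amplitude f u v) + nsq (defect f u v)).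
Proof.
have [ab K K' KK' KP f u v pu pv uv|[a b] /=|K K0 KP] :=
    @uniform_bound R (VH * VH)%type (fun ab K => forall f u v,
  pi u = ab.1 -> pi v = ab.2 -> T u v ->
  nsq (f v) <= K * (nsq (amplitude f u v) + nsq (defect f u v))).
- apply: le_trans (KP f u v pu pv uv) _; rewrite ler_wpM2r//.
  by rewrite addr_ge0 ?nsq_ge0.
- case rab: (rho a b) => [z|]; last first.
    exists 1 => f u v pu pv uv; rewrite mul1r /amplitude pu pv rab lerDl.
    exact: nsq_ge0.
  exists (2 * nsq z + 2 * nsq (m a b)^-1) => f u v pu pv uv.
  have fv := defect_Some f uv; rewrite pu pv in fv.
  rewrite (fv _ rab) /amplitude pu pv rab.
  apply: le_trans (nsqD _ _) _; rewrite nsqN !nsqM.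
  move: (nsq_ge0 z) (nsq_ge0 (f u)) (nsq_ge0 (m a b)^-1) (nsq_ge0 (defect f u v)).
  by move: (nsq z) (nsq (f u)) (nsq _^-1) (nsq _) => x1 x2 x3 x4; nra.
by exists K => // f u v uv; exact: (KP (pi u, pi v)).
Qed.

Hypothesis pivot_neq0 : forall b, (forall c, H b c -> rho b c != None) ->
  root_pivot H m rho b != 0.

(** No amplitude comes in at the root. Its value is found from the pivot if all ratios are finite;
    otherwise the defect on the infinite edge is [m f v], and the equation gives the value across
    that edge. *)
Lemma root_step : exists2 K, 0 <= K & forall f v,
  nsq (f v) <= K * root_residual f v /\
  forall c, H (pi v) c -> nsq (amplitude f v (lft v c)) <= K * root_residual f v.
Proof.
have [b K K' KK' KP f v pv|b /=|K K0 KP] := @uniform_bound R VH (fun b K => forall f v,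
  pi v = b -> nsq (f v) <= K * root_residual f v /\
  forall c, H b c -> nsq (amplitude f v (lft v c)) <= K * root_residual f v).
- have KQ : K * root_residual f v <= K' * root_residual f v.
    by rewrite ler_wpM2r// root_residual_ge0.
  have [h1 h2] := KP f v pv; split; first exact: le_trans h1 KQ.
  by move=> c /h2 /le_trans; apply.
- have [[c0 bc0 rc0]|allfin] := pselect (exists2 c, H b c & rho b c = None); last first.
    have fin c : H b c -> rho b c != None.
      by move=> bc; apply/eqP => rc; apply: allfin; exists c.
    have D0 := pivot_neq0 fin; set D := root_pivot _ _ _ _ in D0.
    exists (nsq D^-1 * ((4 + 2 * #|VH|%:R) * 1)) => f v pv.
    have fvE : f v = D^-1 * (L f v + 0 + \sum_(c | H b c) defect f v (lft v c)).
      have := @defect_sum f v (fun c => H b c); rewrite pv => dE.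
      rewrite addr0 /local_sum pv dE//; set S := \sum_(c | _) defect _ _ _.
      have -> : m b b * f v + ((\sum_(c | H b c) m b c * odflt 0 (rho b c)) * f v - S) + S
        = D * f v by rewrite /D /root_pivot; ring.
      by rewrite mulrA mulVf// mul1r.
    have fv : nsq (f v) <= nsq D^-1 * ((4 + 2 * #|VH|%:R) * 1) * root_residual f v.
      rewrite [in leLHS]fvE [leLHS]nsqM -[leRHS]mulrA ler_wpM2l ?nsq_ge0//.
      apply: le_trans (nsq_sum3 _ _ _ _) _; rewrite mulr1 nsq0 addr0.
      by rewrite /root_residual pv.
    split=> // c bc; rewrite /amplitude (pi_lift covT) ?pv//.
    by case: (rho b c) (fin c bc).
  pose S := \sum_(d | H b d && (d != c0)) m b d * odflt 0 (rho b d).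
  have mbc := m_neq0 bc0.
  pose K1 := nsq (m b c0)^-1.
  pose K2 := K1 * ((4 + 2 * #|VH|%:R) * (1 + nsq ((m b b + S) / m b c0))).
  have K10 : 0 <= K1 by exact: nsq_ge0.
  have K20 : 0 <= K2.
    apply: mulr_ge0 => //; apply: mulr_ge0; last by rewrite addr_ge0 ?nsq_ge0.
    by rewrite addr_ge0 ?mulr_ge0.
  exists (K1 + K2) => f v pv; have Q0 := root_residual_ge0 f v.
  have dE : defect f v (lft v c0) = m b c0 * f v.
    by rewrite defect_lift_None pv.
  have fvE : f v = (m b c0)^-1 * defect f v (lft v c0).
    by rewrite dE mulrA mulVf// mul1r.
  have fv : nsq (f v) <= (K1 + K2) * root_residual f v.
    rewrite mulrDl; apply: ler_wpDr; first exact: mulr_ge0 K20 Q0.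
    rewrite [in leLHS]fvE [leLHS]nsqM ler_wpM2l//.
    rewrite /root_residual pv (bigD1 c0)//= addrCA lerDl addr_ge0 ?nsq_ge0//.
  split=> // c bc; rewrite /amplitude (pi_lift covT) ?pv//.
  case rbc: (rho b c) => [//|]; rewrite (ratio_system_None_unique prs bc bc0 rbc rc0).
  have := @defect_sum_None f v (fun d => H b d) c0; rewrite pv => sE.
  have hE : L f v = m b b * f v + (m b c0 * f (lft v c0) + S * f v -
      \sum_(d | H b d && (d != c0)) defect f v (lft v d)).
    by rewrite /local_sum pv sE.
  move: hE; set D := \sum_(d | _) defect _ _ _ => hE.
  have -> : f (lft v c0) = (m b c0)^-1 *
      (L f v + - ((m b b + S) / m b c0) * defect f v (lft v c0) + D).
    by rewrite hE dE; field.
  rewrite [leRHS]mulrDl; apply: ler_wpDl; first exact: mulr_ge0 K10 Q0.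
  rewrite [leLHS]nsqM -[leRHS]mulrA ler_wpM2l//.
  apply: le_trans (nsq_sum3 _ _ _ _) _.
  rewrite -[leRHS]mulrA ler_wpM2l ?addr_ge0 ?mulr_ge0// (nsqM _ (defect _ _ _)) nsqN /root_residual pv.
  rewrite [in leRHS](bigD1 c0)//=.
  have s0 : 0 <= \sum_(d | H b d && (d != c0)) nsq (defect f v (lft v d)) by [].
  move: s0 (nsq_ge0 (L f v)) (nsq_ge0 (defect f v (lft v c0)))
    (nsq_ge0 ((m b b + S) / m b c0)).
  move: (\sum_(_ | _) _) (nsq _) (nsq _) (nsq _).
  by move=> x1 x2 x3 x4; nra.
exists K => // f v; have [h1 h2] := KP (pi v) f v erefl; split => //.
Qed.

(** * Summation over the rooted tree *)

Section Rooted.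
Variable o : VT.

Definition parent c : VT := head o (geodesic T_tree c o).

Lemma parentP c : c != o -> T c (parent c) /\ branch c (parent c) o.
Proof.
move=> /(branch_exists T_tree)[v cv cvo]; suff -> : parent c = v by [].
by rewrite /parent (branch_geodesic cvo).
Qed.

Lemma parentE c v : branch c v o -> parent c = v.
Proof. by move=> cvo; rewrite /parent (branch_geodesic cvo). Qed.

Lemma parent_adj c : c != o -> T (parent c) c.
Proof. by move=> /parentP[]; rewrite adj_sym. Qed.

Lemma child_branch v c : T v c -> (v == o) || (c != parent v) -> branch c v o.
Proof.
move=> vc vo; rewrite branch_compl//.
apply/negP => vco; have [vE|vn] := eqVneq v o.
  by rewrite -vE branch_tail in vco.
by move: vo; rewrite (negPf vn) (parentE vco) eqxx.
Qed.

Definition child_label v : pred VH :=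
  fun b => H (pi v) b && ((v == o) || (b != pi (parent v))).

Definition children v : seq VT := [seq lft v b | b <- enum (child_label v)].

Lemma sum_children (g : VT -> R) v :
  \sum_(c <- children v) g c = \sum_(b | child_label v b) g (lft v b).
Proof. by rewrite big_map big_enum_cond; apply: eq_bigl => b; rewrite andbT. Qed.

Lemma child_label_neq v b : v != o ->
  child_label v b = H (pi v) b && (b != pi (parent v)).
Proof. by move=> /negPf vo; rewrite /child_label vo. Qed.

Lemma child_label_branch v b : child_label v b ->
  [/\ T v (lft v b), branch (lft v b) v o & lft v b != o].
Proof.
move=> /andP[vb vo]; have vc := lift_adj covT vb.
have cvo : branch (lft v b) v o.
  apply: child_branch => //; case/orP: vo => [->//|bp]; apply/orP; right.
  by apply: contra bp => /eqP <-; rewrite (pi_lift covT).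
split=> //; rewrite eq_sym; apply: branch_neq cvo.
by rewrite adj_sym.
Qed.

Lemma parent_lift v b : child_label v b -> parent (lft v b) = v.
Proof. by move=> /child_label_branch[_ bo _]; exact: parentE. Qed.

Lemma children_uniq1 v : uniq (children v).
Proof.
rewrite map_inj_in_uniq ?enum_uniq// => b c; rewrite !mem_enum.
move=> /andP[vb _] /andP[vc _] /(congr1 pi).
by rewrite !(pi_lift covT).
Qed.

Lemma parent_children v c : c \in children v -> parent c = v.
Proof. by move=> /mapP[b]; rewrite mem_enum => vb ->; exact: parent_lift. Qed.

Lemma children_parent c : c != o -> c \in children (parent c).
Proof.
move=> co; have pc := parent_adj co; have [_ bc] := parentP co.
apply/mapP; exists (pi c); last by rewrite (lift_pi covT).
rewrite mem_enum; apply/andP; split; first exact: (cover_adj covT).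
have [//|po] := eqVneq (parent c) o; apply/negP => /eqP e.
have [pp bp] := parentP po.
have := congr1 (lft (parent c)) e; rewrite !(lift_pi covT)// => e'.
by move: bp; rewrite -e' branch_compl ?bc// adj_sym.
Qed.

(** An edge pointing away from the root is represented by its head, so functions of such edges
    become functions of vertices that are 0 at [o]. *)
Definition off_root (g : VT -> R) v : R := if v == o then 0 else g v.

Lemma sum_bounded_off_parent (g : VT -> R) Y : (forall v, 0 <= g v) ->
  sum_bounded g Y -> sum_bounded (off_root (fun v => g (parent v))) (#|VH|%:R * Y).
Proof.
move=> g0 gY; have deg v : \sum_(c <- children v) (1 : R) <= #|VH|%:R.
  by rewrite sum_children sumr_const -[leLHS]/(_%:R) ler_nat max_card.
apply: sum_bounded_le (sum_bounded_parent children_uniq1 parent_children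
  children_parent g0 (fun=> ler01) (ler0n _ _) deg gY) => v.
by rewrite /off_root mul1r.
Qed.

Lemma nsq_defect_le : exists2 K, 0 <= K & forall f u v,
  nsq (defect f u v) <= K * (nsq (f u) + nsq (f v)).
Proof.
have [ab K K'|[a b]|K K0 KP] := @uniform_bound R (VH * VH)%type (fun ab K =>
    forall x y, nsq (if rho ab.1 ab.2 is Some z then m ab.1 ab.2 * (z * x - y)
      else m ab.1 ab.2 * x) <= K * (nsq x + nsq y)).
- move=> KK' KP x y; apply: le_trans (KP x y) _.
  by rewrite ler_wpM2r// addr_ge0 ?nsq_ge0.
- rewrite /=; case: (rho a b) => [z|]; last first.
    by exists (nsq (m a b)) => x y; rewrite nsqM ler_wpM2l ?nsq_ge0// lerDl nsq_ge0.
  exists (nsq (m a b) * (2 * nsq z + 2)) => x y; rewrite nsqM -mulrA.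
  rewrite ler_wpM2l ?nsq_ge0//; have := nsqD (z * x) (- y); rewrite nsqM nsqN.
  by have := nsq_ge0 x; have := nsq_ge0 y; have := nsq_ge0 z; nra.
by exists K => // f u v; exact: (KP (pi u, pi v)).
Qed.

Lemma defect_bound : exists2 C, 0 <= C & forall f Y S,
  sum_bounded (fun v => nsq (f v)) Y ->
  sum_bounded (off_root (fun v => nsq (L f v))) S ->
  sum_bounded (off_root (fun v => nsq (defect f (parent v) v))) (C * S).
Proof.
have [kap01 aw0 awk] := awP; have /andP[kap0 kap1] := kap01.
have [ab K K' KK' /= KP h|[a b]|K K0 KP] := @uniform_bound R (VH * VH)%type
  (fun ab K => H ab.1 ab.2 -> [/\ aw ab.1 ab.2 <= K, (aw ab.1 ab.2)^-1 <= K &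
    nsq (odflt 1 (rho ab.1 ab.2)) / aw ab.1 ab.2 <= K]).
- by have [a1 a2 a3] := KP h; split; exact: le_trans KK'.
- exists (`|aw a b| + `|(aw a b)^-1| + `|nsq (odflt 1 (rho a b)) / aw a b|) => /= _.
  by split; rewrite -?addrA; [apply: le_trans (ler_norm _) _; rewrite lerDl addr_ge0
    | apply: le_trans (ler_norm _) _; rewrite addrCA lerDl addr_ge0
    | apply: le_trans (ler_norm _) _; rewrite addrA lerDr addr_ge0].
(* This choice gives [kap2 - (1 + eps) * kap = (1 - kap)^2 / 2 >= 0]. *)
pose eps := (1 - kap) / 2; have eps0 : 0 < eps by rewrite divr_gt0 ?subr_gt0.
pose kap2 := (1 + kap) / 2.
have kap2P : 0 <= kap2 < 1 by rewrite /kap2; apply/andP; split; lra.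
have kapE : (1 + eps) * kap <= kap2 by rewrite /eps /kap2; nra.
have ei : 0 <= eps^-1 by rewrite invr_ge0 ltW.
exists (K * ((1 + eps^-1) * K / (1 - kap2))).
  rewrite !mulr_ge0 ?addr_ge0// invr_ge0 subr_ge0 ltW//.
  by case/andP: kap2P.
move=> f Y S fY hS.
pose w v := aw (pi (parent v)) (pi v).
pose W := off_root (fun v => nsq (defect f (parent v) v) / w v).
have par_edge v : v != o -> H (pi (parent v)) (pi v).
  by move=> vo; apply: (cover_adj covT); exact: parent_adj.
(* Some finite bound suffices; it does not reach the final constant. *)
have WY : exists Y0, sum_bounded W Y0.
  have [K1 K10 K1P] := nsq_defect_le.
  have := sum_boundedD (sum_bounded_off_parent (fun v => nsq_ge0 (f v)) fY) fY.
  move=> /(sum_boundedZ (mulr_ge0 K10 K0)) bY; eexists; apply: sum_bounded_le bY => v.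
  rewrite /W /off_root; case: ifPn => [_|vo].
    by rewrite !mulr_ge0// addr_ge0// nsq_ge0.
  have [_ wK _] := KP (pi (parent v), pi v) (par_edge v vo).
  rewrite [leRHS]mulrAC; apply: ler_pM => //; first exact: nsq_ge0.
  by rewrite invr_ge0 ltW// aw0// par_edge.
case: WY => Y0 WY.
have step v : W v <= kap2 * (\sum_(c <- children v) W c)
    + off_root (fun v => (1 + eps^-1) * K * nsq (L f v)) v.
  have W0 x : 0 <= W x.
    rewrite /W /off_root; case: ifPn => // xo.
    by rewrite mulr_ge0 ?nsq_ge0// invr_ge0 ltW// aw0// par_edge.
  rewrite {1}/W /off_root; case: ifPn => [_|vo].
    by rewrite addr0 mulr_ge0 ?sumr_ge0//; case/andP: kap2P.
  have ab := par_edge v vo; have wv : 0 < w v by exact: aw0.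
  have [_ _ sK] := KP (pi (parent v), pi v) ab.
  rewrite (defect_transfer _ (parent_adj vo)) ler_pdivrMr//.
  rewrite [X in nsq X <= _]addrC.
  apply: le_trans (nsqD_eps _ _ eps0) _.
  rewrite [leRHS]mulrDl; apply: lerD; last first.
    rewrite nsqM; have : nsq (odflt 1 (rho (pi (parent v)) (pi v))) <= K * w v.
      by rewrite -ler_pdivrMr.
    move: (nsq (L f v)) (nsq_ge0 (L f v)) => q q0.
    move: (nsq (odflt _ _)) => p pK.
    have -> : (1 + eps^-1) * K * q * w v = (1 + eps^-1) * (K * w v * q) by ring.
    by rewrite ler_wpM2l ?addr_ge0// ler_wpM2r.
  pose D c := defect f v (lft v c).
  have -> : \sum_(c <- children v) W c =
      \sum_(b | H (pi v) b && (b != pi (parent v))) nsq (D b) / aw (pi v) b.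
    rewrite sum_children; apply: eq_big => [b|b cb]; first exact: child_label_neq.
    have [_ _ bo] := child_label_branch cb.
    rewrite /W /off_root (negPf bo) /w (parent_lift cb) (pi_lift covT)//.
    by case/andP: cb.
  (* With the weights [aw], the first factor of Cauchy-Schwarz is at most [kap * w v], and [w v]
     cancels against the normalization of [W v]. *)
  have := @nsq_wsum _ _ (index_enum VH) (fun b => H (pi v) b && (b != pi (parent v)))
    (fun c => transfer m rho (pi (parent v)) (pi v) c) D (aw (pi v)).
  move=> /(_ (fun b vb => aw0 _ _ (andP vb).1)) D1.
  set X := \sum_(c | _) nsq _ / _ in D1 *.
  have X0 : 0 <= X.
    by apply: sumr_ge0 => b /andP[vb _]; rewrite mulr_ge0 ?nsq_ge0// invr_ge0 ltW// aw0.
  apply: (@le_trans _ _ ((1 + eps) * (kap * w v * X))).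
    apply: ler_wpM2l; first by rewrite addr_ge0// ltW.
    apply: le_trans D1 _.
    by rewrite ler_wpM2r// awk.
  rewrite !mulrA -mulrA -[leRHS]mulrA (mulrC X) ler_wpM2r//.
  by rewrite mulr_ge0// ltW.
have SK : sum_bounded (off_root (fun v => (1 + eps^-1) * K * nsq (L f v)))
    ((1 + eps^-1) * K * S).
  have c0 : 0 <= (1 + eps^-1) * K by rewrite mulr_ge0// addr_ge0.
  apply: sum_bounded_le (sum_boundedZ c0 hS) => v.
  by rewrite /off_root; case: ifP; rewrite ?mulr0.
have := contract_up children_uniq1 parent_children kap2P WY step SK.
move=> /(sum_boundedZ K0); rewrite -mulrA mulrAC -mulrA => WS.
have {WS} : sum_bounded (fun v => K * W v) (K * ((1 + eps^-1) * K / (1 - kap2)) * S).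
  by move=> Z; apply: le_trans (WS Z) _; rewrite le_eqVlt; apply/orP; left; apply/eqP; ring.
apply: sum_bounded_le => v; rewrite /W /off_root; case: ifPn => [_|vo].
  by rewrite mulr0.
have ab := par_edge v vo; have wv : 0 < w v by exact: aw0.
have [wK _ _] := KP (pi (parent v), pi v) ab.
by rewrite mulrA ler_pdivlMr// mulrC ler_wpM2r ?nsq_ge0.
Qed.

Lemma weight_bounds : exists2 K, 0 <= K & forall a b, H a b ->
  [/\ 0 < aw a b, aw a b <= K & (aw a b)^-1 <= K].
Proof.
have [_ aw0 _] := awP.
have [ab K K' KK' /= KP h|[a b]|K K0 KP] := @uniform_bound R (VH * VH)%type
  (fun ab K => H ab.1 ab.2 -> aw ab.1 ab.2 <= K /\ (aw ab.1 ab.2)^-1 <= K).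
- by have [a1 a2] := KP h; split; exact: le_trans KK'.
- exists (`|aw a b| + `|(aw a b)^-1|) => /= _; split.
    by apply: le_trans (ler_norm _) _; rewrite lerDl.
  by apply: le_trans (ler_norm _) _; rewrite lerDr.
exists K => // a b ab; have [h1 h2] := KP (a, b) ab.
by split => //; exact: aw0.
Qed.

Definition total_residual f v : R :=
  if v == o then root_residual f v else residual f (parent v) v.

Lemma total_residualE f v : total_residual f v =
  nsq (L f v) + off_root (fun v => nsq (defect f (parent v) v)) v +
  \sum_(c <- children v) off_root (fun c => nsq (defect f (parent c) c)) c.
Proof.
rewrite sum_children (eq_bigr (fun b => nsq (defect f v (lft v b)))); last first.
  move=> b cb; have [_ _ /negPf bo] := child_label_branch cb.
  by rewrite /off_root bo (parent_lift cb).
rewrite /total_residual /off_root; have [->|vo] := eqVneq v o.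
  rewrite addr0; congr (_ + _); apply: eq_bigl => b.
  by rewrite /child_label eqxx andbT.
by congr (_ + _); apply: eq_bigl => b; rewrite child_label_neq.
Qed.

Lemma total_residual_ge0 f v : 0 <= total_residual f v.
Proof.
by rewrite /total_residual; case: ifP; rewrite ?root_residual_ge0 ?residual_ge0.
Qed.

Lemma coercive_bound : exists2 C, 0 <= C & forall f Y S,
  sum_bounded (fun v => nsq (f v)) Y -> sum_bounded (fun v => nsq (L f v)) S ->
  sum_bounded (fun v => nsq (f v)) (C * S).
Proof.
have [kap01 aw0 awk] := awP; have /andP[kap0 kap1] := kap01.
have [K K0 KP] := weight_bounds.
have [C1 C10 C1P] := defect_bound.
have [C2 C20 C2P] := amplitude_step.
have [C3 C30 C3P] := root_step.
have [C4 C40 C4P] := head_value_le.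
pose eps := (1 - kap) / 2; have eps0 : 0 < eps by rewrite divr_gt0 ?subr_gt0.
pose kap2 := (1 + kap) / 2.
have kap2P : 0 <= kap2 < 1 by rewrite /kap2; apply/andP; split; lra.
have kapE : (1 + eps) * kap <= kap2 by rewrite /eps /kap2; nra.
have ei : 0 <= eps^-1 by rewrite invr_ge0 ltW.
pose n : R := #|VH|%:R; have n0 : 0 <= n by exact: ler0n.
(* The second summand pays for [root_step] at the children of the root, the first for
   [amplitude_step] at all later vertices. *)
pose C5 := K * ((1 + eps^-1) * C2) + K * C3.
have C50 : 0 <= C5 by rewrite addr_ge0 ?mulr_ge0 ?addr_ge0.
have k20 : 0 <= (1 - kap2)^-1 by rewrite invr_ge0 subr_ge0 ltW//; case/andP: kap2P.
exists ((C4 * K) * ((n * C5 * (1 + C1 + C1)) * (1 - kap2)^-1) + C4 * C1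
    + C3 * (1 + C1 + C1)).
  by do ![apply: addr_ge0 => //|apply: mulr_ge0 => //].
move=> f Y S fY hS; have S0 := sum_bounded_ge0 hS.
have dS := C1P f Y S fY.
have {}dS : sum_bounded (off_root (fun v => nsq (defect f (parent v) v))) (C1 * S).
  apply: dS; apply: sum_bounded_le hS => v; rewrite /off_root.
  by case: ifP => // _; exact: nsq_ge0.
have resS : sum_bounded (total_residual f) ((1 + C1 + C1) * S).
  have -> : (1 + C1 + C1) * S = S + C1 * S + C1 * S by ring.
  have := sum_boundedD (sum_boundedD hS dS)
    (sum_bounded_children children_uniq1 parent_children dS).
  by apply: sum_bounded_le => v; rewrite total_residualE.
have par_edge v : v != o -> H (pi (parent v)) (pi v).
  by move=> vo; apply: (cover_adj covT); exact: parent_adj.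
pose w v := aw (pi (parent v)) (pi v).
have w0 v : v != o -> 0 < w v by move=> vo; exact/aw0/par_edge.
pose X v := nsq (amplitude f (parent v) v).
pose G := off_root (fun v => w v * X v).
have G0 v : 0 <= G v.
  rewrite /G /off_root; case: ifPn => // vo.
  by apply: mulr_ge0; [exact/ltW/w0|exact: nsq_ge0].
pose t c := transfer m rho (pi (parent (parent c))) (pi (parent c)) (pi c).
(* Children of the root inherit nothing, since no edge lies above them; their amplitude counts as
   source. *)
pose th c := if (c == o) || (parent c == o) then 0
  else (1 + eps) * (w c * nsq (t c)) / w (parent c).
have th0 c : 0 <= th c.
  rewrite /th; case: ifPn => //; rewrite negb_or => /andP[co pco].
  apply: mulr_ge0; last by rewrite invr_ge0 ltW// w0.
  apply: mulr_ge0; first by rewrite addr_ge0// ltW.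
  by apply: mulr_ge0; [exact/ltW/w0|exact: nsq_ge0].
have thk v : \sum_(c <- children v) th c <= kap2.
  rewrite sum_children; have [vo|vo] := eqVneq v o.
    rewrite big1; first by case/andP: kap2P.
    by move=> b cb; rewrite /th (parent_lift cb) vo eqxx orbT.
  have -> : \sum_(b | child_label v b) th (lft v b) =
      (1 + eps) * (\sum_(c | H (pi v) c && (c != pi (parent v)))
        nsq (transfer m rho (pi (parent v)) (pi v) c) * aw (pi v) c) / w v.
    rewrite mulr_sumr mulr_suml; apply: eq_big => [b|b cb].
      exact: child_label_neq.
    have [_ _ bo] := child_label_branch cb; have /andP[vb _] := cb.
    rewrite /th (parent_lift cb) (negPf bo) (negPf vo) /= /w /t (parent_lift cb).
    by rewrite (pi_lift covT)// [aw _ _ * _]mulrC.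
  rewrite ler_pdivrMr ?w0//; apply: le_trans (ler_wpM2r (ltW (w0 v vo)) kapE).
  rewrite -[leRHS]mulrA; apply: ler_wpM2l; first by rewrite addr_ge0// ltW.
  by apply: awk; exact: par_edge.
have GY : exists Y0, sum_bounded G Y0.
  have := sum_boundedD (sum_bounded_off_parent (fun v => nsq_ge0 (f v)) fY) fY.
  move=> /(sum_boundedZ K0) bY; eexists; apply: sum_bounded_le bY => v.
  rewrite /G /off_root; case: ifPn => [_|vo].
    by apply: mulr_ge0 => //; apply: addr_ge0 => //; exact: nsq_ge0.
  have [_ wK _] := KP _ _ (par_edge v vo).
  apply: ler_pM => //; [exact/ltW/w0|exact: nsq_ge0|].
  rewrite /X /amplitude; case: (rho _ _) => [_|].
    by rewrite lerDl nsq_ge0.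
  by rewrite lerDr nsq_ge0.
case: GY => Y0 GY.
have step c : G c <= (if c == o then 0 else th c * G (parent c))
    + off_root (fun c => C5 * total_residual f (parent c)) c.
  rewrite {1}/G /off_root; case: ifPn => [_|co]; first by rewrite addr0.
  have res0 := total_residual_ge0 f (parent c).
  have pc := parent_adj co; have [_ wK _] := KP _ _ (par_edge c co).
  have wc := ltW (w0 c co).
  have cE : lft (parent c) (pi c) = c by exact: (lift_pi covT).
  have [po|po] := eqVneq (parent c) o.
    rewrite /th (negPf co) po eqxx mul0r add0r -po /C5 mulrDl.
    apply: ler_wpDl; first by rewrite !mulr_ge0// addr_ge0.
    rewrite -mulrA; apply: ler_pM => //; first exact: nsq_ge0.
    have -> : total_residual f (parent c) = root_residual f (parent c).
      by rewrite /total_residual po eqxx.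
    have [_ /(_ (pi c) (par_edge c co))] := C3P f (parent c).
    by rewrite cE.
  have -> : th c * G (parent c) = (1 + eps) * (w c * nsq (t c)) * X (parent c).
    rewrite /th /G /off_root (negPf co) (negPf po) /=; field.
    by rewrite gt_eqF// w0.
  rewrite /C5 [X in _ <= _ + X]mulrDl addrA.
  apply: ler_wpDr; first by rewrite !mulr_ge0.
  have pp := parent_adj po.
  have cp : pi c != pi (parent (parent c)).
    have := children_parent co; move=> /mapP[b]; rewrite mem_enum => cb cE'.
    have -> : pi c = b by rewrite cE' (pi_lift covT)//; case/andP: cb.
    by move: (cb : child_label _ b); rewrite child_label_neq// => /andP[].
  have := C2P f (parent (parent c)) (parent c) (pi c) pp (par_edge c co) cp.
  rewrite cE -/(t c) => D.
  rewrite /X; set x := amplitude f _ c in D *.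
  set y := amplitude f _ (parent c) in D *.
  have xE : nsq x <= (1 + eps) * (nsq (t c) * nsq y) + (1 + eps^-1) * nsq (x - t c * y).
    by rewrite -nsqM -{1}[x](subrK (t c * y)) addrC; exact: nsqD_eps.
  have rE : total_residual f (parent c) = residual f (parent (parent c)) (parent c).
    by rewrite /total_residual (negPf po).
  rewrite -rE in D.
  have e1 : 0 <= 1 + eps^-1 by rewrite addr_ge0.
  have D' := ler_wpM2l e1 D.
  apply: le_trans (ler_wpM2l wc xE) _; rewrite [leLHS]mulrDr; apply: lerD.
    by rewrite le_eqVlt; apply/orP; left; apply/eqP; ring.
  rewrite -[leRHS]mulrA; apply: ler_pM => //.
    by apply: mulr_ge0 => //; exact: nsq_ge0.
  by rewrite -[leRHS]mulrA.
have resp : sum_bounded (off_root (fun c => C5 * total_residual f (parent c)))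
    (n * C5 * (1 + C1 + C1) * S).
  have := sum_bounded_off_parent (fun v => mulr_ge0 C50 (total_residual_ge0 f v))
    (sum_boundedZ C50 resS).
  by rewrite !mulrA.
have GS := contract_down children_uniq1 parent_children children_parent kap2P
  G0 th0 thk GY step resp.
have bnd := sum_boundedD (sum_boundedD
  (sum_boundedZ (mulr_ge0 C40 K0) GS) (sum_boundedZ C40 dS)) (sum_boundedZ C30 resS).
move=> Z; apply: le_trans (_ : _ <= C4 * K * (n * C5 * (1 + C1 + C1) * S / (1 - kap2))
  + C4 * (C1 * S) + C3 * ((1 + C1 + C1) * S)) _; last first.
  by rewrite le_eqVlt; apply/orP; left; apply/eqP; ring.
move: Z; apply: sum_bounded_le bnd => v; rewrite /G /off_root.
have [vo|vo] := eqVneq v o.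
  rewrite !mulr0 !add0r; have [+ _] := C3P f v.
  by rewrite /total_residual vo eqxx.
apply: ler_wpDr; first by rewrite mulr_ge0// total_residual_ge0.
apply: le_trans (C4P f _ _ (parent_adj vo)) _; rewrite [leLHS]mulrDr lerD2r.
rewrite -[leRHS]mulrA; apply: ler_wpM2l => //; rewrite mulrA.
have [_ _ wK] := KP _ _ (par_edge v vo).
apply: ler_peMl; first exact: nsq_ge0.
by rewrite -ler_pdivrMr ?w0// mul1r.
Qed.

Lemma root_source_defect f Y : sum_bounded (fun v => nsq (f v)) Y ->
  (forall v, v != o -> L f v = 0) -> forall v, v != o -> defect f (parent v) v = 0.
Proof.
move=> fY Lf v vo; have [C1 C10 C1P] := defect_bound.
have /(C1P f Y 0 fY) : sum_bounded (off_root (fun v => nsq (L f v))) 0.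
  move=> X; rewrite big1// => x _; rewrite /off_root; case: ifPn => // xo.
  by rewrite Lf// nsq0.
move=> /(@sum_bounded1 _ _ _ _ v); rewrite mulr0 /off_root (negPf vo) => d0.
by apply/eqP; rewrite -nsq_eq0 eq_le d0 nsq_ge0.
Qed.

End Rooted.
End Energy.

(** * Inverting a symmetric operator that is bounded below *)

Section GeometricLimits.
Context {R : realType}.

Lemma real_geometric_limit (a : nat -> R) (s E : R) : 0 <= s < 1 ->
  (forall n, `|a n.+1 - a n| <= E * s ^+ n) ->
  exists l, forall eps, 0 < eps ->
    exists N, forall n, (N <= n)%N -> `|a n - l| <= eps.
Proof.
move=> /andP[s0 s1] aE; pose v := telescope a.
have : cvgn (series v).
  apply: normed_cvg; apply: (@series_le_cvg _ _ (geometric E s)) => [n|n|n|].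
  - exact: normr_ge0.
  - by apply: le_trans (aE n); exact: normr_ge0.
  - exact: aE.
  - by apply: is_cvg_geometric_series; rewrite ger0_norm.
move=> /cvgrPdist_le cv; exists (limn (series v) + a 0%N) => eps /cv [N _ NP].
exists N => n /NP /=; rewrite /v /series /telescope /= telescope_sumr// distrC.
by rewrite -addrA -opprD [a 0%N + _]addrC.
Qed.

(** The bound is on squares, so the increments themselves decay with ratio [sqrt q]. *)
Lemma complex_geometric_limit (u : nat -> R[i]) (q D : R) : 0 <= q < 1 ->
  (forall n, nsq (u n.+1 - u n) <= q ^+ n * D) ->
  exists l, forall eps, 0 < eps ->
    exists N, forall n, (N <= n)%N -> nsq (u n - l) <= eps.
Proof.
move=> /andP[q0 q1] uD; have D0 : 0 <= D.
  by have := uD 0%N; rewrite expr0 mul1r; apply: le_trans; exact: nsq_ge0.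
have s01 : 0 <= Num.sqrt q < 1 by rewrite sqrtr_ge0 -sqrtr1 ltr_sqrt.
have small (x : R) n : x ^+ 2 <= q ^+ n * D -> `|x| <= Num.sqrt D * Num.sqrt q ^+ n.
  move=> xq; rewrite -(@ler_pXn2r _ 2)// ?nnegrE ?mulr_ge0 ?exprn_ge0 ?sqrtr_ge0//.
  by rewrite real_normK ?num_real// exprMn -exprM mulnC exprM !sqr_sqrtr// mulrC.
have re n : `|complex.Re (u n.+1) - complex.Re (u n)| <= Num.sqrt D * Num.sqrt q ^+ n.
  apply: small; apply: le_trans (uD n); rewrite nsqE !raddfB lerDl.
  exact: sqr_ge0.
have im n : `|complex.Im (u n.+1) - complex.Im (u n)| <= Num.sqrt D * Num.sqrt q ^+ n.
  apply: small; apply: le_trans (uD n); rewrite nsqE !raddfB lerDr.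
  exact: sqr_ge0.
have [lr lrP] := real_geometric_limit s01 re.
have [li liP] := real_geometric_limit s01 im.
exists (lr +i* li)%C => eps eps0.
have e0 : 0 < eps / 2 by rewrite divr_gt0.
have r0 : 0 < Num.sqrt (eps / 2) by rewrite sqrtr_gt0.
have sq (x : R) : `|x| <= Num.sqrt (eps / 2) -> x ^+ 2 <= eps / 2.
  move=> xe; rewrite -real_normK ?num_real// -[leRHS]sqr_sqrtr ?(ltW e0)//.
  by rewrite ler_pXn2r// nnegrE ltW.
have [N1 N1P] := lrP _ r0; have [N2 N2P] := liP _ r0.
exists (maxn N1 N2) => n; rewrite geq_max => /andP[n1 n2].
rewrite nsqE !raddfB /= [leRHS](splitr eps).
by apply: lerD; apply: sq; [exact: N1P|exact: N2P].
Qed.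

End GeometricLimits.

(** * The normal equation of a local operator *)

Section Inversion.
Context {R : realType} {VH : finType} (H : sgraph VH).
Context {VT : choiceType} (T : sgraph VT) (pi : VT -> VH).
Context (M : {linear ell2 R VT -> ell2 R VT}).
Local Notation C := R[i].
Local Notation E := (ell2 R VT).
Local Notation lft := (lift T pi).
Hypothesis covT : universal_cover T H pi.
Hypotheses (M_sym : symmetric_op M) (M_loc : local_op T M) (M_pb : pulled_back T pi M).

Definition neighbourhood x : seq VT := x :: [seq lft x b | b <- enum (H (pi x))].

Lemma neighbourhood_sym x y : y \in neighbourhood x -> x \in neighbourhood y.
Proof.
rewrite !inE eq_sym => /predU1P[->|]; first by rewrite eqxx.
move=> /mapP[b]; rewrite mem_enum => xb ->; apply/orP; right.
have yx : T (lft x b) x by rewrite adj_sym (lift_adj covT).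
apply/mapP; exists (pi x); last by rewrite (lift_pi covT).
by rewrite mem_enum; exact: (cover_adj covT).
Qed.

Lemma op_local (f g : E) x : {in neighbourhood x, forall y, f y = g y} -> M f x = M g x.
Proof.
move=> fg; rewrite !(opE covT)// /local_sum fg ?mem_head//; congr (_ + _).
apply: eq_bigr => b xb; rewrite fg// inE; apply/orP; right.
by apply: map_f; rewrite mem_enum.
Qed.

Definition thicken (s : seq VT) := undup (flatten (map neighbourhood s)).

Lemma mem_thicken s x y : y \in s -> x \in neighbourhood y -> x \in thicken s.
Proof.
by move=> ys xy; rewrite mem_undup; apply/flattenP; exists (neighbourhood y); rewrite ?map_f.
Qed.

(** By symmetry this is the Hilbert adjoint. It is conjugate to [M] by an isometry, and so inherits
    its norm bound and its trivial kernel. *)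
Definition adjoint_op (f : E) : E := op_conj M f.

Lemma adjoint_opE f x : adjoint_op f x = (M (ell2_conj f) x)^*.
Proof. by []. Qed.

Lemma adjoint_opB f g : adjoint_op (f - g) = adjoint_op f - adjoint_op g.
Proof.
apply: ell2_ext => x; rewrite adjoint_opE.
have -> : ell2_conj (f - g) = ell2_conj f - ell2_conj g.
  by apply: ell2_ext => y; rewrite /= rmorphB.
rewrite linearB -[LHS]/(Num.conj (M (ell2_conj f) x - M (ell2_conj g) x)).
by rewrite rmorphB.
Qed.

Lemma adjoint_op_local (f g : E) x :
  {in neighbourhood x, forall y, f y = g y} -> adjoint_op f x = adjoint_op g x.
Proof.
by move=> fg; rewrite !adjoint_opE; congr Num.conj; apply: op_local => y /fg /= ->.
Qed.

Lemma l2norm_conj (f : E) : l2norm (ell2_conj f) = l2norm f.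
Proof.
apply/eqP; rewrite -(@eqrXn2 _ 2) ?sqrtr_ge0// !l2norm_sqr; apply/eqP.
by congr fine; apply: eq_esum => x _; congr EFin; exact: nsqJ.
Qed.

Variables (K B : R).
Hypotheses (B_ge1 : 1 <= B) (M_bounded : forall f, l2norm (M f) ^+ 2 <= B * l2norm f ^+ 2).
Hypotheses (K_ge1 : 1 <= K) (M_coercive : forall f, l2norm f ^+ 2 <= K * l2norm (M f) ^+ 2).

Lemma adjoint_op_bounded f : l2norm (adjoint_op f) ^+ 2 <= B * l2norm f ^+ 2.
Proof.
by rewrite /adjoint_op /op_conj l2norm_conj -(l2norm_conj f); exact: M_bounded.
Qed.

Lemma support_op (f : E) s : (forall x, x \notin s -> f x = 0) ->
  forall x, x \notin thicken s -> M f x = 0 .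
Proof.
move=> f0 x xs; rewrite -(ell2_0E x) -(linear0 M); apply: op_local => y yx.
rewrite ell2_0E f0//; apply: contra xs => ys.
exact: (mem_thicken ys (neighbourhood_sym yx)).
Qed.

Lemma support_adjoint_op (f : E) s : (forall x, x \notin s -> f x = 0) ->
  forall x, x \notin thicken s -> adjoint_op f x = 0 .
Proof.
move=> f0 x xs; rewrite adjoint_opE (@support_op _ s) ?conjC0// => y /f0 /= ->.
by rewrite conjC0.
Qed.

Lemma l2norm_finite (f : E) s : uniq s -> (forall x, x \notin s -> f x = 0) ->
  l2norm f ^+ 2 = \sum_(x <- s) nsq (f x).
Proof.
move=> us f0; apply/eqP; rewrite eq_le (sum_bounded_seq (ell2_bounded f))// andbT.
apply: l2norm_le => X; rewrite [leRHS](perm_big [fset x in s]%fset)/=; last first.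
  by apply: uniq_perm => // x; rewrite !inE.
apply: (@sum_fset_sub _ _ (fun x => nsq (f x))) => [x|x _]; first exact: nsq_ge0.
by rewrite inE; apply: contraR => /f0 ->; rewrite nsq0.
Qed.

(** [M^* M] scaled so that its spectrum lies between [1 / (B * K)] and 1. *)
Definition normal_op (f : E) : E := B^-1%:C%C *: adjoint_op (M f).

Lemma normal_opB f g : normal_op (f - g) = normal_op f - normal_op g.
Proof. by rewrite /normal_op linearB adjoint_opB scalerBr. Qed.

Lemma ell2BE (f g : E) x : (f - g) x = f x - g x.
Proof. by []. Qed.

Lemma normal_op_local (f g : E) x :
  {in thicken (neighbourhood x), forall y, f y = g y} -> normal_op f x = normal_op g x.
Proof.
move=> fg; rewrite /normal_op !ell2ZE; congr (_ * _); apply: adjoint_op_local => y yx.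
by apply: op_local => z zy; apply: fg; exact: mem_thicken zy.
Qed.

Lemma normal_op_bounded f : l2norm (normal_op f) ^+ 2 <= l2norm f ^+ 2.
Proof.
have B0 : 0 < B by exact: lt_le_trans B_ge1.
have : l2norm (normal_op f) ^+ 2 <= nsq (B^-1%:C%C) * l2norm (adjoint_op (M f)) ^+ 2.
  apply: l2norm_le; apply: sum_bounded_le (sum_boundedZ (nsq_ge0 _) (ell2_bounded _)) => x.
  by rewrite /normal_op ell2ZE nsqM.
move=> /le_trans; apply; rewrite nsqE /= expr0n addr0.
apply: (@le_trans _ _ (B^-1 ^+ 2 * (B * (B * l2norm f ^+ 2)))).
  rewrite ler_wpM2l ?sqr_ge0//; apply: le_trans (adjoint_op_bounded _) _.
  by rewrite ler_wpM2l// ltW.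
by rewrite le_eqVlt; apply/orP; left; apply/eqP; field; rewrite gt_eqF.
Qed.

(* On finitely supported functions [<f, M^* M f> = |M f|^2] is a finite sum. *)
Lemma contraction_finite (f : E) s : uniq s -> (forall x, x \notin s -> f x = 0) ->
  l2norm (f - normal_op f) ^+ 2 <= (1 - (B * K)^-1) * l2norm f ^+ 2.
Proof.
move=> us f0; have B0 : 0 < B by exact: lt_le_trans B_ge1.
have K0 : 0 < K by exact: lt_le_trans K_ge1.
pose t := undup (s ++ thicken s ++ thicken (thicken s)).
have ut : uniq t by exact: undup_uniq.
have ft x : x \notin t -> f x = 0.
  by rewrite mem_undup !mem_cat !negb_or => /and3P[/f0].
have Mft x : x \notin t -> M f x = 0.
  by rewrite mem_undup !mem_cat !negb_or => /and3P[_ /(support_op f0)].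
have Aft x : x \notin t -> adjoint_op (M f) x = 0.
  rewrite mem_undup !mem_cat !negb_or => /and3P[_ _].
  exact/support_adjoint_op/support_op.
have := M_sym f (M f); rewrite /inner -/(adjoint_op (M f)).
rewrite !(@sum_finite_support _ _ _ t)// => [|x /Mft ->|x /Aft ->]; last 2 first.
- by rewrite mulr0.
- by rewrite mulr0.
under [RHS]eq_bigr do rewrite -nsq_real.
rewrite -rmorph_sum -(l2norm_finite ut Mft) => /(congr1 (@complex.Re R)).
rewrite raddf_sum /= => cross.
rewrite (l2norm_finite ut) => [|x xt]; last first.
  rewrite ell2BE /normal_op ell2ZE Aft// ft//.
  by rewrite mulr0 subr0.
have -> : \sum_(x <- t) nsq ((f - normal_op f) x) =
    \sum_(x <- t) nsq (f x) - 2 * B^-1 *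
      (\sum_(x <- t) complex.Re ((f x)^* * adjoint_op (M f) x))
    + B^-1 ^+ 2 * (\sum_(x <- t) nsq (adjoint_op (M f) x)).
  rewrite !mulr_sumr -sumrB -big_split; apply: eq_bigr => x _.
  rewrite ell2BE /normal_op ell2ZE.
  move: (f x) (adjoint_op (M f) x) => [a b] [c d]; rewrite !nsqE /=.
  by ring.
rewrite cross -(l2norm_finite ut ft) -(l2norm_finite ut Aft).
have h1 := adjoint_op_bounded (M f); have h2 := M_coercive f.
have h3 : B^-1 ^+ 2 * l2norm (adjoint_op (M f)) ^+ 2 <= B^-1 * l2norm (M f) ^+ 2.
  apply: le_trans (ler_wpM2l (sqr_ge0 _) h1) _.
  by rewrite le_eqVlt; apply/orP; left; apply/eqP; field; rewrite gt_eqF.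
have h4 : (B * K)^-1 * l2norm f ^+ 2 <= B^-1 * l2norm (M f) ^+ 2.
  rewrite invfM -mulrA ler_wpM2l ?invr_ge0 ?(ltW B0)//.
  by rewrite mulrC ler_pdivrMr// mulrC.
by rewrite mulrBl mul1r; lra.
Qed.

(** On a finite set [X] locality allows [f] to be truncated to a larger finite set, and the constant
    does not depend on [X]. *)
Lemma contraction (f : E) :
  l2norm (f - normal_op f) ^+ 2 <= (1 - (B * K)^-1) * l2norm f ^+ 2.
Proof.
apply: l2norm_le => X.
pose s := undup (flatten [seq x :: thicken (neighbourhood x) | x <- X]).
have [g gE] := ell2_restrict f (mem s).
have g0 x : x \notin s -> g x = 0 by rewrite gE /= => /negPf ->.
have gf : l2norm g ^+ 2 <= l2norm f ^+ 2.
  apply: l2norm_le; apply: sum_bounded_le (ell2_bounded f) => x.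
  by rewrite gE; case: ifP => // _; rewrite nsq0 nsq_ge0.
have c0 : 0 <= 1 - (B * K)^-1.
  rewrite subr_ge0 invf_le1 ?mulr_ege1// mulr_gt0//.
    exact: lt_le_trans B_ge1.
  exact: lt_le_trans K_ge1.
apply: le_trans (ler_wpM2l c0 gf).
apply: le_trans (contraction_finite (undup_uniq _) g0).
rewrite big_seq; apply: le_trans (ell2_bounded _ X); rewrite [leRHS]big_seq.
apply: ler_sum => x xX.
have sx y : y \in x :: thicken (neighbourhood x) -> y \in s.
  by move=> yx; rewrite mem_undup; apply/flattenP; exists (x :: thicken (neighbourhood x)) => //; exact: map_f.
rewrite !ell2BE.
rewrite (@normal_op_local f g) => [|y yx]; last by rewrite gE /= sx// inE yx orbT.
by rewrite gE /= sx ?mem_head.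
Qed.

Lemma l2normD_eps (eps : R) (f g : E) : 0 < eps ->
  l2norm (f + g) ^+ 2 <= (1 + eps) * l2norm f ^+ 2 + (1 + eps^-1) * l2norm g ^+ 2.
Proof.
move=> eps0; apply: l2norm_le.
have e1 : 0 <= 1 + eps by rewrite addr_ge0// ltW.
have e2 : 0 <= 1 + eps^-1 by rewrite addr_ge0// invr_ge0 ltW.
have := sum_boundedD (sum_boundedZ e1 (ell2_bounded f)) (sum_boundedZ e2 (ell2_bounded g)).
by apply: sum_bounded_le => x; rewrite ell2DE; exact: nsqD_eps.
Qed.

Lemma l2norm_sqr_le0 (f : E) : l2norm f ^+ 2 <= 0 -> f = 0.
Proof.
move=> f0; apply: ell2_ext => x; rewrite ell2_0E; apply/eqP; rewrite -nsq_eq0 eq_le.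
by rewrite nsq_ge0 andbT (le_trans (sum_bounded1 _ (ell2_bounded f)) f0).
Qed.

Lemma l2norm0_sqr : l2norm (0 : E) ^+ 2 = 0.
Proof.
apply/eqP; rewrite eq_le sqr_ge0 andbT; apply: l2norm_le => X.
by rewrite big1// => x _; rewrite ell2_0E nsq0.
Qed.

Lemma coercive_ker f : M f = 0 -> f = 0.
Proof.
move=> Mf; apply: l2norm_sqr_le0; apply: le_trans (M_coercive f) _.
by rewrite Mf l2norm0_sqr mulr0.
Qed.

Lemma adjoint_op_ker f : adjoint_op f = 0 -> f = 0.
Proof.
move=> Af; have Mf : M (ell2_conj f) = 0.
  apply: ell2_ext => x; have := congr1 (fun g : E => g x) Af.
  by rewrite adjoint_opE !ell2_0E => /eqP; rewrite conjC_eq0 => /eqP.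
by rewrite -(ell2_conjK f) (coercive_ker Mf); apply: ell2_ext => x; exact: conjC0.
Qed.

(* Richardson iteration for the normal equation [M^* M f = M^* h]. *)
Lemma op_surj (h : E) : exists f, M f = h.
Proof.
have B0 : 0 < B by exact: lt_le_trans B_ge1.
have K0 : 0 < K by exact: lt_le_trans K_ge1.
pose d := B^-1%:C%C *: adjoint_op h.
pose f n := iter n (fun g => g - normal_op g + d) 0.
pose e n := f n.+1 - f n.
have e_d n : e n = d - normal_op (f n).
  by rewrite /e /f /= addrAC [_ - _ - _]addrAC subrr add0r addrC.
(* The source [d] cancels in the increments, so these contract. *)
have eS n : e n.+1 = e n - normal_op (e n).
  rewrite (e_d n.+1) {1}e_d /e normal_opB opprB addrA subrK.
  by [].
pose q := 1 - (B * K)^-1.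
have q01 : 0 <= q < 1.
  rewrite /q subr_ge0 invf_le1 ?mulr_ege1 ?mulr_gt0//= ltrBlDr ltrDl invr_gt0.
  by rewrite mulr_gt0.
have /andP[q0 q1] := q01.
pose D := l2norm (e 0%N) ^+ 2.
have eD n : l2norm (e n) ^+ 2 <= q ^+ n * D.
  elim: n => [|n IHn]; first by rewrite expr0 mul1r.
  rewrite eS [q ^+ _]exprS -[leRHS]mulrA; apply: le_trans (contraction _) _.
  by rewrite ler_wpM2l.
have /choice[F FP] : forall x, exists l, forall eps, 0 < eps ->
    exists N, forall n, (N <= n)%N -> nsq (f n x - l) <= eps.
  move=> x; apply: (complex_geometric_limit q01 (D := D)) => n.
  by rewrite -ell2BE; apply: le_trans (eD n); exact: (sum_bounded1 _ (ell2_bounded _)).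
have unif (s : seq VT) eps : 0 < eps -> exists N, forall n, (N <= n)%N ->
    {in s, forall x, nsq (f n x - F x) <= eps}.
  move=> eps0; elim: s => [|x s [N NP]]; first by exists 0%N.
  have [N' N'P] := FP x eps eps0; exists (maxn N N') => n; rewrite geq_max.
  move=> /andP[n1 n2] y; rewrite inE => /predU1P[->|]; first exact: N'P.
  exact: NP.
pose eps := (1 - q) / 2; have eps0 : 0 < eps by rewrite divr_gt0 ?subr_gt0.
(* [B1] is the fixed point of [t -> (1 + q) / 2 * t + (1 + eps^-1) * |d|^2], and
   [(1 + eps) * q <= (1 + q) / 2]. *)
pose B1 := (1 + eps^-1) * l2norm d ^+ 2 / (1 - (1 + q) / 2).
have den0 : 0 < 1 - (1 + q) / 2 by lra.
have fB n : l2norm (f n) ^+ 2 <= B1.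
  elim: n => [|n IHn].
    rewrite l2norm0_sqr /B1 mulr_ge0 ?invr_ge0 ?(ltW den0)// mulr_ge0 ?sqr_ge0//.
    by rewrite addr_ge0// invr_ge0 ltW.
  apply: le_trans (l2normD_eps _ _ eps0) _.
  have c := le_trans (contraction (f n)) (ler_wpM2l q0 IHn).
  have B10 : 0 <= B1 by apply: le_trans IHn; exact: sqr_ge0.
  have -> : (1 + eps^-1) * l2norm d ^+ 2 = (1 - (1 + q) / 2) * B1.
    by rewrite [RHS]mulrC /B1 divfK// gt_eqF.
  have : (1 + eps) * (l2norm (f n - normal_op (f n)) ^+ 2) <= (1 + eps) * (q * B1).
    by rewrite ler_wpM2l// addr_ge0// ltW.
  have : 0 <= (1 - q) ^+ 2 * B1 by rewrite mulr_ge0 ?sqr_ge0.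
  by rewrite /eps; lra.
have [Fl FlE] : exists g : E, forall x, g x = F x.
  (* On [X] some iterate is within total squared distance 1 of [F]: [2 * B1] bounds the iterate, 2
     the error. *)
  apply: (@ell2_of_bounded _ _ _ (2 * B1 + 2)) => X.
  have X0 : 0 < (size X).+1%:R^-1 :> R by rewrite invr_gt0.
  have [N NP] := unif X _ X0.
  have le1 : \sum_(x <- X) nsq (f N x - F x) <= 1.
    rewrite big_seq; apply: (@le_trans _ _ (\sum_(x <- X | x \in X) (size X).+1%:R^-1)).
      by apply: ler_sum => x xX; exact: NP.
    rewrite -big_seq big_const_seq count_predT iter_addr_0 -[leLHS]mulr_natr mulrC.
    by rewrite ler_pdivrMr// mul1r ler_nat.
  apply: (@le_trans _ _ (2 * (\sum_(x <- X) nsq (f N x)) +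
      2 * (\sum_(x <- X) nsq (f N x - F x)))); last first.
    apply: lerD; last by rewrite -[leRHS]mulr1 ler_pM2l.
    by rewrite ler_pM2l//; exact: le_trans (ell2_bounded (f N) X) (fB N).
  rewrite !mulr_sumr -big_split; apply: ler_sum => x _.
  have := nsqD (f N x) (F x - f N x).
  by rewrite addrC subrK -opprB nsqN.
exists Fl; have PF x : normal_op Fl x = d x.
  apply/eqP; rewrite -subr_eq0 -nsq_eq0 eq_le nsq_ge0 andbT leNgt; apply/negP => v0.
  pose s := thicken (neighbourhood x).
  (* Two uses of [nsqD] give [v <= 2 * (size s * eta) + 2 * (2 * eta + 2 * eta) = n0 * eta = v /
     2]. *)
  pose n0 : R := 2 * (size s)%:R + 8; have n00 : 0 < n0 by rewrite ltr_wpDl ?mulr_ge0.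
  pose v := nsq (normal_op Fl x - d x); pose eta := v / (2 * n0).
  have eta0 : 0 < eta by apply: divr_gt0 => //; exact: mulr_gt0.
  have [N NP] := unif (x :: s) _ eta0.
  have [r rE] := ell2_restrict (Fl - f N) (mem s).
  have r0 y : y \notin s -> r y = 0 by rewrite rE /= => /negPf ->.
  have PE : normal_op Fl x - d x = normal_op r x - (f N.+1 x - F x - (f N x - F x)).
    rewrite (@normal_op_local r (Fl - f N)) => [|y ys]; last by rewrite rE /= ys.
    rewrite normal_opB ell2BE.
    have := congr1 (fun g : E => g x) (e_d N); rewrite /e !ell2BE => eN.
    have -> : f N.+1 x - F x - (f N x - F x) = f N.+1 x - f N x by ring.
    by rewrite eN; ring.
  have b1 : nsq (normal_op r x) <= (size s)%:R * eta.
    apply: le_trans (sum_bounded1 x (ell2_bounded (normal_op r))) _.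
    apply: le_trans (normal_op_bounded r) _.
    rewrite (l2norm_finite (undup_uniq _) r0) big_seq.
    apply: (@le_trans _ _ (\sum_(y <- s | y \in s) eta)).
      apply: ler_sum => y ys; rewrite rE ifT// ell2BE FlE -opprB nsqN.
      by apply: NP => //; rewrite inE ys orbT.
    by rewrite -big_seq big_const_seq count_predT iter_addr_0 mulr_natl.
  have xs : x \in x :: s by rewrite mem_head.
  have b2 := NP N (leqnn N) x xs; have b3 := NP N.+1 (leqnSn N) x xs.
  have b4 := nsqD (f N.+1 x - F x) (- (f N x - F x)).
  have b5 := nsqD (normal_op r x) (- (f N.+1 x - F x - (f N x - F x))).
  rewrite -PE -/v nsqN in b5; rewrite nsqN in b4.
  have : v <= n0 * eta by rewrite /n0; lra.
  have -> : n0 * eta = v / 2 by rewrite /eta; field; rewrite gt_eqF.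
  by apply/negP; rewrite -ltNge; rewrite -/v in v0; lra.
have BC : (B^-1%:C)%C != 0 by rewrite -nsq_eq0 nsqE /= expr0n addr0 sqrf_eq0 invr_eq0 gt_eqF.
(* The normal equation implies [M f = h] because the adjoint is injective. *)
apply/eqP; rewrite -subr_eq0; apply/eqP; apply: adjoint_op_ker.
rewrite adjoint_opB; apply/eqP; rewrite subr_eq0; apply/eqP; apply: ell2_ext => x.
by apply: (mulfI BC); have := PF x; rewrite /normal_op /d !ell2ZE.
Qed.

Lemma exists_bounded_inverse : exists N : {linear E -> E}, bounded_inverse M N.
Proof.
have M_inj f g : M f = M g -> f = g.
  move=> e; apply/eqP; rewrite -subr_eq0; apply/eqP; apply: coercive_ker.
  by rewrite linearB e subrr.
pose N0 h := sval (cid (op_surj h)).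
have MN h : M (N0 h) = h by exact: (svalP (cid (op_surj h))).
have N_lin : linear N0.
  by move=> a f g; apply: M_inj; rewrite linearP !MN.
pose N : {linear E -> E} := HB.pack N0 (GRing.isLinear.Build C E E *:%R N0 N_lin).
exists N; split; last by [].
  exists (Num.sqrt K) => f; rewrite -(@ler_pXn2r _ 2)// ?nnegrE ?mulr_ge0 ?sqrtr_ge0//.
  rewrite exprMn [Num.sqrt K ^+ 2]sqr_sqrtr ?(le_trans ler01 K_ge1)//.
  by have := M_coercive (N0 f); rewrite MN.
by move=> f; apply: M_inj; exact: MN.
Qed.

End Inversion.

(** * From a ratio system to the inverse *)

Section RatioSystemToInverse.
Context {R : realType} {VH : finType} (H : sgraph VH).
Context {VT : choiceType} (T : sgraph VT) (pi : VT -> VH).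
Context (M : {linear ell2 R VT -> ell2 R VT}).
Local Notation C := R[i].
Hypotheses (conH : connected_graph H) (covT : universal_cover T H pi).
Hypotheses (M_sym : symmetric_op M) (M_loc : local_op T M).
Hypotheses (M_con : connected_op T M) (M_pb : pulled_back T pi M).
Local Notation m := (coef T pi M).
Variable rho : VH -> VH -> option C.
Hypotheses (rhoP : pair_ratio_system H m rho)
  (decay : decay_rate m (@edge_fun _ H _ rho) < 1).

Let m_sym a b : H a b -> m a b = m b a.
Proof. exact: (coef_sym covT). Qed.

Let m_neq0 a b : H a b -> m a b != 0.
Proof. exact: (coef_neq0 covT). Qed.

Let ME f x : M f x = local_sum H T pi M f x.
Proof. exact: opE. Qed.

Lemma ratio_system_coercive : ~ is_tree H ->
  exists2 K, 1 <= K & forall f, l2norm f ^+ 2 <= K * l2norm (M f) ^+ 2.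
Proof.
move=> nontree; have [aw [kap awP]] := energy_weights_exist m_sym m_neq0 rhoP decay.
have pivot := root_pivot_neq0 m_neq0 rhoP awP conH nontree.
have [[ex _] _] := cover_tree covT; case: ex => o _.
have [K K0 KP] := coercive_bound covT m_sym m_neq0 rhoP awP pivot o.
exists (1 + K); first by rewrite lerDl.
move=> f; apply: (@le_trans _ _ (K * l2norm (M f) ^+ 2)).
  apply: l2norm_le; apply: KP (ell2_bounded f) _.
  by apply: sum_bounded_le (ell2_bounded (M f)) => x; rewrite ME.
by rewrite ler_wpM2r ?sqr_ge0// lerDr.
Qed.

Lemma ratio_system_inverse : bounded_op M -> ~ is_tree H ->
  exists N : {linear ell2 R VT -> ell2 R VT}, bounded_inverse M N.
Proof.
move=> [B BP] /ratio_system_coercive[K K1 KP].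
have B1 : 1 <= 1 + B ^+ 2 by rewrite lerDl sqr_ge0.
have MB f : l2norm (M f) ^+ 2 <= (1 + B ^+ 2) * l2norm f ^+ 2.
  apply: (@le_trans _ _ (B ^+ 2 * l2norm f ^+ 2)).
    rewrite -exprMn lerXn2r ?nnegrE ?sqrtr_ge0//.
    by apply: le_trans (BP f); exact: sqrtr_ge0.
  by rewrite ler_wpM2r ?sqr_ge0// lerDr.
exact: (exists_bounded_inverse covT M_sym M_loc M_pb B1 MB K1 KP).
Qed.

(** Rooting the tree at [w] makes [(u, v)] point away from the root. The defect estimate involves no
    pivot, so the formula also holds when [H] is a tree. *)
Lemma ratio_system_green (f : ell2 R VT) (u v w : VT) (p : seq VT) :
  M f = delta w -> T u v -> simple_path T w v p -> u \in w :: p ->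
  ~ (f v = 0 /\ f u = 0) -> gratio (f v) (f u) = rho (pi u) (pi v).
Proof.
move=> Mf uv wp up nz.
have [aw [kap awP]] := energy_weights_exist m_sym m_neq0 rhoP decay.
have vuw := branch_of_simple_path (cover_tree covT) uv wp up.
have vw : v != w by rewrite eq_sym; apply: branch_neq vuw; rewrite adj_sym.
have Lf x : x != w -> local_sum H T pi M f x = 0.
  by move=> /negPf xw; rewrite -ME Mf /= xw.
have := root_source_defect covT m_sym m_neq0 rhoP awP (ell2_bounded f) Lf vw.
have muv := m_neq0 (cover_adj covT uv).
rewrite (parentE vuw) /defect /gratio; case: (rho _ _) => [z|] /eqP.
  rewrite mulf_eq0 (negPf muv) subr_eq0 /= => /eqP zu.
  have [u0|u0] := eqVneq (f u) 0; first by case: nz; rewrite -zu u0 mulr0.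
  by rewrite -zu mulfK.
by rewrite mulf_eq0 (negPf muv) /= => ->.
Qed.

End RatioSystemToInverse.

Theorem theorem1p4 (R : realType) (VH : finType) (H : sgraph VH)
    (VT : choiceType) (T : sgraph VT) (pi : VT -> VH)
    (M : {linear ell2 R VT -> ell2 R VT}) :
  connected_graph H -> universal_cover T H pi ->
  bounded_op M -> symmetric_op M -> local_op T M -> connected_op T M ->
  pulled_back T pi M ->
  let m := coef T pi M in
  [/\ (* On a finite tree H = T the converse fails: take a single edge and the
         matrix all of whose entries are 1, with r = -1 and alpha(r) = 0. *)
      ~ is_tree H ->
        ((exists N, bounded_inverse M N) <->
         (exists r : dedge H -> option R[i],
            ratio_system m r /\ decay_rate m r < 1)),
      is_tree H ->
        (exists N, bounded_inverse M N) ->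
        (exists r : dedge H -> option R[i],
            ratio_system m r /\ decay_rate m r < 1) &
      forall N, bounded_inverse M N ->
      let G x y := N (delta x) y in
      forall r : dedge H -> option R[i],
        ratio_system m r -> decay_rate m r < 1 ->
      forall (u v w : VT) (e : dedge H) (p : seq VT),
        T u v -> val e = (pi u, pi v) ->
        simple_path T w v p -> u \in w :: p ->
        ~ (G w v = 0 /\ G w u = 0) ->
        gratio (G w v) (G w u) = r e].
Proof.
move=> conH covT M_bounded M_sym M_loc M_con M_pb m.
have to_ratio : (exists N, bounded_inverse M N) ->
    exists r : dedge H -> option R[i], ratio_system m r /\ decay_rate m r < 1.
  by move=> [N [_ MK NK]]; exact: (inverse_ratio_system conH covT) MK NK.
split=> //.
  move=> nontree; split=> // -[r [rP decay]].
  have [rho rE] := edge_fun_surj (Some 0) r; rewrite rE in rP decay.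
  move/ratio_systemP: rP => rP.
  exact: (ratio_system_inverse conH covT _ _ _ _ rP decay).
move=> N [_ _ NK] G r rP decay u v w e p uv eE wp up nz.
have [rho rE] := edge_fun_surj (Some 0) r; rewrite rE in rP decay *.
move/ratio_systemP: rP => rP.
rewrite /edge_fun /dtail /dhead eE.
exact: (ratio_system_green conH covT _ _ _ _ rP decay (NK _) uv wp up nz).
Qed.
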